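(* Let $k$ be a field, and let $X$ be a presheaf of Kan complexes on the finite étale site $fet\vert_k$ which is a sectionwise $n$-type (for some $n$). Suppose that $X$ satisfies finite descent, and that $j: X \to Z$ is an injective fibrant model. Then the map $j: X(k) \to Z(k)$ in global sections is a weak equivalence.
   Context: The finite étale site $fet\vert_k$ has as objects the finite disjoint unions of spectra $\operatorname{Sp}(L)$ of finite separable extensions $L/k$, with $k$-scheme morphisms; coverings are the (jointly) surjective families. Write $X(L)=X(\operatorname{Sp}(L))$; $\ast=\operatorname{Sp}(k)$ is terminal. A presheaf of Kan complexes is a presheaf of simplicial sets (simplicial presheaf) $X$ with every $X(U)$ a Kan complex. A map $X\to Y$ of simplicial presheaves is a local weak equivalence if $\varinjlim_{L/k}X(L)\to\varinjlim_{L/k}Y(L)$ is a weak equivalence, with $L/k$ varying over finite Galois extensions in a fixed algebraic closure of $k$. Cofibrations are monomorphisms; injective fibrations are the maps with the right lifting property with respect to cofibrations which are local weak equivalences. An injective fibrant model of $X$ is a local weak equivalence $X\to Z$ with $Z\to\ast$ an injective fibration. $\mathbf{hom}(U,X)$ is the simplicial set whose $n$-simplices are the maps $U\times\Delta^n\to X$. For $L/k$ finite Galois with group $G$, $EG\times_G\operatorname{Sp}(L)$ is the Borel construction: the simplicial presheaf whose sections at $U$ are the nerve of the translation groupoid of $G$ acting on $\hom(U,\operatorname{Sp}(L))$. $X$ satisfies finite descent if, for every finite Galois extension $L/k$ with Galois group $G$, the map $EG\times_G\operatorname{Sp}(L)\to\ast$ induces a weak equivalence $X(k)\to\mathbf{hom}(EG\times_G\operatorname{Sp}(L),X)$.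 $X$ is a sectionwise $n$-type if the canonical map $X\to\mathbf{P}_nX$ to its $n$th Moore-Postnikov section (formed sectionwise) is a weak equivalence in each section; equivalently $\pi_s(X(U),x)$ is trivial for all $U$, all vertices $x\in X(U)$ and all $s>n$. *)

(* Defs.v *)
From HB Require Import structures.
From mathcomp Require Import all_boot all_order all_fingroup all_algebra all_field.
From mathcomp Require Import boolp.
From Stdlib Require Import Relation_Operators.

Set Implicit Arguments.
Unset Strict Implicit.
Unset Printing Implicit Defensive.

Import GRing.Theory.

(* Sets are types with Leibniz equality; with functional extensionality and
   proof irrelevance, maps and natural transformations are compared
   extensionally. The universe of the sets occurring in a simplicial set is
   above that of the objects of the finite etale site, so that colimits and
   function complexes over that (essentially small) site stay inside it. *)

Record cat := Cat {
  ob :> Type;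
  hom : ob -> ob -> Type;
  idm : forall a, hom a a;
  cmp : forall a b d, hom b d -> hom a b -> hom a d;
  cmp1m : forall a b (f : hom a b), cmp (idm b) f = f;
  cmpm1 : forall a b (f : hom a b), cmp f (idm a) = f;
  cmpA : forall a b d e (h : hom d e) (g : hom b d) (f : hom a b),
    cmp h (cmp g f) = cmp (cmp h g) f }.

Arguments hom {c}.
Arguments idm {c}.

Record functor (C D : cat) := Functor {
  fob :> C -> D;
  fmor : forall a b, hom a b -> hom (fob a) (fob b);
  fmor1 : forall a, fmor (idm a) = idm (fob a);
  fmorM : forall a b c (g : hom b c) (f : hom a b),
    fmor (cmp g f) = cmp (fmor g) (fmor f) }.

Definition functor_cmp (C D E : cat) (G : functor D E) (F : functor C D) :
  functor C E.
Proof.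
refine (@Functor C E (fun a => G (F a)) (fun a b f => fmor G (fmor F f)) _ _).
- by move=> a; rewrite !fmor1.
- by move=> a b d g f; rewrite !fmorM.
Defined.

Definition ord_cat (n : nat) : cat.
Proof.
by refine (@Cat 'I_n.+1 (fun i j => (i <= j)%N) (fun i => leqnn i)
  (fun i j l jl ij => leq_trans ij jl) _ _ _) => *; exact: Prop_irrelevance.
Defined.

Record dmap (m n : nat) := DMap {
  dfun :> 'I_m.+1 -> 'I_n.+1;
  dmono : forall i j : 'I_m.+1, (i <= j)%N -> (dfun i <= dfun j)%N }.

Definition did n : dmap n n := @DMap n n id (fun _ _ h => h).

Definition dcmp m n p (f : dmap n p) (g : dmap m n) : dmap m p :=
  @DMap m p (fun i => f (g i)) (fun _ _ h => dmono f (dmono g h)).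

Lemma dmap_eq m n (f g : dmap m n) : f =1 g -> f = g.
Proof.
case: f g => [f fP] [g gP] /= /funext fg; rewrite -{g}fg in gP *.
by rewrite (Prop_irrelevance fP gP).
Qed.

Record sSet := SSet {
  simp :> nat -> Type;
  act : forall m n, dmap m n -> simp n -> simp m;
  act_id : forall n (x : simp n), act (did n) x = x;
  act_cmp : forall m n p (f : dmap n p) (g : dmap m n) (x : simp p),
    act (dcmp f g) x = act g (act f x) }.

Arguments act {s m n}.

Record sMap (X Y : sSet) := SMap {
  smap :> forall n, X n -> Y n;
  smap_act : forall m n (f : dmap m n) (x : X n),
    smap (act f x) = act f (smap x) }.

Definition smap_cmp (X Y W : sSet) (g : sMap Y W) (f : sMap X Y) : sMap X W.
Proof.
refine (@SMap X W (fun n x => g n (f n x)) _).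
by move=> m n t x; rewrite !smap_act.
Defined.

Definition simplex (p : nat) : sSet.
Proof.
refine (@SSet (fun n => dmap n p) (fun m n f x => dcmp x f) _ _).
- by move=> n x; exact: dmap_eq.
- by move=> m n q f g x; exact: dmap_eq.
Defined.

Definition sprod (X Y : sSet) : sSet.
Proof.
refine (@SSet (fun n => (X n * Y n)%type)
  (fun m n f x => (act f x.1, act f x.2)) _ _).
- by move=> n [x y] /=; rewrite !act_id.
- by move=> m n p f g [x y] /=; rewrite !act_cmp.
Defined.

Definition sunit : sSet :=
  @SSet (fun=> unit) (fun _ _ _ x => x) (fun _ _ => erefl)
    (fun _ _ _ _ _ _ => erefl).

(* The horn of dimension p with vertex i: the simplices of the standard
   p-simplex that miss some vertex other than i. *)
Definition in_horn p (i : 'I_p.+1) n (x : dmap n p) : Prop :=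
  exists j, j != i /\ forall l, x l != j.

Lemma in_horn_act p (i : 'I_p.+1) m n (f : dmap m n) (x : dmap n p) :
  in_horn i x -> in_horn i (dcmp x f).
Proof. by move=> [j [ji xj]]; exists j; split=> // l; exact: xj. Qed.

Definition horn p (i : 'I_p.+1) : sSet.
Proof.
refine (@SSet (fun n => {x : dmap n p | in_horn i x})
  (fun m n f x => exist _ (dcmp (sval x) f) (in_horn_act f (svalP x))) _ _).
- by move=> n [x xP]; apply: eq_exist; exact: dmap_eq.
- by move=> m n q f g [x xP]; apply: eq_exist; exact: dmap_eq.
Defined.

Definition horn_incl p (i : 'I_p.+1) : sMap (horn i) (simplex p) :=
  @SMap (horn i) (simplex p) (fun n x => sval x) (fun _ _ _ _ => erefl).

Definition kan (X : sSet) : Prop :=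
  forall p (i : 'I_p.+2) (h : sMap (horn i) X),
    exists s : sMap (simplex p.+1) X,
      forall n (x : horn i n), s n (horn_incl i n x) = h n x.

Definition dconst n (i : 'I_2) : dmap n 1 :=
  @DMap n 1 (fun=> i) (fun _ _ _ => leqnn i).

Definition elem_homotopic (X Y : sSet) (f g : sMap X Y) : Prop :=
  exists H : sMap (sprod X (simplex 1)) Y, forall n (x : X n),
    H n (x, dconst n ord0) = f n x /\ H n (x, dconst n ord_max) = g n x.

(* Equality in the set of path components of the function complex; for Y a
   Kan complex this coincides with [elem_homotopic]. *)
Definition homotopic (X Y : sSet) : sMap X Y -> sMap X Y -> Prop :=
  clos_refl_sym_trans _ (@elem_homotopic X Y).

(* Weak homotopy equivalences of arbitrary simplicial sets: precomposition
   with f is a bijection [Y, K] -> [X, K] on homotopy classes of maps into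
   every Kan complex K. *)
Definition weq (X Y : sSet) (f : sMap X Y) : Prop :=
  forall K : sSet, kan K ->
    (forall g h : sMap Y K,
       homotopic (smap_cmp g f) (smap_cmp h f) -> homotopic g h) /\
    (forall h : sMap X K, exists g : sMap Y K, homotopic (smap_cmp g f) h).

Section Quotient.
Variables (T : Type) (R : T -> T -> Prop).

(* The quotient by the equivalence relation generated by R, realized as the
   type of equivalence classes. *)
Definition quot : Type :=
  {S : T -> Prop | exists x, S = clos_refl_sym_trans T R x}.

Definition qcl (x : T) : quot := exist _ _ (ex_intro _ x erefl).

Lemma qcl_eq x y : clos_refl_sym_trans T R x y -> qcl x = qcl y.
Proof.
move=> xy; apply: eq_exist; apply/funext => z; apply/propext; split => h.
  by apply: rst_trans h; apply: rst_sym.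
exact: rst_trans h.
Qed.

Lemma quot_ind (P : quot -> Prop) : (forall x, P (qcl x)) -> forall q, P q.
Proof.
move=> Pcl [S SP]; have [x Sx] := SP; rewrite {S}Sx in SP *.
by have := Pcl x; congr P; exact: eq_exist.
Qed.

End Quotient.

Section QuotientMap.
Variables (T T' : Type) (R : T -> T -> Prop) (R' : T' -> T' -> Prop).
Variables (f : T -> T') (fR : forall x y, R x y -> R' (f x) (f y)).

Lemma clos_map x y :
  clos_refl_sym_trans T R x y -> clos_refl_sym_trans T' R' (f x) (f y).
Proof.
elim=> [a b /fR ab|a|a b _ ab|a b c _ ab _ bc].
- exact: rst_step.
- exact: rst_refl.
- exact: rst_sym.
- exact: rst_trans bc.
Qed.

Lemma qmap_class (S : T -> Prop) :
  (exists x, S = clos_refl_sym_trans T R x) ->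
  exists x, (fun y => exists2 z, S z & clos_refl_sym_trans T' R' (f z) y)
            = clos_refl_sym_trans T' R' x.
Proof.
case=> x ->; exists (f x).
apply/funext => y; apply/propext; split=> [[z xz zy]|xy].
  by apply: rst_trans zy; exact: clos_map.
by exists x => //; exact: rst_refl.
Qed.

Definition qmap (q : quot R) : quot R' := exist _ _ (qmap_class (svalP q)).

Lemma qmap_cl x : qmap (qcl R x) = qcl R' (f x).
Proof.
apply: eq_exist; apply/funext => y; apply/propext; split=> [[z xz zy]|xy].
  by apply: rst_trans zy; exact: clos_map.
by exists x => //; exact: rst_refl.
Qed.

End QuotientMap.

(* Two m-simplices are identified when they agree on the n-skeleton of the
   standard m-simplex, i.e. on all its simplices of dimension at most n. *)
Definition skel_eq (X : sSet) n m (x y : X m) : Prop :=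
  forall p (f : dmap p m), (p <= n)%N -> act f x = act f y.

Lemma skel_eq_act (X : sSet) n m p (f : dmap m p) (x y : X p) :
  skel_eq n x y -> skel_eq n (act f x) (act f y).
Proof. by move=> xy q g qn; rewrite -!act_cmp; exact: xy. Qed.

Definition postnikov (n : nat) (X : sSet) : sSet.
Proof.
refine (@SSet (fun m => quot (@skel_eq X n m))
  (fun m p f => qmap (@skel_eq_act X n m p f)) _ _).
- by move=> m; apply: quot_ind => x; rewrite qmap_cl act_id.
- by move=> m p q f g; apply: quot_ind => x; rewrite !qmap_cl act_cmp.
Defined.

Definition to_postnikov n (X : sSet) : sMap X (postnikov n X).
Proof.
refine (@SMap X (postnikov n X) (fun m => qcl (@skel_eq X n m)) _).
by move=> m p f x; rewrite /= qmap_cl.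
Defined.

Definition ord_functor m n (f : dmap m n) : functor (ord_cat m) (ord_cat n).
Proof.
refine (@Functor (ord_cat m) (ord_cat n) f (fun i j => @dmono m n f i j) _ _).
- by move=> i; exact: (@Prop_irrelevance (f i <= f i)%N).
- by move=> i j l h g; exact: (@Prop_irrelevance (f i <= f l)%N).
Defined.

Lemma functor_eq (C D : cat) (F0 : C -> D)
    (F1 : forall a b, hom a b -> hom (F0 a) (F0 b)) p p' q q' :
  @Functor C D F0 F1 p q = @Functor C D F0 F1 p' q'.
Proof. by rewrite (Prop_irrelevance p p') (Prop_irrelevance q q'). Qed.

Definition nerve (C : cat) : sSet.
Proof.
refine (@SSet (fun n => functor (ord_cat n) C)
  (fun m n f F => functor_cmp F (ord_functor f)) _ _).
- by move=> n [F0 F1 p q]; exact: functor_eq.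
- by move=> m n p f g F; exact: functor_eq.
Defined.

Definition nerve_map (C D : cat) (G : functor C D) : sMap (nerve C) (nerve D).
Proof.
refine (@SMap (nerve C) (nerve D) (fun n F => functor_cmp G F) _).
by move=> m n f F; exact: functor_eq.
Defined.

Section Translation.
Local Open Scope group_scope.
Variables (gT : finGroupType) (G : {group gT}).

Record gset := GSet {
  gcar :> Type;
  gact : gT -> gcar -> gcar;
  gact1 : forall s, gact 1 s = s;
  gactM : forall g h s, gact (g * h) s = gact g (gact h s) }.

Definition trans_hom (S : gset) (s t : S) : Type :=
  {g : gT | g \in G /\ gact g s = t}.

Definition translation (S : gset) : cat.
Proof.
refine (@Cat S (@trans_hom S)
  (fun s => exist _ 1 (conj (group1 G) (gact1 s)))
  (fun s t u h g => exist _ (sval h * sval g) _) _ _ _).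
- by move=> s t [g gP]; apply: eq_exist; rewrite mul1g.
- by move=> s t [g gP]; apply: eq_exist; rewrite mulg1.
- by move=> s t u v h g f; apply: eq_exist; rewrite /= mulgA.
Unshelve.
case: h g => h [Gh htu] [g [Gg gst]] /=; split; first exact: groupM.
by rewrite gactM gst.
Defined.

Definition translation_map (S S' : gset) (f : S -> S')
  (fE : forall g s, f (gact g s) = gact g (f s)) :
  functor (translation S) (translation S').
Proof.
refine (@Functor (translation S) (translation S') f
  (fun s t g => exist _ (sval g) _) _ _).
- by move=> s; exact: eq_exist.
- by move=> s t u h g; exact: eq_exist.
Unshelve.
by case: g => g [Gg gst] /=; split; rewrite // -fE gst.
Defined.

Lemma translation_functor_eq (C : cat) (S : gset)
    (F F' : functor C (translation S)) :
  F =1 F' ->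
  (forall a b (f : hom a b), sval (fmor F f) = sval (fmor F' f)) -> F = F'.
Proof.
case: F F' => [F0 F1 p q] [F0' F1' p' q'] /= /funext e0.
case: F0' / e0 F1' p' q' => F1' p' q' e1.
suff e : F1 = F1' by case: F1' / e p' q' {e1} => p' q'; exact: functor_eq.
apply: functional_extensionality_dep => a.
apply: functional_extensionality_dep => b.
apply: functional_extensionality_dep => f.
case: (F1 a b f) (F1' a b f) (e1 a b f) => [g gP] [g' gP'] /= e.
exact: eq_exist.
Qed.

End Translation.

Section Presheaves.
Variable C : cat.

Record sPre := SPre {
  sec :> C -> sSet;
  res : forall U V, hom U V -> sMap (sec V) (sec U);
  res_id : forall U n (x : sec U n), res (idm U) n x = x;
  res_cmp : forall U V W (g : hom V W) (f : hom U V) n (x : sec W n),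
    res (cmp g f) n x = res f n (res g n x) }.

Record pMap (X Y : sPre) := PMap {
  pmap :> forall U, sMap (X U) (Y U);
  pmap_res : forall U V (f : hom U V) n (x : X V n),
    pmap U n (res X f n x) = res Y f n (pmap V n x) }.

Definition pmap_cmp (X Y W : sPre) (g : pMap Y W) (f : pMap X Y) : pMap X W.
Proof.
refine (@PMap X W (fun U => smap_cmp (g U) (f U)) _).
by move=> U V h n x; rewrite /= !pmap_res.
Defined.

Lemma smap_eq (X Y : sSet) (f g : sMap X Y) : (forall n, f n =1 g n) -> f = g.
Proof.
case: f g => [f fP] [g gP] /= e.
have {}e : f = g.
  by apply: functional_extensionality_dep => n; apply/funext => x; exact: e.
by case: g / e gP => gP; rewrite (Prop_irrelevance fP gP).
Qed.

Lemma pmap_eq (X Y : sPre) (f g : pMap X Y) :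
  (forall U n, f U n =1 g U n) -> f = g.
Proof.
case: f g => [f fP] [g gP] /= e.
have {}e : f = g.
  by apply: functional_extensionality_dep => U; apply: smap_eq => n; exact: e.
by case: g / e gP => gP; rewrite (Prop_irrelevance fP gP).
Qed.

Definition pterm : sPre.
Proof.
by refine (@SPre (fun=> sunit)
  (fun U V _ => @SMap sunit sunit (fun=> id) (fun _ _ _ _ => erefl)) _ _).
Defined.

Definition to_pterm (X : sPre) : pMap X pterm.
Proof.
by refine (@PMap X pterm
  (fun U => @SMap (X U) sunit (fun _ _ => tt) (fun _ _ _ _ => erefl)) _).
Defined.

Definition ptensor (X : sPre) (K : sSet) : sPre.
Proof.
refine (@SPre (fun U => sprod (X U) K) (fun U V f =>
  @SMap (sprod (X V) K) (sprod (X U) K) (fun n x => (res X f n x.1, x.2)) _)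
  _ _).
- by move=> U n [x y] /=; rewrite res_id.
- by move=> U V W g f n [x y] /=; rewrite res_cmp.
Unshelve.
by move=> m n t [x y] /=; rewrite smap_act.
Defined.

Definition ptensor_map (X : sPre) m n (t : dmap m n) :
  pMap (ptensor X (simplex m)) (ptensor X (simplex n)).
Proof.
refine (@PMap (ptensor X (simplex m)) (ptensor X (simplex n)) (fun U =>
  @SMap (sprod (X U) (simplex m)) (sprod (X U) (simplex n))
    (fun p x => (x.1, dcmp t x.2)) _) _).
  by [].
Unshelve.
by move=> p q u [x y] /=; congr pair; exact: dmap_eq.
Defined.

Definition phom (X Y : sPre) : sSet.
Proof.
refine (@SSet (fun n => pMap (ptensor X (simplex n)) Y)
  (fun m n t f => pmap_cmp f (ptensor_map X t)) _ _).
- move=> n f; apply: pmap_eq => U p [x y] /=.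
  by congr (f U p (x, _)); exact: dmap_eq.
- move=> m n p f g h; apply: pmap_eq => U q [x y] /=.
  by congr (h U q (x, _)); exact: dmap_eq.
Defined.

Definition phom_pre (X X' Y : sPre) (f : pMap X X') :
  sMap (phom X' Y) (phom X Y).
Proof.
refine (@SMap (phom X' Y) (phom X Y) (fun n g => pmap_cmp g
  (@PMap (ptensor X (simplex n)) (ptensor X' (simplex n)) (fun U =>
    @SMap (sprod (X U) (simplex n)) (sprod (X' U) (simplex n))
      (fun p x => (f U p x.1, x.2)) _) _)) _).
  by move=> m n t g; apply: pmap_eq => U p [x y].
Unshelve.
- by move=> p q u [x y] /=; rewrite smap_act.
- by move=> U V h p [x y] /=; rewrite pmap_res.
Defined.

(* The canonical isomorphism from global sections to the function complex out
   of the terminal object, for a terminal object U0 of C. *)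
Definition global_sections (U0 : C) (bang : forall U, hom U U0)
  (bang_eq : forall U (f : hom U U0), f = bang U) (X : sPre) :
  sMap (X U0) (phom pterm X).
Proof.
refine (@SMap (X U0) (phom pterm X) (fun n x =>
  @PMap (ptensor pterm (simplex n)) X (fun U =>
    @SMap (sprod sunit (simplex n)) (X U)
      (fun p s => act s.2 (res X (bang U) n x)) _) _) _).
  move=> m n t x; apply: pmap_eq => U p [u y] /=.
  by rewrite smap_act -act_cmp.
Unshelve.
- by move=> p q f [u y] /=; rewrite act_cmp.
- move=> U V f p [u y] /=.
  by rewrite smap_act -res_cmp (bang_eq _ (cmp (bang V) f)).
Defined.

Definition cofibration (X Y : sPre) (f : pMap X Y) : Prop :=
  forall U n, injective (f U n).

Definition sectionwise_ntype (n : nat) (X : sPre) : Prop :=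
  forall U, weq (to_postnikov n (X U)).

End Presheaves.

Section FiniteEtale.
Variable k : fieldType.

(* The finite disjoint union of the spectra of the [fcomp i]. *)
Record fet_ob := FetOb {
  fidx :> finType;
  fcomp : fidx -> fieldExtType k;
  fsep : forall i, separable 1%AS {:fcomp i} }.

(* A morphism of k-schemes between such disjoint unions sends each (connected)
   component Sp(L) into one component Sp(M) of the target, by a k-algebra
   homomorphism M -> L. *)
Definition fet_hom (U V : fet_ob) : Type :=
  forall i : U, {j : V & 'AHom(fcomp j, fcomp i)}.

Definition fet_id (U : fet_ob) : fet_hom U U :=
  fun i => existT _ i \1%AF.

Definition fet_cmp (U V W : fet_ob) (g : fet_hom V W) (f : fet_hom U V) :
  fet_hom U W :=
  fun i => existT _ (tag (g (tag (f i))))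
    (tagged (f i) \o tagged (g (tag (f i))))%AF.

Lemma ahom_eq (A B : fieldExtType k) (f g : 'AHom(A, B)) : f =1 g -> f = g.
Proof. by move=> fg; apply/val_inj/lfunP. Qed.

Definition fet : cat.
Proof.
refine (@Cat fet_ob fet_hom fet_id fet_cmp _ _ _).
- move=> U V f; apply: functional_extensionality_dep => i.
  rewrite /fet_cmp /=; case: (f i) => j a /=; congr existT.
  by apply: ahom_eq => x; rewrite comp_lfunE id_lfunE.
- move=> U V f; apply: functional_extensionality_dep => i.
  rewrite /fet_cmp /=; case: (f i) => j a /=; congr existT.
  by apply: ahom_eq => x; rewrite comp_lfunE id_lfunE.
- move=> U V W Y h g f; apply: functional_extensionality_dep => i.
  rewrite /fet_cmp /=; congr existT.
  by apply: ahom_eq => x; rewrite !comp_lfunE.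
Defined.

Definition Sp (L : fieldExtType k) (Lsep : separable 1%AS {:L}) : fet :=
  @FetOb unit (fun=> L) (fun=> Lsep).

Definition Sp_map (L M : fieldExtType k) (Lsep : separable 1%AS {:L})
  (Msep : separable 1%AS {:M}) (f : 'AHom(M, L)) :
  @hom fet (Sp Lsep) (Sp Msep) := fun=> existT _ tt f.

Arguments Sp_map {L M} Lsep Msep f.

Lemma regular_sep : separable 1%AS {:k^o}.
Proof. by rewrite regular_fullv; exact: separable_refl. Qed.

Definition Spk : fet := Sp regular_sep.

Section AlgMap.
Variable L : fieldExtType k.

Definition alg_map (a : k^o) : L := (a%:A)%R.

Lemma alg_map_linear : linear alg_map.
Proof. by move=> a x y; rewrite /alg_map scalerDl -scalerA. Qed.

HB.instance Definition _ :=
  GRing.isLinear.Build k k^o L _ alg_map alg_map_linear.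

Lemma alg_map_monoid : monoid_morphism alg_map.
Proof.
by split=> [|x y]; rewrite /alg_map ?scale1r // -scalerAl mul1r scalerA.
Qed.

HB.instance Definition _ :=
  GRing.isMonoidMorphism.Build k^o L alg_map alg_map_monoid.

Definition alg_ahom : 'AHom(k^o, L) := AHom (linfun_is_ahom alg_map).

Lemma alg_ahom_eq (f : 'AHom(k^o, L)) : f = alg_ahom.
Proof.
apply: ahom_eq => x; rewrite [RHS]lfunE /= /alg_map.
by rewrite -[x in LHS]mulr1 linearZ_LR /= rmorph1.
Qed.

End AlgMap.

Definition to_Spk (U : fet_ob) : @hom fet U Spk :=
  fun i => existT _ tt (alg_ahom (fcomp i)).

Lemma to_Spk_eq (U : fet) (f : @hom fet U Spk) : f = @to_Spk U.
Proof.
apply: functional_extensionality_dep => i; rewrite /to_Spk.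
by case: (f i) => [[] a]; congr existT; exact: alg_ahom_eq.
Qed.

Section Borel.
Variables (L : splittingFieldType k) (Lgal : galois 1%AS {:L}).

Lemma galois_sep : separable 1%AS {:L}.
Proof. by case/and3P: Lgal. Qed.

Definition SpG : fet := Sp galois_sep.

(* The Galois group acts on Sp(L) contravariantly in the automorphisms of L;
   since the product of gal_of is given by (g * h) a = h (g a), this is a left
   action of the group as it stands. *)
Definition gal_Sp (g : gal_of {:L}) : hom SpG SpG :=
  Sp_map galois_sep galois_sep g.

Lemma gal_Sp1 : gal_Sp 1%g = idm SpG.
Proof.
apply: functional_extensionality_dep => -[]; congr existT.
by apply: ahom_eq => x; rewrite gal_id id_lfunE.
Qed.

Lemma gal_SpM g h : gal_Sp (g * h)%g = cmp (gal_Sp g) (gal_Sp h).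
Proof.
apply: functional_extensionality_dep => -[]; congr existT.
by apply: ahom_eq => x; rewrite galM ?memvf // comp_lfunE.
Qed.

Definition gal_gset (U : fet) : gset (gal_of {:L}).
Proof.
refine (@GSet _ (hom U SpG) (fun g s => cmp (gal_Sp g) s) _ _).
- by move=> s; rewrite gal_Sp1 cmp1m.
- by move=> g h s; rewrite gal_SpM cmpA.
Defined.

Definition borel : sPre fet.
Proof.
refine (@SPre fet
  (fun U => nerve (translation 'Gal({:L} / 1%AS)%G (gal_gset U)))
  (fun U V f => nerve_map (@translation_map _ _ (gal_gset V) (gal_gset U)
    (fun s => cmp s f) (fun g s => esym (cmpA (gal_Sp g) s f)))) _ _).
- by move=> U n F; apply: translation_functor_eq => // a; exact: cmpm1.
- by move=> U V W g f n F; apply: translation_functor_eq => // a; exact: cmpA.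
Defined.

End Borel.

Definition descent_map (X : sPre fet) (L : splittingFieldType k)
    (Lgal : galois 1%AS {:L}) : sMap (X Spk) (phom (borel Lgal) X) :=
  smap_cmp (phom_pre X (to_pterm (borel Lgal))) (global_sections to_Spk_eq X).

Definition finite_descent (X : sPre fet) : Prop :=
  forall (L : splittingFieldType k) (Lgal : galois 1%AS {:L}),
    weq (descent_map X Lgal).

Section Injective.
Variables (kbar : closedFieldType) (iota : {rmorphism k -> kbar}).

Record galsub := GalSub {
  gfld : splittingFieldType k;
  ggal : galois 1%AS {:gfld};
  gemb : {rmorphism gfld -> kbar};
  gembE : forall a : k, gemb (a%:A)%R = iota a }.

Definition gSp (E : galsub) : fet := SpG (ggal E).

(* The order relation E <= F of subfields of kbar, as an inclusion map. *)
Definition gincl (E F : galsub) (f : 'AHom(gfld E, gfld F)) : Prop :=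
  forall x, gemb F (f x) = gemb E x.

Section Colimit.
Variable X : sPre fet.

Definition colim_pt n : Type := {E : galsub & X (gSp E) n}.

Definition colim_step n (x y : colim_pt n) : Prop :=
  exists2 f : 'AHom(gfld (tag x), gfld (tag y)), gincl f &
    tagged y = res X (Sp_map (galois_sep (ggal (tag y)))
                             (galois_sep (ggal (tag x))) f) n (tagged x).

Definition colim_act m n (t : dmap m n) (x : colim_pt n) : colim_pt m :=
  existT _ (tag x) (act t (tagged x)).

Lemma colim_act_step m n (t : dmap m n) (x y : colim_pt n) :
  colim_step x y -> colim_step (colim_act t x) (colim_act t y).
Proof. by case=> f fi /= e; exists f => //=; rewrite e smap_act. Qed.

Definition colim : sSet.
Proof.
refine (@SSet (fun n => quot (@colim_step n))
  (fun m n t => qmap (@colim_act_step m n t)) _ _).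
- by move=> n; apply: quot_ind => -[E x]; rewrite qmap_cl /colim_act act_id.
- move=> m n p f g; apply: quot_ind => -[E x].
  by rewrite !qmap_cl /colim_act act_cmp.
Defined.

End Colimit.

Section ColimitMap.
Variables (X Y : sPre fet) (f : pMap X Y).

Definition colim_fun n (x : colim_pt X n) : colim_pt Y n :=
  existT _ (tag x) (f _ n (tagged x)).

Lemma colim_fun_step n (x y : colim_pt X n) :
  colim_step x y -> colim_step (colim_fun x) (colim_fun y).
Proof. by case=> g gi /= e; exists g => //=; rewrite e pmap_res. Qed.

Definition colim_map : sMap (colim X) (colim Y).
Proof.
refine (@SMap (colim X) (colim Y) (fun n => qmap (@colim_fun_step n)) _).
move=> m n t; apply: quot_ind => -[E x].
by rewrite /= !qmap_cl /colim_fun /colim_act /= smap_act.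
Defined.

End ColimitMap.

Definition local_weq (X Y : sPre fet) (f : pMap X Y) : Prop :=
  weq (colim_map f).

Definition injective_fibration (X Y : sPre fet) (p : pMap X Y) : Prop :=
  forall (A B : sPre fet) (i : pMap A B), cofibration i -> local_weq i ->
  forall (a : pMap A X) (b : pMap B Y), pmap_cmp p a = pmap_cmp b i ->
  exists h : pMap B X, pmap_cmp h i = a /\ pmap_cmp p h = b.

Definition injective_fibrant_model (X Z : sPre fet) (j : pMap X Z) : Prop :=
  local_weq j /\ injective_fibration (to_pterm Z).

End Injective.

End FiniteEtale.

(* Main.v *)
From HB Require Import structures.
From mathcomp Require Import all_boot all_order all_fingroup all_algebra all_field.
From mathcomp Require Import boolp zify algebraics_fundamentals.
From Stdlib Require Import Relation_Operators.
Require Import Defs.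

(** Let W -> Z be the path fibration of j: a section of W over U is a path in
    Z(U) that starts at a point of j(X(U)). The constant paths embed X in W
    as a weak equivalence in each section, so it is enough that the evaluation
    p : W(k) -> Z(k) at the far end of the path is a weak equivalence, and
    this holds as soon as p lifts every simplex b of Z(k) relative to its
    boundary ([pev_rlp]).

    Locally this is no problem. In the colimit over all finite Galois
    extensions, W -> Z is a Kan fibration and a weak equivalence of Kan
    complexes, hence lifts boundaries; as a simplex is a finite complex, each
    boundary problem over an extension L can be solved over some larger
    extension ([pev_solvable]). In dimensions above n + 1 it can be solved over
    L itself ([pev_high]). Indeed X fills all boundaries in these dimensions,
    being a sectionwise n-type ([ntype_fill]). So Z fills them locally, and then
    globally, because an injective fibrant presheaf is a retract of any presheaf
    into which it embeds by a local weak equivalence ([inj_fill]).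

    Write B for the Borel construction of L. Its simplices over all objects are
    freely generated, under the Galois group, by those over Sp(L), and these are
    finite in number in each dimension. A lift of b over B x Delta^m, extending
    the given one on the boundary, can therefore be built one dimension at a
    time. In each dimension up to n + 1 a larger L may be necessary, so L changes
    finitely often; after that it is fixed. The result is an extension L and a
    lift c : B x Delta^m -> W ([skeleton_lift]).

    Finite descent for X gives finite descent for W ([ppath_descent]). So c is
    homotopic, relative to the boundary, to a map that comes from a simplex d of
    W(k) ([rhlp]). In Z this homotopy joins p d to b, but it is defined on
    B x Delta^m x Delta^1 only. Since B is locally contractible and Z is
    injective fibrant, there is a homotopy with the same ends over k
    ([inj_descend]). As p is a fibration, this homotopy lifts to W(k) with start
    d, and its end is the lift of b.

    The simplicial homotopy theory used here is developed from the lifting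
    property against horns. Maps defined on a part of a simplicial set are given
    by their graphs. Weak equivalences are defined by mapping into Kan complexes,
    so that between Kan complexes they are the homotopy equivalences
    ([weq_hequiv]); a fibration that is one of these lifts against all
    monomorphisms by Dold's argument ([dold]). *)

Set Implicit Arguments.
Unset Strict Implicit.
Unset Printing Implicit Defensive.

(** * Partial simplicial maps and lifting problems *)

(** A partial simplicial map is encoded by its graph, a functional relation
    closed under the simplicial operators. A lifting or extension problem can
    then prescribe values on a union of pieces by a disjunction, without a
    simplicial set being built for the union. *)
Definition sgraph (D E : sSet) (G : forall n, D n -> E n -> Prop) : Prop :=
  (forall n x e e', G n x e -> G n x e' -> e = e') /\
  (forall m n (f : dmap m n) x e, G n x e -> G m (act f x) (act f e)).

Lemma graph_map (D E : sSet) (G : forall n, D n -> E n -> Prop) :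
  sgraph G -> (forall n x, exists e, G n x e) ->
  exists h : sMap D E, forall n x, G n x (h n x).
Proof.
move=> [Gf Ga] Gt; have t n x := cid (Gt n x).
have hact m n (f : dmap m n) x : sval (t m (act f x)) = act f (sval (t n x)).
  by apply: (Gf _ _ _ _ (svalP (t m (act f x)))); apply: Ga; exact: svalP.
by exists (SMap hact) => n x /=; exact: svalP.
Qed.

Definition sclosed (D : sSet) (S : forall n, D n -> Prop) : Prop :=
  forall m n (f : dmap m n) x, S n x -> S m (act f x).

(** The right lifting property of p against the inclusion of S into D. The
    lift has to agree with G on S only, so that one graph can serve several
    subcomplexes. *)
Definition rlp (D : sSet) (S : forall n, D n -> Prop) (E F : sSet)
    (p : sMap E F) : Prop :=
  forall (G : forall n, D n -> E n -> Prop) (b : sMap D F),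
  sgraph G -> (forall n x, S n x -> exists e, G n x e) ->
  (forall n x e, G n x e -> p n e = b n x) ->
  exists h : sMap D E,
    (forall n x e, S n x -> G n x e -> h n x = e) /\
    (forall n x, p n (h n x) = b n x).

(** The inclusion of S is a retract of the inclusion of [S']; lifting
    properties pass to retracts. *)
Lemma rlp_retract (D D' : sSet) (S : forall n, D n -> Prop)
    (S' : forall n, D' n -> Prop) (s : sMap D D') (r : sMap D' D)
    (E F : sSet) (p : sMap E F) :
  (forall n x, r n (s n x) = x) -> (forall n x, S n x -> S' n (s n x)) ->
  (forall n y, S' n y -> S n (r n y)) -> rlp S' p -> rlp S p.
Proof.
move=> rs sS rS' lS' G b [Gf Ga] GS Gb.
have [||n y e /Gb|h [hG hb]] :=
  lS' (fun n y e => G n (r n y) e) (smap_cmp b r) _ _ _.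
- split=> [n y e e'|m n f y e]; first exact: Gf.
  by rewrite smap_act; exact: Ga.
- by move=> n y /rS'; exact: GS.
- by [].
- exists (smap_cmp h s); split=> [n x e Sx Gx|n x] /=.
    by apply: hG; [exact: sS|rewrite rs].
  by rewrite hb /= rs.
Qed.

Definition bdry p n (x : simplex p n) : Prop := exists j, forall l, x l != j.

Lemma bdry_scl p : sclosed (@bdry p).
Proof. by move=> m n f x [j xj]; exists j => l; exact: xj. Qed.

(** The Yoneda map of a simplex. *)
Definition cls (X : sSet) n (x : X n) : sMap (simplex n) X.
Proof.
refine (@SMap (simplex n) X (fun m f => act f x) _).
by move=> m q f g; rewrite -act_cmp.
Defined.

Lemma cls_id (X : sSet) n (h : sMap (simplex n) X) m (f : dmap m n) :
  h m f = act f (h n (did n)).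
Proof. by rewrite -smap_act; congr (h m); exact: dmap_eq. Qed.

Definition face n (j : 'I_n.+2) : dmap n n.+1.
Proof.
refine (@DMap n n.+1 (lift j) _).
by move=> a b ab; rewrite /= /bump; lia.
Defined.

(** A missed vertex j can be deleted: the map then factors through the j-th
    face. *)
Lemma bdry_face p m (f : simplex p.+1 m) : bdry f ->
  exists j (g : dmap m p), f = dcmp (face j) g.
Proof.
move=> [j fj]; exists j.
have u i : {l | f i = lift j l}.
  by case: (unliftP j (f i)) => [l ->|e]; [exists l|have := fj i; rewrite e eqxx].
have um (a b : 'I_m.+1) : (a <= b)%N -> (sval (u a) <= sval (u b))%N.
  move=> /(dmono f); case: (u a) (u b) => [la ea] [lb eb] /=.
  by rewrite ea eb /= /bump; lia.
by exists (DMap um); apply: dmap_eq => i /=; case: (u i).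
Qed.

Lemma bdry0 m (f : simplex 0 m) : ~ bdry f.
Proof. by move=> [j fj]; have := fj ord0; rewrite (ord1 j) (ord1 (f ord0)). Qed.

(** Surjective order-preserving maps split, and any prescribed element a of a
    fibre can be the value of the section there. Hence two surjections with
    the same sections are equal, which [add_cells] uses to compare
    degeneracies. *)
Lemma surj_section m n (f : dmap m n) (a : 'I_m.+1) : ~ @bdry n m f ->
  exists d : dmap n m, dcmp f d = did n /\ d (f a) = a.
Proof.
move=> nb.
have sj j : exists l, f l = j.
  apply: contrapT => nl; apply: nb; exists j => l; apply/eqP => e.
  by apply: nl; exists l.
have sj' j : {l | f l = j & (j = f a -> l = a)}.
  apply: cid2; have [->|ja] := pselect (j = f a); first by exists a.
  by have [l fl] := sj j; exists l => // /ja.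
pose d j := s2val (sj' j).
have fd j : f (d j) = j by exact: (s2valP (sj' j)).
have dm (i j : 'I_n.+1) : (i <= j)%N -> (d i <= d j)%N.
  move=> ij; rewrite leqNgt; apply/negP => lt.
  have := dmono f (ltnW lt); rewrite !fd => ji.
  have e : i = j by apply/val_inj/eqP; rewrite eqn_leq ij ji.
  by rewrite e ltnn in lt.
exists (DMap dm); split; first exact: dmap_eq.
exact: (s2valP' (sj' (f a))).
Qed.

Lemma inj_endo n (d : dmap n n) : injective d -> d = did n.
Proof.
move=> dI.
have dlt (i j : 'I_n.+1) : (i < j)%N -> (d i < d j)%N.
  move=> ij; rewrite ltn_neqAle (dmono d (ltnW ij)) andbT.
  by apply: contraTneq ij => /val_inj /dI ->; rewrite ltnn.
have up q (i : 'I_n.+1) : i = q :> nat -> (i <= d i)%N.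
  elim: q i => [|q IH] i iq; first by have := iq; lia.
  have qn : (q < n.+1)%N by have := ltn_ord i; lia.
  have := IH (Ordinal qn) erefl; have := dlt (Ordinal qn) i; rewrite /=; lia.
have down q (i : 'I_n.+1) : (i + q = n)%N -> (d i <= i)%N.
  elim: q i => [|q IH] i iq; first by have := ltn_ord (d i); lia.
  have qn : (i.+1 < n.+1)%N by lia.
  have := IH (Ordinal qn); have := dlt i (Ordinal qn); rewrite /=; lia.
apply: dmap_eq => i; apply/val_inj/eqP; rewrite eqn_leq (up i i) // andbT.
by apply: (down (n - i)); have := ltn_ord i; lia.
Qed.

Lemma surj_endo n (f : dmap n n) : ~ @bdry n n f -> f = did n.
Proof.
move=> nb; have [d [fd _]] := surj_section ord0 nb.
have fdj l : f (d l) = l by rewrite -[l in RHS]/(did n l) -fd.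
have e : d = did n by apply: inj_endo; exact: can_inj fdj.
by apply: dmap_eq => i; have := fdj i; rewrite e.
Qed.

(** * Extending maps over the skeleta of a freely generated presheaf *)

(** The simplices of B over all objects are restrictions of simplices over V,
    in a way unique up to the endomorphisms of V, which act transitively on
    the choices ([fg_tors]) and freely on vertices ([fg_free]). The Borel
    construction of a Galois extension has this property at the spectrum of
    the extension. A map out of B is then determined by equivariant data over
    V. *)
Record freely_generated (C : cat) (B : sPre C) (V : C) : Prop := FreelyGenerated {
  fg_gen : forall U n (x : B U n), exists (f : hom U V) (y : B V n), x = res B f n y;
  fg_free : forall U (f f' : hom U V) (y : B V 0%N),
    res B f 0%N y = res B f' 0%N y -> f = f';
  fg_tors : forall U n (f f' : hom U V) (x y : B V n),
    res B f n x = res B f' n y -> exists h, x = res B h n y }.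

Lemma ptensor_freely_generated (C : cat) (B : sPre C) (V : C) (D : sSet) :
  freely_generated B V -> freely_generated (ptensor B D) V.
Proof.
move=> [gen free tors]; split.
- by move=> U n [x d]; have [f [y ->]] := gen U n x; exists f, (y, d).
- by move=> U f f' [y d] e; apply: (free U f f' y); exact: (congr1 fst e).
- move=> U n f f' [x d] [y d'] e.
  have [h ->] := tors _ _ _ _ _ _ (congr1 fst e : res B f n x = res B f' n y).
  by exists h; congr pair; exact: (congr1 snd e).
Qed.

Section Cells.
Variables (C : cat) (B E : sPre C) (V : C).
Variable adm : forall U n, B U n -> E U n -> Prop.
Hypothesis adm_res : forall U W (f : hom U W) n x e,
  @adm W n x e -> adm (res B f n x) (res E f n e).
Hypothesis adm_act : forall U m n (f : dmap m n) x e,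
  @adm U n x e -> adm (act f x) (act f e).
Hypothesis fgB : freely_generated B V.

Definition pdom (G : forall U n, B U n -> E U n -> Prop) U n x : Prop :=
  exists e, G U n x e.

(** The partial maps G from B to E that are natural, satisfy the constraint
    adm, and are saturated: being defined on a restriction of x forces being
    defined on x. Saturation keeps the domain a union of free orbits, so that
    a cell outside the domain meets it only along its boundary. *)
Record valid (G : forall U n, B U n -> E U n -> Prop) : Prop := Valid {
  v_fun : forall U n x e e', G U n x e -> G U n x e' -> e = e';
  v_res : forall U W (f : hom U W) n x e,
    G W n x e -> G U n (res B f n x) (res E f n e);
  v_act : forall U m n (f : dmap m n) x e,
    G U n x e -> G U m (act f x) (act f e);
  v_adm : forall U n x e, G U n x e -> adm x e;
  v_sat : forall U (f : hom U V) n (x : B V n),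
    pdom G (res B f n x) -> pdom G x }.

Definition gle (G H : forall U n, B U n -> E U n -> Prop) : Prop :=
  forall U n x e, G U n x e -> H U n x e.

Section AddCells.
Variables (G : forall U n, B U n -> E U n -> Prop) (vG : valid G) (n : nat).
Variables (R : B V n -> Prop) (w : B V n -> E V n).
Hypothesis RG : forall t, R t -> ~ pdom G t.
Hypothesis Rorb : forall t t' (h : hom V V), R t -> R t' ->
  t = res B h n t' -> t = t'.
Hypothesis Rw : forall t, R t -> adm t (w t).
Hypothesis bG : forall t m (f : simplex n m), R t -> bdry f ->
  G (act f t) (act f (w t)).

Let H U m (x : B U m) (e : E U m) : Prop :=
  G x e \/ exists t (g : hom U V) (f : dmap m n),
    [/\ R t, x = res B g m (act f t) & e = res E g m (act f (w t))].

Let nondeg t m (f : dmap m n) : R t -> pdom G (act f t) -> @bdry n m f.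
Proof.
move=> Rt d; apply: contrapT => nb; apply: (RG Rt).
have [s [fs _]] := surj_section ord0 nb.
case: d => e Ge; exists (act s e).
by have := v_act vG s Ge; rewrite -act_cmp fs act_id.
Qed.

Let cell_fun t t' m (f f' : dmap m n) U (g g' : hom U V) : R t -> R t' ->
  res B g m (act f t) = res B g' m (act f' t') ->
  res E g m (act f (w t)) = res E g' m (act f' (w t')).
Proof.
move=> Rt Rt' e; have [h eh] := fg_tors fgB e.
have [nf|nf] := pselect (@bdry n m f).
  have nf' : @bdry n m f'.
    apply: (nondeg Rt'); apply: (v_sat vG (f := h)); rewrite -eh.
    by exists (act f (w t)); exact: bG.
  have := v_res vG g' (bG Rt' nf'); rewrite -e => G1.
  exact: (v_fun vG (v_res vG g (bG Rt nf)) G1).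
(* f is surjective, and then so is f'; they have the same sections. *)
have nf' : ~ @bdry n m f'.
  move=> nf'; apply: nf; apply: (nondeg Rt); rewrite eh.
  by exists (res E h m (act f' (w t'))); apply: v_res => //; exact: bG.
have sec s : dcmp f s = did n -> t = res B h n (act (dcmp f' s) t').
  by move=> fs; rewrite act_cmp smap_act -eh -act_cmp fs act_id.
have f's s : dcmp f s = did n -> dcmp f' s = did n.
  move=> fs; apply: surj_endo => nb; apply: (RG Rt).
  rewrite (sec s fs); exists (res E h n (act (dcmp f' s) (w t'))).
  by apply: v_res => //; exact: bG.
have ff : f = f'.
  apply: dmap_eq => i; have [s [fs si]] := surj_section i nf.
  by rewrite -{2}si -[RHS]/(dcmp f' s (f i)) f's.
rewrite -{f' f's sec nf'}ff in e eh *.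
have tt : t = t'.
  have [s [fs _]] := surj_section ord0 nf.
  apply: (Rorb Rt Rt' (h := h)); have := congr1 (act s) eh.
  by rewrite -smap_act -!act_cmp fs !act_id.
rewrite -{t' Rt' eh}tt in e *; suff -> : g = g' by [].
pose v : dmap 0 n := @DMap 0 n (fun=> ord0) (fun _ _ _ => leqnn _).
apply: (fg_free fgB (y := act v t)).
have [s [fs _]] := surj_section ord0 nf.
have -> : v = dcmp f (dcmp s v).
  by apply: dmap_eq => i; rewrite -[LHS]/(did n ord0) -fs.
by have := congr1 (act (dcmp s v)) e; rewrite -!smap_act -!act_cmp.
Qed.

Let cross t U m (g : hom U V) (f : dmap m n) e : R t ->
  G (res B g m (act f t)) e -> e = res E g m (act f (w t)).
Proof.
move=> Rt Ge; apply: (v_fun vG Ge); apply: v_res => //; apply: bG => //.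
by apply: (nondeg Rt); apply: (v_sat vG (f := g)); exists e.
Qed.

(** One representative t in R for each orbit of missing n-cells, with values w
    t extending G along the boundary of t, determine an extension of G to the
    orbits of these cells and their degeneracies. The value on the restriction
    along g of a degeneracy f of t must be the corresponding restriction of f
    applied to w t; this is unambiguous because the orbits are free and a
    degenerate simplex has only one nondegenerate root. *)
Lemma add_cells : valid H /\ gle G H /\ forall t, R t -> pdom H t.
Proof.
split; last split.
- split.
  + move=> U m x e e' [Ge|[t [g [f [Rt -> ->]]]]] [Ge'|[t' [g' [f' [Rt' e1 ->]]]]].
    * exact: (v_fun vG Ge Ge').
    * by rewrite e1 in Ge; exact: cross.
    * by rewrite (cross Rt Ge').
    * exact: cell_fun.
  + move=> U W f m x e [Ge|[t [g [f' [Rt -> ->]]]]]; first by left; exact: v_res.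
    by right; exists t, (cmp g f), f'; rewrite !res_cmp.
  + move=> U p m f x e [Ge|[t [g [f' [Rt -> ->]]]]]; first by left; exact: v_act.
    by right; exists t, g, (dcmp f' f); rewrite !act_cmp !smap_act.
  + move=> U m x e [/(v_adm vG)//|[t [g [f [Rt -> ->]]]]].
    by apply: adm_res; apply: adm_act; exact: Rw.
  + move=> U f m x [e [Ge|[t [g [f' [Rt ex ee]]]]]].
      by have [e' Ge'] := v_sat vG (ex_intro _ e Ge); exists e'; left.
    have [h ->] := fg_tors fgB ex; exists (res E h m (act f' (w t))).
    by right; exists t, h, f'.
- by move=> U m x e Ge; left.
- move=> t Rt; exists (w t); right; exists t, (idm V), (did n).
  by rewrite !res_id !act_id.
Qed.

End AddCells.

Variable M : nat -> Prop.
Variable G0 : forall U n, B U n -> E U n -> Prop.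
Hypothesis vG0 : valid G0.
Hypothesis step : forall (G : forall U n, B U n -> E U n -> Prop), valid G -> gle G0 G ->
  forall n (t : B V n), M n -> ~ pdom G t ->
  (forall m (f : simplex n m), bdry f -> pdom G (act f t)) ->
  exists w, adm t w /\ forall m (f : simplex n m) e, bdry f ->
    G V m (act f t) e -> e = act f w.
Hypothesis Mdown : forall n, M n.+1 -> M n.

Let orb n (t t' : B V n) : Prop := exists h, t = res B h n t'.

Let orb_sym n (t t' : B V n) : orb t t' -> orb t' t.
Proof.
case=> h e; apply: (fg_tors fgB (f := h) (f' := idm V)).
by rewrite res_id e.
Qed.

Let orb_eq n (t t' : B V n) : orb t t' -> orb t = orb t'.
Proof.
move=> tt; apply/funext => s; apply/propext; split=> [ts|ts].
  case: (orb_sym tt) ts => h -> [h' ->]; exists (cmp h' h); by rewrite res_cmp.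
by case: tt ts => h -> [h' ->]; exists (cmp h' h); rewrite res_cmp.
Qed.

Let fill_dim n (G : forall U n, B U n -> E U n -> Prop) :
  valid G -> gle G0 G ->
  (forall U m (x : B U m), (m < n)%N -> M m -> pdom G x) ->
  exists H, [/\ valid H, gle G H &
    forall U m (x : B U m), (m < n.+1)%N -> M m -> pdom H x].
Proof.
move=> vG G0G Gn; have [Mn|nM] := pselect (M n); last first.
  exists G; split=> // U m x; rewrite ltnS leq_eqVlt => /orP[/eqP e|mn].
    by move=> Mm; case: nM; rewrite -e.
  exact: Gn.
have bd (t : B V n) m (f : simplex n m) : bdry f -> pdom G (act f t).
  case: n t f Mn Gn => [|n] t f Mn Gn; first by move/bdry0.
  move=> /bdry_face[j [g ->]]; rewrite act_cmp.
  have [e Ge] := Gn _ _ (act (face j) t) (ltnSn n) (Mdown Mn).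
  by exists (act g e); exact: v_act.
have wP (t : B V n) : {w | ~ pdom G t -> adm t w /\
    forall m (f : simplex n m) e, bdry f -> G V m (act f t) e -> e = act f w}.
  apply: cid; have [[e te]|nt] := pselect (pdom G t).
    by exists e => nt; case: nt; exists e.
  by have [w wP] := step vG G0G Mn nt (bd t); exists w.
have repP (t : B V n) : exists s, orb t s by exists t, (idm V); rewrite res_id.
pose rep (t : B V n) := sval (cid (repP t)).
have repE t t' : orb t t' -> rep t = rep t'.
  move=> /orb_eq e; rewrite /rep; move: (repP t) (repP t'); rewrite e => a b.
  by rewrite (Prop_irrelevance a b).
pose R t := ~ pdom G t /\ rep t = t.
have [H [vH [GH HR]]] : exists H, valid H /\ gle G H /\ forall t, R t -> pdom H t.
  eexists; apply: (@add_cells G vG n R (fun t => sval (wP t))).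
  - by move=> t [].
  - by move=> t t' h [_ rt] [_ rt'] e; rewrite -rt -rt'; apply: repE; exists h.
  - by move=> t [nt _]; case: (wP t) => w /= /(_ nt)[].
  - move=> t m f [nt _] bf; case: (wP t) => w /= /(_ nt)[_ bw].
    by have [e Ge] := bd t m f bf; rewrite -(bw _ _ _ bf Ge).
exists H; split=> // U m x; rewrite ltnS leq_eqVlt => /orP[/eqP e|mn] Mm; last first.
  by have [e Ge] := Gn U m x mn Mm; exists e; exact: GH.
move: x; rewrite {m Mm}e => x; have [f [y ->]] := fg_gen fgB x.
suff [e He] : pdom H y by exists (res E f n e); exact: v_res.
have [[e Ge]|ny] := pselect (pdom G y); first by exists e; apply: GH.
have [h eh] := svalP (cid (repP y)); rewrite -/(rep y) in eh.
have [|e He] := HR (rep y).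
  split; last by symmetry; apply: repE; exists h.
  by case=> e Ge; apply: ny; rewrite eh; exists (res E h n e); exact: v_res.
by exists (res E h n e); rewrite {1}eh; exact: v_res.
Qed.

(** The skeletal induction: when each missing cell can be given a value
    compatible with those on its boundary, the partial map extends to all
    simplices whose dimension lies in M. *)
Lemma cells : exists G, [/\ valid G, gle G0 G & forall U n (x : B U n),
  M n -> pdom G x].
Proof.
pose T n := {G | valid G /\ gle G0 G /\
  forall U m (x : B U m), (m < n)%N -> M m -> pdom G x}.
have next n (a : T n) : {b : T n.+1 | gle (sval a) (sval b)}.
  apply: cid; case: a => G [vG [G0G Gn]].
  have [H [vH GH Hn]] := fill_dim vG G0G Gn.
  have G0H : gle G0 H by move=> U m x e /G0G /GH.
  by exists (exist _ H (conj vH (conj G0H Hn))).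
have [a0 a0E] : {a0 : T 0%N | sval a0 = G0}.
  by unshelve eexists; first by exists G0; split=> //; split.
pose a := nat_rect T a0 (fun n b => sval (next n b)).
have am m n : (m <= n)%N -> gle (sval (a m)) (sval (a n)).
  elim: n => [|n IH]; first by rewrite leqn0 => /eqP ->.
  rewrite leq_eqVlt => /orP[/eqP ->//|/IH mn] U q x e /mn.
  exact: (svalP (next n (a n))).
pose G U n x e := exists m, sval (a m) U n x e.
have vG : valid G.
  split.
  + move=> U n x e e' [b be] [c ce].
    exact: (v_fun (svalP (a (maxn b c))).1
      (am b _ (leq_maxl b c) _ _ _ _ be) (am c _ (leq_maxr b c) _ _ _ _ ce)).
  + by move=> U W f n x e [b be]; exists b; apply: (v_res (svalP (a b)).1).
  + by move=> U m n f x e [b be]; exists b; apply: (v_act (svalP (a b)).1).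
  + by move=> U n x e [b be]; apply: (v_adm (svalP (a b)).1 be).
  + move=> U f n x [e [b be]].
    have [e' be'] := v_sat (svalP (a b)).1 (ex_intro _ e be).
    by exists e', b.
exists G; split; first exact: vG.
  by move=> U n x e ge; exists 0%N; rewrite /= a0E.
move=> U n x Mn.
have [_ [_ an]] := svalP (a n.+1).
by have [e ae] := an U n x (ltnSn n) Mn; exists e, n.+1.
Qed.

End Cells.

(** * Cell induction, function complexes and attaching simplices *)

Definition one_cat : cat.
Proof.
by refine (@Cat unit (fun _ _ => unit) (fun=> tt) (fun _ _ _ _ _ => tt) _ _ _)
  => // a b; case.
Defined.

Definition sid (X : sSet) : sMap X X := @SMap X X (fun=> id) (fun _ _ _ _ => erefl).

Definition const_pre (X : sSet) : sPre one_cat :=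
  @SPre one_cat (fun=> X) (fun _ _ _ => sid X) (fun _ _ _ => erefl)
    (fun _ _ _ _ _ _ _ => erefl).

(** The case of presheaves on the point: a simplicial set is freely generated
    in the trivial way. *)
Lemma scells (B E : sSet) (adm G0 : forall n, B n -> E n -> Prop) :
  (forall m n (f : dmap m n) x e, adm n x e -> adm m (act f x) (act f e)) ->
  sgraph G0 -> (forall n x e, G0 n x e -> adm n x e) ->
  (forall G : forall n, B n -> E n -> Prop, sgraph G ->
    (forall n x e, G0 n x e -> G n x e) ->
    (forall n x e, G n x e -> adm n x e) ->
    forall n (t : B n), (forall m (f : simplex n m), bdry f -> exists e, G m (act f t) e) ->
    exists w, adm n t w /\ forall m (f : simplex n m) e, bdry f ->
      G m (act f t) e -> e = act f w) ->
  exists h : sMap B E, (forall n x, adm n x (h n x)) /\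
    (forall n x e, G0 n x e -> h n x = e).
Proof.
move=> adma [G0f G0a] G0adm step.
have [||||||G [vG G0G Gt]] := @cells one_cat (const_pre B) (const_pre E) tt
  (fun _ => adm) _ _ _ (fun=> True) (fun _ => G0) _ _ _.
- by [].
- by move=> U; exact: adma.
- split; [by move=> U n x; exists tt, x|by move=> U [] []|].
  by move=> U n f f' x y e; exists tt.
- by split=> // U.
- move=> G vG G0G n t _ _ bt; apply: (step (G tt)) => //.
  + by split; [move=> m x e e'; exact: (v_fun vG)|move=> m q f x e; exact: (v_act vG)].
  + by move=> m x e; exact: G0G.
  + by move=> m x e; exact: (v_adm vG).
- by [].
have [||h hG] := @graph_map B E (G tt).
- by split; [move=> m x e e'; exact: (v_fun vG)|move=> m q f x e; exact: (v_act vG)].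
- by move=> n x; exact: Gt.
exists h; split=> [n x|n x e g0]; first exact: (v_adm vG (hG n x)).
exact: (v_fun vG (hG n x) (G0G tt _ _ _ g0)).
Qed.

(** Lifting against the boundary inclusions gives lifting against all
    inclusions, one cell at a time. *)
Lemma rlp_cells (E F : sSet) (p : sMap E F) :
  (forall n, rlp (@bdry n) p) -> forall (D : sSet) (S : forall n, D n -> Prop), rlp S p.
Proof.
move=> lb D S G b sG GS Gb.
have [|G' sG' GG' Gb' n t bt|h [hb hG]] :=
  @scells D E (fun n x e => p n e = b n x) G _ sG Gb.
- by move=> m n f x e; rewrite !smap_act => ->.
- have [|||h [hG hb]] := lb n (fun m f e => G' m (act f t) e) (smap_cmp b (cls t)).
  + split=> [m f e e'|m q g f e]; first by case: sG' => Gf _; exact: Gf.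
    by move=> ge; rewrite /= act_cmp; apply: sG'.2.
  + by move=> m f; exact: bt.
  + by move=> m f e /Gb'.
  exists (h n (did n)); split; first by rewrite hb /= act_id.
  by move=> m f e bf Ge; rewrite -cls_id; symmetry; exact: hG.
- by exists h; split=> // n x e _; exact: hG.
Qed.

(** The domain of the pushout product of two inclusions. *)
Definition box (B D : sSet) (S : forall n, B n -> Prop) (T : forall n, D n -> Prop)
  n (z : sprod B D n) : Prop := S n z.1 \/ T n z.2.

Definition ptP (e : 'I_2) n (t : simplex 1 n) : Prop := forall l, t l = e.

Definition ihom (D E : sSet) : sSet.
Proof.
refine (@SSet (fun n => sMap (sprod (simplex n) D) E)
  (fun m n f g => @SMap (sprod (simplex m) D) E
     (fun q z => g q (dcmp f z.1, z.2)) _) _ _).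
- by move=> n x; apply: smap_eq => q [a b] /=; congr (x q (_, _)); exact: dmap_eq.
- by move=> m n q f g x; apply: smap_eq => r [a b] /=; congr (x r (_, _)); exact: dmap_eq.
Unshelve.
by move=> q r h [a b] /=; rewrite -smap_act /=; congr (g q (_, _)); exact: dmap_eq.
Defined.

Definition curry (B D E : sSet) (h : sMap (sprod B D) E) : sMap B (ihom D E).
Proof.
refine (@SMap B (ihom D E) (fun n x => @SMap (sprod (simplex n) D) E
  (fun q z => h q (act z.1 x, z.2)) _) _).
  by move=> m n f x; apply: smap_eq => q [a b] /=; rewrite act_cmp.
Unshelve.
by move=> q r f [a b] /=; rewrite -smap_act /= act_cmp.
Defined.

Definition uncurry (B D E : sSet) (h : sMap B (ihom D E)) : sMap (sprod B D) E.
Proof.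
refine (@SMap (sprod B D) E (fun n z => h n z.1 n (did n, z.2)) _).
move=> m n f [x d] /=; rewrite !smap_act /= -smap_act /=.
by congr (h n x m (_, _)); exact: dmap_eq.
Defined.

Lemma ihom_ev (D E : sSet) n (g : ihom D E n) m (f : dmap m n) d :
  g m (f, d) = act f g m (did m, d).
Proof. by rewrite /=; congr (g m (_, _)); exact: dmap_eq. Qed.

Lemma ihom_eq (D E : sSet) n (g g' : ihom D E n) :
  (forall m (f : dmap m n) d, g m (f, d) = g' m (f, d)) -> g = g'.
Proof. by move=> e; apply: smap_eq => m [f d]; exact: e. Qed.

Definition hornP p (i : 'I_p.+1) n (x : simplex p n) : Prop := in_horn i x.

Definition kan_fib (E F : sSet) (p : sMap E F) : Prop :=
  forall n (i : 'I_n.+2), rlp (@hornP n.+1 i) p.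

(** The homotopy lifting property relative to an arbitrary subcomplex, from
    either end of the cylinder. Every Kan fibration has it ([kan_fib_cyl]),
    and in this form it is used throughout. *)
Definition cyl_fib (E F : sSet) (p : sMap E F) : Prop :=
  forall (B : sSet) (S : forall n, B n -> Prop) (e : 'I_2), sclosed S ->
  rlp (box S (@ptP e)) p.

Section Attach.
Variables (D E F : sSet) (p : sMap E F) (b : sMap D F).

Definition partial_lift (S : forall n, D n -> Prop) (G : forall n, D n -> E n -> Prop) :=
  [/\ sgraph G, (forall n x e, G n x e -> p n e = b n x) &
    forall n x, (exists e, G n x e) <-> S n x].

(** Adjoining one simplex s to the domain S of a partial lift: if the
    operators act freely on s, the simplex generated by s meets S in a
    subcomplex H of the standard simplex, and the lift extends as soon as p
    lifts against H. *)
Lemma attach (S : forall n, D n -> Prop) G n (s : D n) (H : forall m, simplex n m -> Prop) :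
  partial_lift S G -> (forall m (f g : dmap m n), act f s = act g s -> f = g) ->
  (forall m (f : dmap m n), S m (act f s) <-> H m f) -> rlp H p ->
  exists G', partial_lift (fun m x => S m x \/ exists f, x = act f s) G' /\
    forall m x e, G m x e -> G' m x e.
Proof.
move=> [sG Gb GS] si SH lH.
have [|||h [hG hb]] := lH (fun m f e => G m (act f s) e) (smap_cmp b (cls s)).
- split=> [m f e e'|m q g f e ge]; first by case: sG => Gf _; exact: Gf.
  by rewrite /= act_cmp; apply: sG.2.
- by move=> m f /SH /GS.
- by move=> m f e /Gb.
exists (fun m x e => G m x e \/ exists2 f, x = act f s & e = h m f).
have cr m f e : G m (act f s) e -> e = h m f.
  move=> Ge; symmetry; apply: hG => //; apply/SH/GS; by exists e.
split; last by move=> m x e; left.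
split.
- split=> [m x e e'|m q g x e].
  + move=> [Ge|[f ef ->]] [Ge'|[f' ef' ->]].
    * by case: sG => Gf _; exact: Gf Ge Ge'.
    * by apply: cr; rewrite -ef'.
    * by symmetry; apply: cr; rewrite -ef.
    * by rewrite ef in ef'; rewrite (si _ _ _ ef').
  + move=> [Ge|[f -> ->]]; first by left; apply: sG.2.
    by right; exists (dcmp f g); rewrite ?act_cmp // -smap_act.
- move=> m x e [/Gb//|[f -> ->]]; exact: hb.
- move=> m x; split.
    case=> e [Ge|[f -> _]]; first by left; apply/GS; exists e.
    by right; exists f.
  case=> [/GS[e Ge]|[f ->]]; first by exists e; left.
  by exists (h m f); right; exists f.
Qed.

(** Adjoining simplices one after another; H k is the part of the k-th simplex
    already covered by S0 and its predecessors. *)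
Lemma attach_seq (N : nat) (d : nat) (S0 : forall n, D n -> Prop) G
    (s : nat -> D d) (H : nat -> forall m, simplex d m -> Prop) :
  partial_lift S0 G ->
  (forall k m (f g : dmap m d), (k < N)%N -> act f (s k) = act g (s k) -> f = g) ->
  (forall k m (f : dmap m d), (k < N)%N -> (S0 m (act f (s k)) \/
    exists j g, (j < k)%N /\ act f (s k) = act g (s j)) <-> H k m f) ->
  (forall k, (k < N)%N -> rlp (H k) p) ->
  exists G', partial_lift (fun m x => S0 m x \/ exists j f, (j < N)%N /\ x = act f (s j)) G' /\
    forall m x e, G m x e -> G' m x e.
Proof.
move=> pG; elim: N => [|N IH] si SH lH.
  exists G; split=> //; case: pG => sG Gb GS; split=> // n x; rewrite GS.
  by split; [left|case=> // -[j [f []]]].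
have [|||G1 [pG1 GG1]] := IH.
- by move=> k m f g kN; apply: si; lia.
- by move=> k m f kN; apply: SH; lia.
- by move=> k kN; apply: lH; lia.
have [|||G2 [pG2 GG2]] := attach (s := s N) (H := H N) pG1.
- by move=> m f g; apply: si; lia.
- by move=> m f; apply: SH; lia.
- by apply: lH; lia.
exists G2; split; last by move=> m x e /GG1 /GG2.
case: pG2 => sG Gb GS; split=> // n x; rewrite GS; split.
  case=> [[?|[j [f [jN ->]]]]|[f ->]]; first by left.
    by right; exists j, f; split=> //; lia.
  by right; exists N, f.
case=> [?|[j [f [jN ->]]]]; first by left; left.
rewrite ltnS leq_eqVlt in jN; case/orP: jN => [/eqP ->|jN]; first by right; exists f.
by left; right; exists j, f.
Qed.

End Attach.

(** * The shuffles of a prism *)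

Lemma dmap_eqn m n (f g : dmap m n) : (forall i, f i = g i :> nat) -> f = g.
Proof. by move=> e; apply: dmap_eq => i; apply/val_inj/e. Qed.

Section Prism.
Variable n : nat.

(** The two coordinates of the j-th nondegenerate top simplex of the prism: in
    the vertices (0,0), ..., (j,0), (j,1), ..., (n,1) the first coordinate
    repeats j, and the second jumps after j. *)
Definition shuf1 (j : nat) : dmap n.+1 n.
Proof.
refine (@DMap n.+1 n (fun l => inord (minn n (if (l <= j)%N then l : nat else l.-1))) _).
move=> a b ab; rewrite !inordK ?ltnS ?geq_minl //.
by case: ifP; case: ifP; lia.
Defined.

Definition shuf2 (j : nat) : dmap n.+1 1.
Proof.
refine (@DMap n.+1 1 (fun l => inord (j < l)%N) _).
by move=> a b ab; rewrite !inordK ?ltnS ?leq_b1 //; lia.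
Defined.

Lemma shuf1E j (l : 'I_n.+2) : (j <= n)%N -> shuf1 j l = (if (l <= j)%N then l : nat else l.-1) :> nat.
Proof. by move=> jn; have := ltn_ord l; rewrite /= inordK ?ltnS ?geq_minl //; case: ifP; lia. Qed.

Lemma shuf2E j (l : 'I_n.+2) : shuf2 j l = (j < l)%N :> nat.
Proof. by rewrite /= inordK ?ltnS ?leq_b1. Qed.

Definition shuf j : sprod (simplex n) (simplex 1) n.+1 := (shuf1 j, shuf2 j).

Lemma shufE1 j m (f : dmap m n.+1) l : (j <= n)%N ->
  (act f (shuf j)).1 l = (if (f l <= j)%N then f l : nat else (f l).-1) :> nat.
Proof. by move=> jn; rewrite -[LHS]/(nat_of_ord (shuf1 j (f l))) shuf1E. Qed.

Lemma shufE2 j m (f : dmap m n.+1) l : (act f (shuf j)).2 l = (j < f l)%N :> nat.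
Proof. by rewrite -[LHS]/(nat_of_ord (shuf2 j (f l))) shuf2E. Qed.

Lemma shuf_inj j m (f g : dmap m n.+1) : (j <= n)%N ->
  act f (shuf j) = act g (shuf j) -> f = g.
Proof.
move=> jn e; apply: dmap_eqn => i.
have : (act f (shuf j)).1 i = (act g (shuf j)).1 i :> nat by rewrite e.
have : (act f (shuf j)).2 i = (act g (shuf j)).2 i :> nat by rewrite e.
by rewrite !shufE1 // !shufE2; case: ifP; case: ifP; lia.
Qed.

(** The simplices of the j-th shuffle, seen inside the prism: points at the
    bottom are at most j, points at the top at least j. *)
Definition inshuf j m (x : sprod (simplex n) (simplex 1) m) : Prop :=
  forall l, (x.2 l = 0 :> nat -> (x.1 l <= j)%N) /\ (x.2 l = 1 :> nat -> (j <= x.1 l)%N).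

Lemma inshufP j m x : (j <= n)%N ->
  @inshuf j m x <-> exists f, x = act f (shuf j).
Proof.
move=> jn; split; last first.
  by move=> [f ->] l; rewrite shufE1 // shufE2; case: ifP; lia.
case: x => [a b] ab.
pose g l : 'I_n.+2 := inord (a l + b l).
have gE l : g l = (a l + b l)%N :> nat.
  by rewrite inordK //; have := ltn_ord (a l); have := ltn_ord (b l); lia.
have gm (i i' : 'I_m.+1) : (i <= i')%N -> (g i <= g i')%N.
  by move=> ii; rewrite !gE; have := dmono a ii; have := dmono b ii; lia.
exists (DMap gm); congr pair; apply: dmap_eqn => i.
  rewrite -[RHS]/(nat_of_ord (shuf1 j (g i))) shuf1E // gE.
  have [/= h0 h1] := ab i; have := ltn_ord (b i).
  by case: ifP; have := h0; have := h1; lia.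
rewrite -[RHS]/(nat_of_ord (shuf2 j (g i))) shuf2E // gE.
have [/= h0 h1] := ab i; have := ltn_ord (b i).
have [b0|b1] : (b i = 0 :> nat \/ b i = 1 :> nat) by have := ltn_ord (b i); lia.
  by have := h0 b0; lia.
by have := h1 b1; lia.
Qed.

(** The first vertex with second coordinate 1 tells which shuffle contains the
    simplex. *)
Lemma inshuf_ex m (x : sprod (simplex n) (simplex 1) m) : exists j, (j <= n)%N /\ inshuf j x.
Proof.
have [l0 l0P|nl] := pickP (fun l => x.2 l == 1 :> nat).
  case: (@arg_minnP _ l0 (fun l => x.2 l == 1 :> nat) (fun l : 'I_m.+1 => l : nat) l0P) => l /eqP lP lmin.
  exists (x.1 l); split; first by have := ltn_ord (x.1 l); lia.
  move=> i; split=> [i0|/eqP i1]; last by apply: dmono; exact: lmin.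
  apply: dmono; case: (leqP i l) => // li.
  by have := dmono x.2 (ltnW li); lia.
exists n; split=> // i; split; first by have := ltn_ord (x.1 i); lia.
by have /= := nl i; move=> + e; rewrite e.
Qed.

End Prism.

Lemma hornP_nat n i m (f : dmap m n.+1) : (i <= n.+1)%N ->
  hornP (inord i : 'I_n.+2) f <->
    exists w, [/\ (w <= n.+1)%N, w <> i & forall l, f l <> w :> nat].
Proof.
move=> iN; have iE : (inord i : 'I_n.+2) = i :> nat by rewrite inordK.
split=> [[j [ji fj]]|[w [wn wi fw]]].
  exists j; split; first by have := ltn_ord j; lia.
    by move=> e; case/eqP: ji; apply/val_inj; rewrite /= iE.
  by move=> l e; case/eqP: (fj l); apply/val_inj.
exists (inord w); split.
  by apply/eqP => /(congr1 val) /=; rewrite iE inordK.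
by move=> l; apply/eqP => /(congr1 val) /=; rewrite inordK //; exact: fw.
Qed.

(** The combinatorial heart of prism filling. When the shuffles are attached
    in decreasing order to the bottom and the sides, the i-th one meets what
    is already there in the horn with vertex i: the face opposite i + 1 is
    shared with the next shuffle (or is the bottom, for i = n), the other
    faces but the i-th lie in the sides. *)
Lemma in_horn_shuf0 n i m (f : dmap m n.+1) : (i <= n)%N ->
  box (@bdry n) (@ptP ord0) (act f (shuf n i)) \/
  (exists j, (i < j)%N /\ (j <= n)%N /\ inshuf j (act f (shuf n i))) <->
  hornP (inord i : 'I_n.+2) f.
Proof.
move=> iN.
have e1 l : nat_of_ord ((act f (shuf n i)).1 l) = (if (f l <= i)%N then f l : nat else (f l).-1).
  exact: shufE1.
have e2 l : nat_of_ord ((act f (shuf n i)).2 l) = (i < f l)%N.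
  exact: shufE2.
rewrite hornP_nat; last lia.
split.
  case=> [[[v vP]|t0]|[j [ij [jn jP]]]].
  - exists (if (v < i)%N then v : nat else v.+1); have := ltn_ord v; split; try by case: ifP; lia.
    move=> l fl; case/eqP: (vP l); apply/val_inj; rewrite /= e1 fl.
    by case: (ltnP v i); case: ifP; lia.
  - exists i.+1; split=> //; try lia.
    by move=> l fl; have := congr1 val (t0 l); rewrite /= e2 fl; lia.
  - exists i.+1; split=> //; try lia.
    by move=> l fl; have [] := jP l; rewrite e1 e2 fl; case: ifP; lia.
move=> [w [wn wi fw]].
have [lt|gt|e] : [\/ (w < i)%N, (i.+1 < w)%N | w = i.+1].
  by have [?|?|?] := ltngtP w i.+1; [constructor 1; lia|constructor 2|constructor 3].
- left; left; have wn' : (w < n.+1)%N by lia.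
  exists (Ordinal wn') => l; apply/eqP => /(congr1 val) /=; rewrite e1.
  by have := fw l; case: ifP; lia.
- left; left; have wn' : (w.-1 < n.+1)%N by lia.
  exists (Ordinal wn') => l; apply/eqP => /(congr1 val) /=; rewrite e1.
  by have := fw l; case: ifP; lia.
- rewrite {w wi}e in wn fw.
  have [ilt|ie] : (i < n)%N \/ i = n by lia.
    right; exists i.+1; split=> //; split=> // l; rewrite e1 e2.
    by have := fw l; case: ifP; lia.
  left; right => l; apply/val_inj; rewrite /= e2.
  by have := fw l; have := ltn_ord (f l); lia.
Qed.

(** The mirror image: from the top, the shuffles are attached in increasing
    order, along the horn with vertex i + 1. *)
Lemma in_horn_shuf1 n i m (f : dmap m n.+1) : (i <= n)%N ->
  box (@bdry n) (@ptP ord_max) (act f (shuf n i)) \/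
  (exists j, (j < i)%N /\ (j <= n)%N /\ inshuf j (act f (shuf n i))) <->
  hornP (inord i.+1 : 'I_n.+2) f.
Proof.
move=> iN.
have e1 l : nat_of_ord ((act f (shuf n i)).1 l) = (if (f l <= i)%N then f l : nat else (f l).-1).
  exact: shufE1.
have e2 l : nat_of_ord ((act f (shuf n i)).2 l) = (i < f l)%N.
  exact: shufE2.
rewrite hornP_nat; last lia.
split.
  case=> [[[v vP]|t0]|[j [ij [jn jP]]]].
  - exists (if (v <= i)%N then v : nat else v.+1); have := ltn_ord v; split; try by case: ifP; lia.
    move=> l fl; case/eqP: (vP l); apply/val_inj; rewrite /= e1 fl.
    by case: (leqP v i); case: ifP; lia.
  - exists i; split=> //; try lia.
    by move=> l fl; have := congr1 val (t0 l); rewrite /= e2 fl; lia.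
  - exists i; split=> //; try lia.
    by move=> l fl; have [] := jP l; rewrite e1 e2 fl; case: ifP; lia.
move=> [w [wn wi fw]].
have [lt|gt|e] : [\/ (w < i)%N, (i.+1 < w)%N | w = i].
  by have [?|?|?] := ltngtP w i; [constructor 1; lia|constructor 2; lia|constructor 3].
- left; left; have wn' : (w < n.+1)%N by lia.
  exists (Ordinal wn') => l; apply/eqP => /(congr1 val) /=; rewrite e1.
  by have := fw l; case: ifP; lia.
- left; left; have wn' : (w.-1 < n.+1)%N by lia.
  exists (Ordinal wn') => l; apply/eqP => /(congr1 val) /=; rewrite e1.
  by have := fw l; case: ifP; lia.
- rewrite {w wi}e in wn fw.
  have [igt|ie] : (0 < i)%N \/ i = 0%N by lia.
    right; exists i.-1; split; first lia; split; first lia.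
    by move=> l; rewrite e1 e2; have := fw l; case: ifP; lia.
  left; right => l; apply/val_inj; rewrite /= e2.
  by have := fw l; have := ltn_ord (f l); lia.
Qed.

(** * From horns to cylinders *)

Lemma ord2_case (e : 'I_2) : e = ord0 \/ e = ord_max.
Proof. by case: e => [[|[|//]] H]; [left|right]; apply/val_inj. Qed.

(** Attaching the n + 1 shuffles in the right order fills the prism by horns.
    *)
Lemma prism (E F : sSet) (p : sMap E F) : kan_fib p ->
  forall n e, rlp (box (@bdry n) (@ptP e)) p.
Proof.
move=> kp n e G b sG GS Gb.
pose S0 := box (@bdry n) (@ptP e).
have S0cl : sclosed S0.
  move=> m q f [x t] [/= bx|tx]; first by left; exact: bdry_scl.
  by right=> l /=; exact: tx.
have pG : partial_lift p b S0 (fun m x y => S0 m x /\ G m x y).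
  split.
  - split=> [m x y y' [_ g1] [_ g2]|m q f x y [Sx g1]]; first by case: sG => Gf _; exact: Gf g1 g2.
    by split; [exact: S0cl|apply: sG.2].
  - by move=> m x y [_ /Gb].
  - move=> m x; split; first by case=> y [].
    by move=> Sx; have [y Gy] := GS m x Sx; exists y.
have key (s : nat -> nat) (H : nat -> 'I_n.+2) :
    (forall k, (k <= n)%N -> (s k <= n)%N) ->
    (forall j, (j <= n)%N -> exists k, (k <= n)%N /\ s k = j) ->
    (forall k m (f : dmap m n.+1), (k <= n)%N -> (S0 m (act f (shuf n (s k))) \/
      exists j, (j < k)%N /\ inshuf (s j) (act f (shuf n (s k)))) <-> hornP (H k) f) ->
    exists h : sMap (sprod (simplex n) (simplex 1)) E,
      (forall m x y, S0 m x -> G m x y -> h m x = y) /\ (forall m x, p m (h m x) = b m x).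
  move=> sn ss sH.
  have [|||G' [[sG' Gb' GS'] GG']] := attach_seq (N := n.+1) (s := fun k => shuf n (s k))
    (H := fun k => @hornP n.+1 (H k)) pG.
  - by move=> k m f g kn; apply: shuf_inj; apply: sn; lia.
  - move=> k m f kn; rewrite -sH; last lia.
    split=> -[?|]; try by left.
      move=> [j [g [jk e1]]]; right; exists j; split=> //.
      by apply/inshufP; [apply: sn; lia|exists g].
    move=> [j [jk /inshufP jP]]; right; have [|g e1] := jP; first by apply: sn; lia.
    by exists j, g.
  - by move=> k kn; exact: kp.
  have [|h hG'] := graph_map sG'.
    move=> m x; apply/GS'; right; have [j [jn /inshufP jx]] := inshuf_ex x.
    have [//|f fx] := jx; have [k [kn kj]] := ss _ jn; exists k, f.
    by rewrite kj; split=> //; lia.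
  exists h; split=> m x; last exact: Gb'.
  move=> y Sx Gy; have := hG' m x; case: sG' => G'f _; move/G'f; apply; apply: GG'.
  by split.
have [e0|e1] := ord2_case e; rewrite /S0.
- apply: (key (fun k => n - k)%N (fun k => inord (n - k)%N)).
  + by move=> k kn; lia.
  + by move=> j jn; exists (n - j)%N; split; lia.
  + move=> k m f kn; rewrite /S0 e0 -in_horn_shuf0; last lia.
    split=> -[?|]; try by left.
      by move=> [j [jk jP]]; right; exists (n - j)%N; split; [lia|split=> //; lia].
    move=> [j [jk [jn jP]]]; right; exists (n - j)%N; split; first lia.
    by rewrite (_ : n - (n - j) = j)%N //; lia.
- apply: (key id (fun k => inord k.+1)) => //.
  + by move=> j jn; exists j.
  + move=> k m f kn; rewrite /S0 e1 -in_horn_shuf1; last lia.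
    split=> -[?|]; try by left.
      by move=> [j [jk jP]]; right; exists j; split=> //; split=> //; lia.
    by move=> [j [jk [jn jP]]]; right; exists j.
Qed.

(** Cell induction for maps from B into the path object of E reduces the
    cylinder on B to the prisms on its cells. The constraint adm records both
    the projection to F and the values prescribed at the end e. *)
Lemma kan_fib_cyl (E F : sSet) (p : sMap E F) : kan_fib p -> cyl_fib p.
Proof.
move=> kp B S e Scl G b [Gf Ga] GS Gb.
pose adm n (x : B n) (g : ihom (simplex 1) E n) :=
  forall m (f : dmap m n) (t : simplex 1 m), p m (g m (f, t)) = b m (act f x, t) /\
    forall y, ptP e t -> G m (act f x, t) y -> g m (f, t) = y.
pose G0 n (x : B n) (g : ihom (simplex 1) E n) := S n x /\
  forall m (f : dmap m n) (t : simplex 1 m), G m (act f x, t) (g m (f, t)).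
have [||||h [ha h0]] := @scells B (ihom (simplex 1) E) adm G0.
- move=> m n f x g gx q f' t /=.
  by rewrite -act_cmp; exact: gx.
- split=> [n x g g' [Sx gx] [_ gx']|m n f x g [Sx gx]].
    by apply: ihom_eq => m f t; exact: Gf (gx _ _ _) (gx' _ _ _).
  by split=> [|q f' t]; [exact: Scl|rewrite -act_cmp; exact: gx].
- move=> n x g [Sx gx] m f t; split; first exact: Gb.
  by move=> y _; exact: Gf.
- move=> G' [G'f G'a] _ G'adm n t bt.
  pose bt1 : sMap (sprod (simplex n) (simplex 1)) F := uncurry (smap_cmp (curry b) (cls t)).
  have [|||w [wG wb]] := @prism _ _ p kp n e (fun m x y =>
      (bdry x.1 /\ exists g, G' m (act x.1 t) g /\ g m (did m, x.2) = y) \/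
      (ptP e x.2 /\ G m (act x.1 t, x.2) y)) bt1.
  + split=> [m [f u] y y' /=|m q f [f' u] y /=].
      move=> [[bf [g [Gg <-]]]|[eu Gy]] [[bf' [g' [Gg' <-]]]|[eu' Gy']].
      * by rewrite (G'f _ _ _ _ Gg Gg').
      * have [_ ] := G'adm _ _ _ Gg _ (did m) u; rewrite act_id; exact.
      * symmetry; have [_ ] := G'adm _ _ _ Gg' _ (did m) u; rewrite act_id; exact.
      * exact: Gf Gy Gy'.
    move=> [[bf [g [Gg <-]]]|[eu Gy]]; last first.
      by right; split; [move=> l; exact: eu|rewrite act_cmp; exact: (Ga _ _ _ (_, _))].
    left; split; first exact: bdry_scl.
    exists (act f (g : ihom (simplex 1) E q)); split; first by rewrite act_cmp; exact: G'a.
    by rewrite -smap_act /=; congr (g m (_, _)); exact: dmap_eq.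
  + move=> m [f u] [/= bf|/= eu].
      by have [g Gg] := bt m f bf; exists (g m (did m, u)); left; split=> //; exists g.
    by have [|y Gy] := GS m (act f t, u); [right|exists y; right].
  + move=> m [f u] y /= [[bf [g [Gg <-]]]|[eu /Gb->]]; last by rewrite act_id.
    by have [-> _] := G'adm _ _ _ Gg _ (did m) u.
  exists w; split.
    move=> m f u; split; first by rewrite wb /= act_id.
    by move=> y eu Gy; apply: wG; right.
  move=> m f g bf Gg; apply: ihom_eq => q f' u /=; symmetry; apply: wG.
    by left; exact: bdry_scl.
  left; split; first exact: bdry_scl.
  exists (act f' g); split; first by rewrite act_cmp; exact: G'a.
  by rewrite /=; congr (g q (_, _)); exact: dmap_eq.
exists (uncurry h); split=> n [x u]; last first.
  by have [-> _] := ha n x n (did n) u; rewrite act_id.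
move=> y [/= Sx|/= eu] Gy; last first.
  by have [_] := ha n x n (did n) u; rewrite act_id; exact.
have [||g gG] := @graph_map (sprod (simplex n) (simplex 1)) E
  (fun m z => G m (act z.1 x, z.2)).
- split=> [m z z1 z2|m q f z z1 Gz]; first exact: Gf.
  by rewrite /= act_cmp; exact: (Ga _ _ _ (_, _)).
- by move=> m z; apply: GS; left; exact: Scl.
rewrite /= (h0 n x g); last by split=> // m f t; exact: (gG m (f, t)).
by apply: Gf Gy; have := gG n (did n, u); rewrite /= act_id.
Qed.

(** * Kan fibrations and Kan complexes *)

Section Contract.
Variables (p : nat) (i : 'I_p.+1).

Definition lo_fun (t : 'I_2) (l : 'I_p.+1) : 'I_p.+1 :=
  if (t == ord0) && (i < l)%N then i else l.
Definition hi_fun (t : 'I_2) (l : 'I_p.+1) : 'I_p.+1 :=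
  if (t != ord0) && (l < i)%N then i else l.

Lemma lo_mono (s t : 'I_2) (l m : 'I_p.+1) : (s <= t)%N -> (l <= m)%N ->
  (lo_fun s l <= lo_fun t m)%N.
Proof.
rewrite /lo_fun; have [->|->] := ord2_case s; have [->|->] := ord2_case t => //= _ lm;
  by do ?case: ifP => //=; lia.
Qed.

Lemma hi_mono (s t : 'I_2) (l m : 'I_p.+1) : (s <= t)%N -> (l <= m)%N ->
  (hi_fun s l <= hi_fun t m)%N.
Proof.
rewrite /hi_fun; have [->|->] := ord2_case s; have [->|->] := ord2_case t => //= _ lm;
  by do ?case: ifP => //=; lia.
Qed.

(** The homotopy from the retraction of the simplex onto its vertices at most
    i, at time 0, to the identity, at time 1. *)
Definition lo : sMap (sprod (simplex p) (simplex 1)) (simplex p).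
Proof.
refine (@SMap (sprod (simplex p) (simplex 1)) (simplex p) (fun m z =>
  @DMap m p (fun l => lo_fun (z.2 l) (z.1 l)) (fun a b ab =>
    lo_mono (dmono z.2 ab) (dmono z.1 ab))) _).
by move=> m n f x; exact: dmap_eq.
Defined.

(** The homotopy from the identity, at time 0, to the retraction onto the
    vertices at least i, at time 1. *)
Definition hi : sMap (sprod (simplex p) (simplex 1)) (simplex p).
Proof.
refine (@SMap (sprod (simplex p) (simplex 1)) (simplex p) (fun m z =>
  @DMap m p (fun l => hi_fun (z.2 l) (z.1 l)) (fun a b ab =>
    hi_mono (dmono z.2 ab) (dmono z.1 ab))) _).
by move=> m n f x; exact: dmap_eq.
Defined.

End Contract.

Lemma hornP_scl p i : sclosed (@hornP p i).
Proof. by move=> m n f x hx; exact: (in_horn_act f hx). Qed.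

Lemma ptP_scl e : sclosed (@ptP e).
Proof. by move=> m n f x xe l; exact: xe. Qed.

Lemma box_scl (B D : sSet) (S : forall n, B n -> Prop) (T : forall n, D n -> Prop) :
  sclosed S -> sclosed T -> sclosed (box S T).
Proof. by move=> Sc Tc m n f x [Sx|Tx]; [left; exact: Sc|right; exact: Tc]. Qed.

(** The inclusion of the horn, crossed with any inclusion, is a retract of a
    cylinder inclusion, by the homotopies lo (when i is not the last vertex)
    and hi (when it is): they contract the simplex onto proper faces through
    maps preserving the horn. *)
Lemma rlp_box_horn (E F : sSet) (p : sMap E F) : cyl_fib p ->
  forall (B : sSet) (S : forall n, B n -> Prop) n (i : 'I_n.+2), sclosed S ->
  rlp (box S (@hornP n.+1 i)) p.
Proof.
move=> hp B S n i Sc.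
have Sbc : sclosed (box S (@hornP n.+1 i)) by apply: box_scl => //; exact: hornP_scl.
have key (phi : sMap (sprod (simplex n.+1) (simplex 1)) (simplex n.+1)) (e e' : 'I_2) :
    (forall m z, phi m (z, dconst m e') = z) ->
    (forall m z, @hornP n.+1 i m z.1 -> @hornP n.+1 i m (phi m z)) ->
    (forall m z, ptP e z.2 -> @hornP n.+1 i m (phi m z)) ->
    rlp (box S (@hornP n.+1 i)) p.
  move=> phi1 phiH phie.
  pose DD := sprod B (simplex n.+1).
  pose s : sMap DD (sprod DD (simplex 1)) :=
    @SMap DD (sprod DD (simplex 1)) (fun m z => (z, dconst m e')) (fun _ _ _ _ => erefl).
  have rP m q f (z : sprod DD (simplex 1) q) :
      ((act f z).1.1, phi m ((act f z).1.2, (act f z).2)) =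
      act f ((z.1.1, phi q (z.1.2, z.2)) : DD q).
    by congr pair; exact: (smap_act phi f (z.1.2, z.2)).
  pose r : sMap (sprod DD (simplex 1)) DD :=
    @SMap (sprod DD (simplex 1)) DD (fun q z => (z.1.1, phi q (z.1.2, z.2))) rP.
  apply: (rlp_retract (s := s) (r := r) _ _ _ (hp _ _ e Sbc)).
  - by move=> m [x z] /=; rewrite phi1.
  - by move=> m x Sx; left.
  - move=> m [[x z] t] /= [[Sx|hz]|te]; first by left.
      by right; exact: (phiH _ (z, t)).
    by right; exact: (phie _ (z, t)).
have [ilt|ige] := ltnP i n.+1.
  apply: (key (lo i) ord0 ord_max).
  - by move=> m z; apply: dmap_eq => l.
  - move=> m [z t] [w [wi zw]]; exists w; split=> // l /=; rewrite /lo_fun.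
    by case: ifP => _; [rewrite eq_sym|exact: zw].
  - move=> m [z t] /= te; exists ord_max; split.
      by apply/eqP => /(congr1 val) /=; lia.
    by move=> l; apply/eqP => /(congr1 val); rewrite /= /lo_fun te /=; case: ifP; have := ltn_ord (z l); lia.
apply: (key (hi i) ord_max ord0).
- by move=> m z; apply: dmap_eq => l.
- move=> m [z t] [w [wi zw]]; exists w; split=> // l /=; rewrite /hi_fun.
  by case: ifP => _; [rewrite eq_sym|exact: zw].
- move=> m [z t] /= te; exists ord0; split.
    by apply/eqP => /(congr1 val) /=; lia.
  by move=> l; apply/eqP => /(congr1 val); rewrite /= /hi_fun te /=; case: ifP; lia.
Qed.

Definition to_unit (X : sSet) : sMap X sunit :=
  @SMap X sunit (fun _ _ => tt) (fun _ _ _ _ => erefl).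

Definition extends (D : sSet) (S : forall n, D n -> Prop) (K : sSet) : Prop :=
  forall G : forall n, D n -> K n -> Prop, sgraph G ->
  (forall n x, S n x -> exists e, G n x e) ->
  exists h : sMap D K, forall n x e, S n x -> G n x e -> h n x = e.

Lemma rlp_ext (D : sSet) (S : forall n, D n -> Prop) (K : sSet) :
  rlp S (to_unit K) <-> extends S K.
Proof.
split=> [l G sG GS|l G b sG GS _]; last first.
  have [h hG] := l G sG GS; exists h; split=> // n x.
  by case: (b n x).
have [//|//|n x e|h [hG _]] := l G (to_unit D); first by [].
by exists h.
Qed.

Lemma kan_kan_fib (X : sSet) : kan X <-> kan_fib (to_unit X).
Proof.
split=> [kX n i|kX n i h]; last first.
  have [||s sP] := (rlp_ext _ _).1 (kX n i)
      (fun m x e => exists Hx : in_horn i x, e = h m (exist _ x Hx)).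
  - split=> [m x e e' [a ->] [b ->]|m q f x e [a ->]].
      by rewrite (Prop_irrelevance a b).
    exists (in_horn_act f a); by rewrite -smap_act; congr (h m _); exact: eq_exist.
  - by move=> m x Hx; exists (h m (exist _ x Hx)), Hx.
  by exists s => m [x Hx]; apply: sP => //; exists Hx.
apply/rlp_ext => G [Gf Ga] GS.
have [||h hG] := @graph_map (horn i) X (fun m x e => G m (sval x) e).
- by split=> [m x e e'|m q f x e]; [exact: Gf|exact: Ga].
- by move=> m [x Hx]; exact: GS.
have [s sP] := kX _ _ h.
exists s => m x e Hx Ge; rewrite -[x]/(horn_incl i m (exist _ x Hx)) sP.
exact: Gf (hG m (exist _ x Hx)) Ge.
Qed.

Lemma kan_cyl_fib (X : sSet) : kan X -> cyl_fib (to_unit X).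
Proof. by move/kan_kan_fib/kan_fib_cyl. Qed.

Lemma kan_ext_pt (K : sSet) : kan K -> forall (B : sSet) (S : forall n, B n -> Prop) e,
  sclosed S -> extends (box S (@ptP e)) K.
Proof. by move=> kK B S e Sc; apply/rlp_ext; exact: kan_cyl_fib. Qed.

Lemma kan_ext_horn (K : sSet) : kan K -> forall (B : sSet) (S : forall n, B n -> Prop)
  n (i : 'I_n.+2), sclosed S -> extends (box S (@hornP n.+1 i)) K.
Proof. by move=> kK B S n i Sc; apply/rlp_ext; apply: rlp_box_horn => //; exact: kan_cyl_fib. Qed.

Lemma kan_total (E F : sSet) (p : sMap E F) : kan_fib p -> kan F -> kan E.
Proof.
move=> kp /kan_kan_fib kF; apply/kan_kan_fib => n i; apply/rlp_ext => G [Gf Ga] GS.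
have [||b bG] := (rlp_ext _ _).1 (kF n i)
  (fun m x y => hornP i x /\ exists2 e, G m x e & y = p m e).
- split=> [m x y y' [_ [e Ge ->]] [_ [e' Ge' ->]]|m q f x y [hx [e Ge ->]]].
    by rewrite (Gf _ _ _ _ Ge Ge').
  split; first exact: hornP_scl.
  by exists (act f e); [exact: Ga|rewrite smap_act].
- by move=> m x hx; have [e Ge] := GS m x hx; exists (p m e); split=> //; exists e.
have [|||h [hG _]] := kp n i (fun m x e => hornP i x /\ G m x e) b.
- split=> [m x y y' [_ e] [_ e']|m q f x y [hx e]]; first exact: Gf e e'.
  by split; [exact: hornP_scl|exact: Ga].
- by move=> m x hx; have [e Ge] := GS m x hx; exists e.
- by move=> m x e [hx Ge]; rewrite (bG m x (p m e)) //; split=> //; exists e.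
by exists h => m x e hx Ge; apply: hG.
Qed.


Definition sig21 : dmap 2 1.
Proof.
refine (@DMap 2 1 (fun l => inord (0 < l)%N) _).
by move=> a b ab; rewrite !inordK ?ltnS ?leq_b1 //; lia.
Defined.

Definition miss (j : 'I_3) n (x : simplex 2 n) : Prop := forall l, x l != j.

(** Two homotopies with the same start are two edges of a triangle; filling
    the horn at their common vertex, fibrewise over F, gives the third edge.
    Symmetry and transitivity of the homotopy relation both come from this
    construction. *)
Lemma homotopy_edge (E F : sSet) (p : sMap E F) (B : sSet)
    (H1 H2 : sMap (sprod B (simplex 1)) E) : cyl_fib p ->
  (forall n x, H1 n (x, dconst n ord0) = H2 n (x, dconst n ord0)) ->
  (forall n x, p n (H1 n x) = p n (H2 n x)) ->
  exists N : sMap (sprod B (simplex 1)) E, forall n x,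
    [/\ N n (x, dconst n ord0) = H1 n (x, dconst n ord_max),
        N n (x, dconst n ord_max) = H2 n (x, dconst n ord_max) &
        forall t, p n (N n (x, t)) = p n (H1 n (x, dconst n ord_max))].
Proof.
move=> hp H12 pH.
pose one : 'I_3 := inord 1; pose two : 'I_3 := inord 2.
have e1 : one = 1 :> nat by rewrite inordK.
have e2 : two = 2 :> nat by rewrite inordK.
have sigE n (x : simplex 2 n) l : dcmp sig21 x l = (0 < x l)%N :> nat.
  by rewrite /= inordK ?ltnS ?leq_b1.
have cst m q (f : dmap m q) (H : sMap (sprod B (simplex 1)) E) x (y : simplex 2 q) :
    H m (act f x, dcmp sig21 (dcmp y f)) = act f (H q (x, dcmp sig21 y)).
  by rewrite -smap_act; congr (H m (_, _)); exact: dmap_eq.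
have bP m q (f : dmap m q) (z : sprod B (simplex 2) q) :
    p m (H1 m ((act f z).1, dcmp sig21 (act f z).2)) =
    act f (p q (H1 q (z.1, dcmp sig21 z.2))).
  by rewrite -smap_act -cst.
have [|||M [MG Mb]] := @rlp_box_horn _ _ p hp B (fun _ _ => False) 1 ord0 (fun _ _ _ _ x => x)
   (fun n z e => (miss two z.2 /\ e = H1 n (z.1, dcmp sig21 z.2)) \/
      (miss one z.2 /\ e = H2 n (z.1, dcmp sig21 z.2))) (@SMap (sprod B (simplex 2)) F (fun q z => p q (H1 q (z.1, dcmp sig21 z.2))) bP).
- have both n (x : B n) (y : simplex 2 n) : miss two y -> miss one y ->
      H1 n (x, dcmp sig21 y) = H2 n (x, dcmp sig21 y).
    move=> m2 m1; have -> : dcmp sig21 y = dconst n ord0; last exact: H12.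
    apply: dmap_eqn => l; rewrite sigE /=.
    have := m2 l; have := m1 l; rewrite -!val_eqE /= e1 e2; have := ltn_ord (y l); lia.
  split.
    move=> n [x y] e e' /= [[m2 ->]|[m1 ->]] [[m2' ->]|[m1' ->]] //; first exact: both.
    by symmetry; exact: both.
  move=> m n f [x y] e /= [[m2 ->]|[m1 ->]]; [left|right]; rewrite cst; split=> // l.
    exact: m2.
  exact: m1.
- move=> n [x y] [//|[w [w0 yw]]] /=.
  have [wE|wE] : w = one \/ w = two.
    have : w <> 0 :> nat by move=> w0'; case/eqP: w0; apply/val_inj.
    have := ltn_ord w => ? ?; have [?|?] : w = 1 :> nat \/ w = 2 :> nat by lia.
      by left; apply/val_inj; rewrite /= e1.
    by right; apply/val_inj; rewrite /= e2.
  - by eexists; right; split; [rewrite -wE; exact: yw|].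
  - by eexists; left; split; [rewrite -wE; exact: yw|].
- by move=> n [x y] e /= [[_ ->]|[_ ->]] //; rewrite pH.
have NP m q (f : dmap m q) (z : sprod B (simplex 1) q) :
    M m ((act f z).1, dcmp (face ord0) (act f z).2) =
    act f (M q (z.1, dcmp (face ord0) z.2)).
  by rewrite -smap_act; congr (M m (_, _)); exact: dmap_eq.
have f0 n t l : (dcmp (@face 1 ord0) (t : dmap n 1)) l = (t l).+1 :> nat.
  by rewrite /= /bump /=.
have sg n (t : dmap n 1) : dcmp sig21 (dcmp (face ord0) t) = dconst n ord_max.
  by apply: dmap_eqn => l; rewrite sigE f0.
exists (@SMap (sprod B (simplex 1)) E (fun q z => M q (z.1, dcmp (face ord0) z.2)) NP) => n x; split.
- rewrite /= -(sg n (dconst n ord0)); apply: MG.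
    right; exists two; split; first by apply/eqP => /(congr1 val) /=; rewrite e2.
    by move=> l; apply/eqP => /(congr1 val) /=; rewrite e2 /bump; lia.
  by left; split=> // l; apply/eqP => /(congr1 val) /=; rewrite e2 /bump; lia.
- rewrite /= -[in RHS](sg n (dconst n ord_max)); apply: MG.
    right; exists one; split; first by apply/eqP => /(congr1 val) /=; rewrite e1.
    by move=> l; apply/eqP => /(congr1 val) /=; rewrite e1 /bump; lia.
  by right; split=> // l; apply/eqP => /(congr1 val) /=; rewrite e1 /bump; lia.
- by move=> t; rewrite /= Mb /= sg.
Qed.

(** * Homotopies and weak equivalences *)

Lemma ptPE e n (t : simplex 1 n) : ptP e t <-> t = dconst n e.
Proof.
split=> [te|->]; last by move=> l.
by apply: dmap_eq => l; rewrite te.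
Qed.

Lemma ptP01 n (t : simplex 1 n) : ptP ord0 t -> ptP ord_max t -> False.
Proof. by move=> t0 t1; have := t0 ord0; rewrite t1. Qed.

Definition sfst (A B : sSet) : sMap (sprod A B) A :=
  @SMap (sprod A B) A (fun n z => z.1) (fun _ _ _ _ => erefl).
Definition ssnd (A B : sSet) : sMap (sprod A B) B :=
  @SMap (sprod A B) B (fun n z => z.2) (fun _ _ _ _ => erefl).
Definition spair (A B D : sSet) (f : sMap D A) (g : sMap D B) : sMap D (sprod A B).
Proof.
refine (@SMap D (sprod A B) (fun n z => (f n z, g n z)) _).
by move=> m n t x; rewrite !smap_act.
Defined.
Definition sconst (A : sSet) (e : 'I_2) : sMap A (simplex 1).
Proof.
by refine (@SMap A (simplex 1) (fun n _ => dconst n e) _) => m n f x; exact: dmap_eq.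
Defined.
Definition at_end (A : sSet) e : sMap A (sprod A (simplex 1)) := spair (sid A) (sconst A e).

Lemma eh_refl (X Y : sSet) (f : sMap X Y) : elem_homotopic f f.
Proof. by exists (smap_cmp f (sfst X (simplex 1))). Qed.

Lemma eh_edge (X Y : sSet) (f g h : sMap X Y) : kan Y ->
  elem_homotopic f g -> elem_homotopic f h -> elem_homotopic g h.
Proof.
move=> /kan_cyl_fib kY [H1 H1P] [H2 H2P].
have [||N NP] := homotopy_edge (H1 := H1) (H2 := H2) kY.
- by move=> n x; rewrite (H1P n x).1 (H2P n x).1.
- by [].
by exists N => n x; have [-> -> _] := NP n x; rewrite (H1P n x).2 (H2P n x).2.
Qed.

Lemma eh_sym (X Y : sSet) (f g : sMap X Y) : kan Y ->
  elem_homotopic f g -> elem_homotopic g f.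
Proof. by move=> kY fg; apply: eh_edge fg (eh_refl f). Qed.

Lemma eh_trans (X Y : sSet) (f g h : sMap X Y) : kan Y ->
  elem_homotopic f g -> elem_homotopic g h -> elem_homotopic f h.
Proof. by move=> kY fg gh; apply: (eh_edge kY _ gh); apply: eh_sym. Qed.

(** Maps into a Kan complex: the generated equivalence relation is the
    homotopy relation itself. *)
Lemma homotopic_eh (X Y : sSet) (f g : sMap X Y) : kan Y ->
  homotopic f g -> elem_homotopic f g.
Proof.
move=> kY; elim=> {f g} [f g //|f|f g _|f g h _ fg _ gh].
- exact: eh_refl.
- exact: eh_sym.
- exact: eh_trans gh.
Qed.

Lemma eh_homotopic (X Y : sSet) (f g : sMap X Y) : elem_homotopic f g -> homotopic f g.
Proof. exact: rst_step. Qed.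

Lemma eh_post (X Y W : sSet) (h : sMap Y W) (f g : sMap X Y) :
  elem_homotopic f g -> elem_homotopic (smap_cmp h f) (smap_cmp h g).
Proof. by move=> [H HP]; exists (smap_cmp h H) => n x /=; have [-> ->] := HP n x. Qed.

Lemma eh_pre (X Y W : sSet) (h : sMap W X) (f g : sMap X Y) :
  elem_homotopic f g -> elem_homotopic (smap_cmp f h) (smap_cmp g h).
Proof.
move=> [H HP]; exists (smap_cmp H (spair (smap_cmp h (sfst _ _)) (ssnd _ _))) => n x.
exact: HP.
Qed.

Lemma homotopic_post (X Y W : sSet) (h : sMap Y W) (f g : sMap X Y) :
  homotopic f g -> homotopic (smap_cmp h f) (smap_cmp h g).
Proof. by apply: clos_map => a b; exact: eh_post. Qed.

Lemma homotopic_pre (X Y W : sSet) (h : sMap W X) (f g : sMap X Y) :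
  homotopic f g -> homotopic (smap_cmp f h) (smap_cmp g h).
Proof. by apply: (clos_map (f := fun f => smap_cmp f h)) => a b; exact: eh_pre. Qed.

Lemma smap_cmpA (X Y Z W : sSet) (h : sMap Z W) (g : sMap Y Z) (f : sMap X Y) :
  smap_cmp h (smap_cmp g f) = smap_cmp (smap_cmp h g) f.
Proof. exact: smap_eq. Qed.

Lemma smap_cmp1 (X Y : sSet) (f : sMap X Y) : smap_cmp f (sid X) = f.
Proof. exact: smap_eq. Qed.

Lemma smap_1cmp (X Y : sSet) (f : sMap X Y) : smap_cmp (sid Y) f = f.
Proof. exact: smap_eq. Qed.

Definition hequiv (X Y : sSet) (f : sMap X Y) : Prop := exists g : sMap Y X,
  homotopic (smap_cmp g f) (sid X) /\ homotopic (smap_cmp f g) (sid Y).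

Lemma hequiv_weq (X Y : sSet) (f : sMap X Y) : hequiv f -> weq f.
Proof.
move=> [g [gf fg]] K kK; split=> [a b ab|h].
  rewrite -[a]smap_cmp1 -[b]smap_cmp1.
  apply: rst_trans (rst_sym _ _ _ _ (homotopic_post a fg)) _.
  apply: (rst_trans _ _ _ _ _ _ (homotopic_post b fg)).
  by rewrite !smap_cmpA; exact: homotopic_pre.
exists (smap_cmp h g); rewrite -smap_cmpA -[X in homotopic _ X]smap_cmp1.
exact: homotopic_post.
Qed.

Lemma weq_sid (X : sSet) : weq (sid X).
Proof. by apply: hequiv_weq; exists (sid X); rewrite smap_cmp1; split; exact: rst_refl. Qed.

(** The Whitehead theorem is built into the definition of weak equivalences:
    testing f against X produces a homotopy inverse, testing it against Y
    shows that it is one on both sides. *)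
Lemma weq_hequiv (X Y : sSet) (f : sMap X Y) : kan X -> kan Y -> weq f ->
  exists g, elem_homotopic (smap_cmp g f) (sid X) /\ elem_homotopic (smap_cmp f g) (sid Y).
Proof.
move=> kX kY wf; have [g gf] := (wf X kX).2 (sid X).
exists g; split; first exact: homotopic_eh.
apply: homotopic_eh => //; apply: (wf Y kY).1.
rewrite smap_1cmp -smap_cmpA -[X in homotopic _ X]smap_cmp1.
exact: homotopic_post.
Qed.

Lemma weq_cmp (X Y W : sSet) (g : sMap Y W) (f : sMap X Y) :
  weq g -> weq f -> weq (smap_cmp g f).
Proof.
move=> wg wf K kK; split=> [a b|h].
  by rewrite !smap_cmpA => /(wf K kK).1 /(wg K kK).1.
have [h1 e1] := (wf K kK).2 h; have [h2 e2] := (wg K kK).2 h1.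
exists h2; rewrite smap_cmpA; apply: rst_trans e1; exact: homotopic_pre.
Qed.

Lemma weq_cancel_l (X Y W : sSet) (g : sMap Y W) (f : sMap X Y) :
  weq g -> weq (smap_cmp g f) -> weq f.
Proof.
move=> wg wgf K kK; split=> [a b ab|h].
  have [a' ea] := (wg K kK).2 a; have [b' eb] := (wg K kK).2 b.
  apply: rst_trans (rst_sym _ _ _ _ ea) _; apply: (rst_trans _ _ _ _ _ _ eb).
  apply: homotopic_pre; apply: (wgf K kK).1.
  rewrite !smap_cmpA; apply: rst_trans (homotopic_pre f ea) _.
  by apply: rst_trans ab _; apply: rst_sym; exact: (homotopic_pre f eb).
have [h' eh] := (wgf K kK).2 h; exists (smap_cmp h' g).
by rewrite -smap_cmpA.
Qed.

Lemma weq_cancel_r (X Y W : sSet) (g : sMap Y W) (f : sMap X Y) :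
  weq f -> weq (smap_cmp g f) -> weq g.
Proof.
move=> wf wgf K kK; split=> [a b ab|h].
  by apply: (wgf K kK).1; rewrite !smap_cmpA; exact: homotopic_pre.
have [h' eh] := (wgf K kK).2 (smap_cmp h f); exists h'.
by apply: (wf K kK).1; rewrite -smap_cmpA.
Qed.

Lemma weq_bij (X Y : sSet) (f : sMap X Y) :
  (forall n, injective (f n)) -> (forall n y, exists x, f n x = y) -> weq f.
Proof.
move=> fi fs; apply: hequiv_weq.
have [||g gP] := @graph_map Y X (fun n y x => f n x = y).
- split=> [n y x x' xy xy'|m n t y x <-]; last by rewrite smap_act.
  by apply: fi; rewrite xy.
- exact: fs.
exists g; split.
  have -> : smap_cmp g f = sid X; last exact: rst_refl.
  by apply: smap_eq => n x; apply: fi; rewrite /= gP.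
have -> : smap_cmp f g = sid Y; last exact: rst_refl.
by apply: smap_eq => n x; rewrite /= gP.
Qed.

(** Dold: a fibration that is a homotopy equivalence is a deformation retract
    onto a strict section s, by a homotopy that moves along the fibres. A
    lifting problem over b is solved at time 1 by s b; the vertical homotopy
    then carries this solution to one with the prescribed values on S at time
    0. *)
Lemma dold (E F : sSet) (p : sMap E F) (g : sMap F E) : cyl_fib p -> kan E ->
  elem_homotopic (smap_cmp p g) (sid F) -> elem_homotopic (smap_cmp g p) (sid E) ->
  forall (D : sSet) (S : forall n, D n -> Prop), sclosed S -> rlp S p.
Proof.
move=> hp kE [K KP] gp.
have [|||L [LG Lb]] := hp F (fun _ _ => False) ord0 (fun _ _ _ _ x => x)
  (fun n z e => ptP ord0 z.2 /\ e = g n z.1) K.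
- split=> [n [x t] e e' /= [_ ->] [_ ->] //|m n f [x t] e /= [te ->]].
  by split; [exact: ptP_scl|rewrite smap_act].
- by move=> n [x t] [//|/= te]; exists (g n x).
- by move=> n [x t] e /= [/ptPE-> ->]; have [-> _] := KP n x.
pose s := smap_cmp L (at_end F ord_max).
have ps n y : p n (s n y) = y by rewrite /= Lb; have [_ ->] := KP n y.
have L0 n y : L n (y, dconst n ord0) = g n y by apply: LG => //; right.
have gs : elem_homotopic g s by exists L => n y; split; rewrite ?L0.
have [G GP] : elem_homotopic (smap_cmp s p) (sid E).
  by apply: (eh_edge kE _ gp); exact: eh_pre.
have [||N NP] := @homotopy_edge _ _ p E G (smap_cmp (smap_cmp s p) G) hp.
- move=> n x; rewrite -[RHS]/(s n (p n (G n (x, dconst n ord0)))).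
  by rewrite (GP n x).1 -[smap_cmp s p n x]/(s n (p n x)) ps.
- by move=> n x; rewrite -[smap_cmp _ _ n x]/(s n (p n (G n x))) ps.
move=> D S Sc Gr b [Gf Ga] GS Gb.
have NE n e : N n (e, dconst n ord_max) = s n (p n e).
  by have [_ -> _] := NP n e; have [_ /= ->] := GP n e.
have N0 n e : N n (e, dconst n ord0) = e.
  by have [-> _ _] := NP n e; have [_ /= ->] := GP n e.
have pN n e t : p n (N n (e, t)) = p n e.
  by have [_ _ ->] := NP n e; have [_ /= ->] := GP n e.
have [|||M [MG Mb]] := hp D S ord_max Sc
  (fun n z e => (S n z.1 /\ exists2 e0, Gr n z.1 e0 & e = N n (e0, z.2)) \/
     (ptP ord_max z.2 /\ e = s n (b n z.1))) (smap_cmp b (sfst D (simplex 1))).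
- split.
    move=> n [x t] e e' /= [[Sx [e0 g0 ->]]|[/ptPE-> ->]] [[Sx' [e0' g0' ->]]|[t1 ->]] //.
    + by rewrite (Gf _ _ _ _ g0 g0').
    + by move/ptPE: t1 => ->; rewrite NE (Gb _ _ _ g0).
    + by rewrite NE (Gb _ _ _ g0').
  move=> m n f [x t] e /= [[Sx [e0 g0 ->]]|[t1 ->]].
    left; split; first exact: Sc.
    by exists (act f e0); [exact: Ga|rewrite -smap_act].
  by right; split; [exact: ptP_scl|exact: (esym (smap_act (smap_cmp s b) f x))].
- move=> n [x t] /= [/= Sx|/= t1].
    by have [e0 g0] := GS n x Sx; exists (N n (e0, t)); left; split=> //; exists e0.
  by exists (s n (b n x)); right.
- move=> n [x t] e /= [[Sx [e0 g0 ->]]|[t1 ->]]; last exact: ps.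
  by rewrite pN; exact: Gb.
exists (smap_cmp M (at_end D ord0)); split=> n x; last exact: Mb.
move=> e Sx Ge; apply: MG; first by left.
by left; split=> //; exists e; rewrite ?N0.
Qed.

Notation iact f g := (act (s := ihom _ _) f g).

(** The exponential law for extension problems. *)
Lemma ext_ihom (B D K : sSet) (S : forall n, B n -> Prop) : sclosed S ->
  extends (fun n (z : sprod D B n) => S n z.2) K -> extends S (ihom D K).
Proof.
move=> Sc l G [Gf Ga] GS.
have [||h hG] := l (fun n z k => exists2 g : ihom D K n, G n z.2 g & (g : sMap _ _) n (did n, z.1) = k).
- split=> [n [d x] k k' /= [g Gg <-] [g' Gg' <-]|m n f [d x] k /= [g Gg <-]].
    by rewrite (Gf _ _ _ _ Gg Gg').
  exists (iact f g); first exact: Ga.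
  by rewrite -ihom_ev -smap_act /=; congr (g m (_, _)); exact: dmap_eq.
- by move=> n [d x] /GS[g Gg]; exists (g n (did n, d)), g.
exists (curry (smap_cmp h (spair (ssnd _ _) (sfst _ _)))) => n x g Sx Gg.
apply: ihom_eq => m f d /=; apply: hG => /=; first exact: Sc.
by exists (iact f g); [exact: Ga|rewrite -ihom_ev].
Qed.

Lemma kan_ihom (D K : sSet) : kan K -> kan (ihom D K).
Proof.
move=> kK; apply/kan_kan_fib => n i; apply/rlp_ext; apply: ext_ihom; first exact: hornP_scl.
have := @kan_ext_horn K kK D (fun _ _ => False) n i (fun _ _ _ _ x => x).
move=> l G sG GS; have [|h hG] := l G sG; first by move=> m z [//|/GS].
by exists h => m z e hz; apply: hG; right.
Qed.

(** The symmetry of the exponential law in its two sources. *)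
Definition flip (A B K : sSet) (h : sMap A (ihom B K)) : sMap B (ihom A K) :=
  curry (smap_cmp (uncurry h) (spair (ssnd _ _) (sfst _ _))).

Lemma flipE (A B K : sSet) (h : sMap A (ihom B K)) n x m f a :
  flip h n x m (f, a) = h m a m (did m, act f x).
Proof. by []. Qed.

Lemma flipK (A B K : sSet) (h : sMap A (ihom B K)) : flip (flip h) = h.
Proof.
apply: smap_eq => n x; apply: ihom_eq => m f b; rewrite !flipE act_id.
by rewrite smap_act -ihom_ev.
Qed.

Lemma flip_eh (A B K : sSet) (f g : sMap A (ihom B K)) :
  elem_homotopic f g -> elem_homotopic (flip f) (flip g).
Proof.
move=> [H HP].
exists (curry (smap_cmp (uncurry H)
  (spair (spair (ssnd _ _) (smap_cmp (ssnd _ _) (sfst _ _))) (smap_cmp (sfst _ _) (sfst _ _))))) => n x.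
split; apply: ihom_eq => m t a; rewrite flipE /=.
  by rewrite -(HP m a).1; congr (H m (_, _) m _); exact: dmap_eq.
by rewrite -(HP m a).2; congr (H m (_, _) m _); exact: dmap_eq.
Qed.

Section Sub.
Variables (B : sSet) (S : forall n, B n -> Prop) (Sc : sclosed S).

Definition Sub : sSet.
Proof.
refine (@SSet (fun n => {x : B n | S x})
  (fun m n f x => exist _ (act f (sval x)) (Sc f (svalP x))) _ _).
- by move=> n [x xP]; apply: eq_exist; exact: act_id.
- by move=> m n q f g [x xP]; apply: eq_exist; exact: act_cmp.
Defined.

Definition incl : sMap Sub B :=
  @SMap Sub B (fun n x => sval x) (fun _ _ _ _ => erefl).

Variable K : sSet.

Definition restr : sMap (ihom B K) (ihom Sub K).
Proof.
refine (@SMap (ihom B K) (ihom Sub K) (fun n g =>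
  smap_cmp g (spair (sfst _ _) (smap_cmp incl (ssnd _ _)))) _).
by move=> m n f g; exact: ihom_eq.
Defined.

Lemma flip_restr (A : sSet) (f : sMap A (ihom B K)) :
  flip (smap_cmp restr f) = smap_cmp (flip f) incl.
Proof. by apply: smap_eq => n x; exact: ihom_eq. Qed.

(** By the exponential law this is an extension problem from the pushout
    product of S with the given inclusion and an end of the interval, which a
    Kan complex solves. *)
Lemma restr_cyl_fib : kan K -> cyl_fib restr.
Proof.
move=> kK B' S' e Sc' G b [Gf Ga] GS Gb.
have Sbc : sclosed (box S' S) by exact: box_scl.
have [||h hG] := @kan_ext_pt K kK _ _ e Sbc (fun n z k =>
  (exists2 g : ihom B K n, G n (z.1.1, z.2) g & (g : sMap _ _) n (did n, z.1.2) = k) \/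
  exists Sy, (b n (z.1.1, z.2) : sMap _ _) n (did n, exist _ z.1.2 Sy) = k).
- have gb n x t y g Sy : G n (x, t) g ->
      g n (did n, y) = b n (x, t) n (did n, exist _ y Sy).
    by move/Gb => <-.
  split.
    move=> n [[x y] t] k k' /= [[g Gg <-]|[Sy <-]] [[g' Gg' <-]|[Sy' <-]].
    + by rewrite (Gf _ _ _ _ Gg Gg').
    + exact: gb.
    + by symmetry; exact: gb.
    + by rewrite (Prop_irrelevance Sy Sy').
  move=> m n f [[x y] t] k /= [[g Gg <-]|[Sy <-]].
    left; exists (iact f g); first exact: (Ga _ _ _ (_, _)).
    by rewrite -ihom_ev -smap_act /=; congr (g m (_, _)); exact: dmap_eq.
  right; exists (Sc f Sy).
  rewrite -[(act f x, act f t)]/(act f ((x, t) : sprod B' (simplex 1) n)) smap_act -ihom_ev -smap_act.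
  by congr (b n (x, t) m (_, _)); [exact: dmap_eq|exact: eq_exist].
- move=> n [[x y] t] /= [[/= Sx|/= Sy]|/= te].
  + by have [|g Gg] := GS n (x, t); [left|exists (g n (did n, y)); left; exists g].
  + by exists (b n (x, t) n (did n, exist _ y Sy)); right; exists Sy.
  + by have [|g Gg] := GS n (x, t); [right|exists (g n (did n, y)); left; exists g].
exists (curry (smap_cmp h (spair (spair (smap_cmp (sfst _ _) (sfst _ _)) (ssnd _ _))
   (smap_cmp (ssnd _ _) (sfst _ _))))); split=> n [x t].
  move=> g bx Gg; apply: ihom_eq => m f y /=; apply: hG.
    by case: bx => [/= Sx|/= te]; [left; left; exact: Sc'|right; exact: ptP_scl].
  left; exists (iact f g); first exact: (Ga _ _ _ (_, _)).
  by rewrite -ihom_ev.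
apply: ihom_eq => m f [y Sy] /=; apply: hG; first by left; right.
right; exists Sy => /=.
rewrite -[(act f x, act f t)]/(act f ((x, t) : sprod B' (simplex 1) n)) smap_act -ihom_ev.
by [].
Qed.

End Sub.

(** * Acyclic subcomplexes *)

Lemma ext_retract (D D' : sSet) (S : forall n, D n -> Prop)
    (S' : forall n, D' n -> Prop) (s : sMap D D') (r : sMap D' D) (K : sSet) :
  (forall n x, r n (s n x) = x) -> (forall n x, S n x -> S' n (s n x)) ->
  (forall n y, S' n y -> S n (r n y)) -> extends S' K -> extends S K.
Proof. by move=> rs sS rS' /rlp_ext l; apply/rlp_ext; exact: rlp_retract l. Qed.

(** Every Kan complex sees the inclusion of S into B as a trivial cofibration,
    even after a pushout product with an arbitrary inclusion T. For
    subcomplexes this amounts to being a weak equivalence ([weq_acyc],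
    [acyc_weq]), and in this form it is visibly stable under pushout products
    ([acyc_box]). *)
Definition acyc (B : sSet) (S : forall n, B n -> Prop) : Prop :=
  forall K, kan K -> forall (D : sSet) (T : forall n, D n -> Prop), sclosed T -> extends (box S T) K.

(** Restriction from B to S is a fibration of function complexes into K, and a
    homotopy equivalence: a homotopy inverse is found by testing the weak
    equivalence against function complexes. By Dold it lifts against every
    inclusion T, which is the extension property, by the exponential law. *)
Lemma weq_acyc (B : sSet) (S : forall n, B n -> Prop) (Sc : sclosed S) :
  weq (incl Sc) -> acyc S.
Proof.
move=> wi K kK D T Tc; pose Y := ihom (Sub Sc) K.
have kY : kan Y by exact: kan_ihom.
have kYK : kan (ihom Y K) by exact: kan_ihom.
have kBK : kan (ihom B K) by exact: kan_ihom.
have [psi psiP] := (wi _ kYK).2 (flip (sid Y)).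
pose g : sMap Y (ihom B K) := flip psi.
have rg : elem_homotopic (smap_cmp (restr Sc K) g) (sid Y).
  rewrite -[smap_cmp _ _]flipK -[sid Y]flipK; apply: flip_eh.
  by rewrite flip_restr flipK; exact: homotopic_eh.
have gr : elem_homotopic (smap_cmp g (restr Sc K)) (sid (ihom B K)).
  rewrite -[smap_cmp _ _]flipK -[sid _]flipK; apply: flip_eh.
  have kEK : kan (ihom (ihom B K) K) by exact: kan_ihom.
  apply: (homotopic_eh kEK); apply: (wi _ kEK).1; apply: eh_homotopic.
  rewrite -!flip_restr; apply: flip_eh.
  by rewrite smap_cmp1 smap_cmpA -[X in elem_homotopic _ X]smap_1cmp; exact: eh_pre.
have L := dold (restr_cyl_fib (Sc := Sc) kK) kBK rg gr Tc.
move=> G [Gf Ga] GS.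
have swap m n (f : dmap m n) (d : D n) (y : B n) k : G n (y, d) k -> G m (act f y, act f d) (act f k).
  exact: (Ga _ _ f (_, _)).
have bex n (d : D n) : exists c : ihom (Sub Sc) K n,
    forall m (f : dmap m n) y, G m (sval y, act f d) ((c : sMap _ _) m (f, y)).
  have [||c cG] := @graph_map (sprod (simplex n) (Sub Sc)) K (fun m z k => G m (sval z.2, act z.1 d) k).
  - split=> [m z k k'|m q f [t y] k Gk]; first exact: Gf.
    by rewrite /= act_cmp; exact: swap.
  - by move=> m [t [y Sy]]; apply: GS; left.
  by exists c => m f y; exact: (cG m (f, y)).
have [||b bG] := @graph_map D (ihom (Sub Sc) K) (fun n d c =>
    forall m (f : dmap m n) y, G m (sval y, act f d) ((c : sMap _ _) m (f, y))).
- split=> [n d c c' cG cG'|m n f d c cG q t y /=].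
    by apply: ihom_eq => m f y; exact: Gf (cG _ _ _) (cG' _ _ _).
  by rewrite -act_cmp; exact: cG.
- exact: bex.
have [|||h [hG hb]] := L (fun n d (c : ihom B K n) => T n d /\
    forall m (f : dmap m n) y, G m (y, act f d) ((c : sMap _ _) m (f, y))) b.
- split=> [n d c c' [Td cG] [_ cG']|m n f d c [Td cG]].
    by apply: ihom_eq => m f y; exact: Gf (cG _ _ _) (cG' _ _ _).
  by split=> [|q t y /=]; [exact: Tc|rewrite -act_cmp; exact: cG].
- move=> n d Td.
  have [||c cG] := @graph_map (sprod (simplex n) B) K (fun m z k => G m (z.2, act z.1 d) k).
  + split=> [m z k k'|m q f [t y] k Gk]; first exact: Gf.
    by rewrite /= act_cmp; exact: swap.
  + by move=> m [t y]; apply: GS; right; exact: Tc.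
  by exists c; split=> // m f y; exact: (cG m (f, y)).
- move=> n d c [Td cG]; apply: ihom_eq => m f [y Sy].
  apply: Gf; last exact: (bG n d m f (exist _ y Sy)).
  exact: cG.
exists (smap_cmp (uncurry h) (spair (ssnd _ _) (sfst _ _))) => n [y d] k /= [/= Sy|/= Td] Gk.
- have := congr1 (fun c : ihom (Sub Sc) K n => (c : sMap _ _) n (did n, exist _ y Sy)) (hb n d).
  move=> /= ->; apply: Gf Gk; have := bG n d n (did n) (exist _ y Sy).
  by rewrite /= act_id.
- have [||c cG] := @graph_map (sprod (simplex n) B) K (fun m z k => G m (z.2, act z.1 d) k).
  + split=> [m z k0 k'|m q f [t z] k0 Gk0]; first exact: Gf.
    by rewrite /= act_cmp; exact: swap.
  + by move=> m [t z]; apply: GS; right; exact: Tc.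
  rewrite (hG n d c) //; last by split=> // m f z; exact: (cG m (f, z)).
  by apply: Gf Gk; have := cG n (did n, y); rewrite /= act_id.
Qed.

Lemma acyc_ext (B : sSet) (S : forall n, B n -> Prop) K : acyc S -> kan K -> extends S K.
Proof.
move=> aS kK.
have L := aS K kK sunit (fun _ _ => False) (fun _ _ _ _ x => x).
apply: (ext_retract (s := spair (sid B) (to_unit B)) (r := sfst B sunit) _ _ _ L) => //.
- by move=> n x Sx; left.
- by move=> n x [].
Qed.

(** Extending along S with T empty gives surjectivity on homotopy classes,
    with T the two ends of an interval injectivity. *)
Lemma acyc_weq (B : sSet) (S : forall n, B n -> Prop) (Sc : sclosed S) :
  acyc S -> weq (incl Sc).
Proof.
move=> aS K kK; split=> [g h /(homotopic_eh kK)[H HP]|h].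
  apply: eh_homotopic.
  have Tc : sclosed (fun n (t : simplex 1 n) => ptP ord0 t \/ ptP ord_max t).
    by move=> m n f t [t0|t1]; [left|right]; exact: ptP_scl.
  have [||M MG] := aS K kK (simplex 1) _ Tc (fun n z k =>
     [\/ exists Sx, k = H n (exist _ z.1 Sx, z.2), ptP ord0 z.2 /\ k = g n z.1 |
         ptP ord_max z.2 /\ k = h n z.1]).
  - have H0 n x Sx : H n (exist _ x Sx, dconst n ord0) = g n x.
      by rewrite (HP n (exist _ x Sx)).1.
    have H1 n x Sx : H n (exist _ x Sx, dconst n ord_max) = h n x.
      by rewrite (HP n (exist _ x Sx)).2.
    split.
      move=> n [x t] k k' /= [[Sx ->]|[t0 ->]|[t1 ->]] [[Sx' ->]|[t0' ->]|[t1' ->]] //.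
      + by rewrite (Prop_irrelevance Sx Sx').
      + by move/ptPE: t0' => ->; rewrite H0.
      + by move/ptPE: t1' => ->; rewrite H1.
      + by move/ptPE: t0 => ->; rewrite H0.
      + by case: (ptP01 t0 t1').
      + by move/ptPE: t1 => ->; rewrite H1.
      + by case: (ptP01 t0' t1).
    move=> m n f [x t] k /= [[Sx ->]|[t0 ->]|[t1 ->]].
    + constructor 1; exists (Sc _ _ f _ Sx); rewrite -smap_act.
      by congr (H m (_, _)); exact: eq_exist.
    + by constructor 2; split; [exact: ptP_scl|rewrite smap_act].
    + by constructor 3; split; [exact: ptP_scl|rewrite smap_act].
  - move=> n [x t] [/= Sx|/= [t0|t1]].
    + by exists (H n (exist _ x Sx, t)); constructor 1; exists Sx.
    + by exists (g n x); constructor 2.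
    + by exists (h n x); constructor 3.
  exists M => n x; split; apply: MG; try by right; [left|right].
  + by right; left.
  + by constructor 2.
  + by right; right.
  + by constructor 3.
have [||g gG] := acyc_ext aS kK (G := fun n x k => exists Sx, k = h n (exist _ x Sx)).
- split=> [n x k k' [Sx ->] [Sx' ->]|m n f x k [Sx ->]].
    by rewrite (Prop_irrelevance Sx Sx').
  exists (Sc _ _ f _ Sx); rewrite -smap_act; congr (h m _); exact: eq_exist.
- by move=> n x Sx; exists (h n (exist _ x Sx)), Sx.
exists g; have -> : smap_cmp g (incl Sc) = h; last exact: rst_refl.
by apply: smap_eq => n [x Sx] /=; apply: gG => //; exists Sx.
Qed.

Definition assoc (A B D : sSet) : sMap (sprod (sprod A B) D) (sprod A (sprod B D)) :=
  spair (smap_cmp (sfst _ _) (sfst _ _)) (spair (smap_cmp (ssnd _ _) (sfst _ _)) (ssnd _ _)).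
Definition assocV (A B D : sSet) : sMap (sprod A (sprod B D)) (sprod (sprod A B) D) :=
  spair (spair (sfst _ _) (smap_cmp (sfst _ _) (ssnd _ _))) (smap_cmp (ssnd _ _) (ssnd _ _)).
Definition swap (A B : sSet) : sMap (sprod A B) (sprod B A) := spair (ssnd _ _) (sfst _ _).

Lemma acyc_box (B D : sSet) (S : forall n, B n -> Prop) (T : forall n, D n -> Prop) :
  acyc S -> sclosed T -> acyc (box S T).
Proof.
move=> aS Tc K kK D' T' T'c.
have L := aS K kK _ _ (box_scl Tc T'c).
apply: (ext_retract (s := assoc B D D') (r := assocV B D D') _ _ _ L).
- by move=> n [[x y] z].
- by move=> n [[x y] z] [[/= h|/= h]|/= h]; [left|right; left|right; right].
- by move=> n [x [y z]] [/= h|[/= h|/= h]]; [left; left|left; right|right].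
Qed.

Lemma acyc_swap (B D : sSet) (S : forall n, B n -> Prop) (T : forall n, D n -> Prop) :
  acyc (box S T) -> acyc (box T S).
Proof.
move=> aS K kK D' T' T'c; have L := aS K kK _ _ T'c.
pose f A C := spair (smap_cmp (swap A C) (sfst (sprod A C) D')) (ssnd (sprod A C) D').
apply: (ext_retract (s := f D B) (r := f B D) _ _ _ L).
- by move=> n [[x y] z].
- by move=> n [[x y] z] [[/= h|/= h]|/= h]; [left; right|left; left|right].
- by move=> n [[x y] z] [[/= h|/= h]|/= h]; [left; right|left; left|right].
Qed.

Lemma acyc_horn n (i : 'I_n.+2) : acyc (@hornP n.+1 i).
Proof.
move=> K kK D T Tc; have L := @kan_ext_horn K kK D T n i Tc.
apply: (ext_retract (s := swap _ _) (r := swap _ _) _ _ _ L).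
- by move=> m [x y].
- by move=> m [x y] [/= h|/= h]; [right|left].
- by move=> m [x y] [/= h|/= h]; [right|left].
Qed.

(** A map with the lifting property against all inclusions has a section, and
    the lifting property on a cylinder gives the homotopy from the other
    composite to the identity. *)
Lemma rlp_weq (E F : sSet) (p : sMap E F) : (forall n, rlp (@bdry n) p) -> weq p.
Proof.
move=> lb; have L := rlp_cells lb.
have [|//|//|s [_ ps]] := L F (fun _ _ => False) (fun _ _ _ => False) (sid F).
  by split.
apply: hequiv_weq; exists s; split; last first.
  have -> : smap_cmp p s = sid F; last exact: rst_refl.
  exact: smap_eq.
apply: eh_homotopic.
have [|||H [HG _]] := L (sprod E (simplex 1))
  (fun n z => ptP ord0 z.2 \/ ptP ord_max z.2)
  (fun n z e => (ptP ord0 z.2 /\ e = s n (p n z.1)) \/ (ptP ord_max z.2 /\ e = z.1))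
  (smap_cmp p (sfst _ _)).
- split.
    move=> n [x u] e e' /= [[u0 ->]|[u1 ->]] [[u0' ->]|[u1' ->]] //.
      by case: (ptP01 u0 u1').
    by case: (ptP01 u0' u1).
  move=> m n t [x u] e /= [[u0 ->]|[u1 ->]].
    by left; split; [exact: ptP_scl|rewrite !smap_act].
  by right; split; first exact: ptP_scl.
- move=> n [x u] [u0|u1]; first by exists (s n (p n x)); left.
  by exists x; right.
- by move=> n [x u] e /= [[_ ->]|[_ ->]] //; rewrite ps.
by exists H => n x; split; apply: HG; [left|left|right|right].
Qed.

(** * The mapping path fibration *)

Section MPath.
Variables (X Y : sSet) (f : sMap X Y).

Definition mpath_simp n : Type := {z : X n * ihom (simplex 1) Y n |
  forall m (t : dmap m n), (z.2 : sMap _ _) m (t, dconst m ord0) = f m (act t z.1)}.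

Definition mpath_act m n (t : dmap m n) (z : mpath_simp n) : mpath_simp m.
Proof.
exists (act t (sval z).1, act t (sval z).2) => q u /=.
by rewrite -act_cmp -(svalP z).
Defined.

Lemma mpath_eq n (z z' : mpath_simp n) :
  (sval z).1 = (sval z').1 -> (sval z).2 = (sval z').2 -> z = z'.
Proof.
by case: z z' => [[x g] P] [[x' g'] P'] /= e e'; apply: eq_exist; rewrite e e'.
Qed.

(** The mapping path space of f: pairs of a point x of X and a path in Y
    starting at f x. The map f is the composite of the section [msec]
    (constant paths) and the evaluation [mev] at the far end. *)
Definition mpath : sSet.
Proof.
refine (@SSet mpath_simp mpath_act _ _).
- by move=> n z; apply: mpath_eq; exact: act_id.
- by move=> m n p t u z; apply: mpath_eq; exact: act_cmp.
Defined.

Definition mfst : sMap mpath X :=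
  @SMap mpath X (fun n z => (sval z).1) (fun _ _ _ _ => erefl).

Definition mev : sMap mpath Y.
Proof.
refine (@SMap mpath Y (fun n z => ((sval z).2 : sMap _ _) n (did n, dconst n ord_max)) _).
move=> m n t z; rewrite -smap_act /=.
by congr (_ _ _ (_, _)); exact: dmap_eq.
Defined.

Definition msec : sMap X mpath.
Proof.
refine (@SMap X mpath (fun n x => exist _ (x, @SMap (sprod (simplex n) (simplex 1)) Y
  (fun m z => f m (act z.1 x)) _) _) _).
  move=> m n t x; apply: mpath_eq => //=; apply: ihom_eq => q u v /=.
  by rewrite act_cmp.
Unshelve.
- by move=> m q t [u v] /=; rewrite act_cmp smap_act.
- by [].
Defined.

Lemma mev_sec n x : mev n (msec n x) = f n x.
Proof. by rewrite /= act_id. Qed.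

Hypothesis kY : kan Y.

(** A lift over b : D -> X is a family of paths with given starting points, so
    it is an extension problem on the cylinder of D from its bottom and its
    sides. *)
Lemma mfst_rlp (D : sSet) (S : forall n, D n -> Prop) : sclosed S -> rlp S mfst.
Proof.
move=> Sc G b [Gf Ga] GS Gb.
have [||h hG] := @kan_ext_pt Y kY D S ord0 Sc (fun n w y =>
  (exists z, [/\ S n w.1, G n w.1 z & y = ((sval z).2 : sMap _ _) n (did n, w.2)]) \/
  (ptP ord0 w.2 /\ y = f n (b n w.1))).
- have z0 n d z : G n d z -> ((sval z).2 : sMap _ _) n (did n, dconst n ord0) = f n (b n d).
    by move=> Gz; rewrite (svalP z) act_id -(Gb _ _ _ Gz).
  split.
    move=> n [d u] y y' /= [[z [Sd Gz ->]]|[u0 ->]] [[z' [Sd' Gz' ->]]|[u0' ->]] //.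
    + by rewrite (Gf _ _ _ _ Gz Gz').
    + by move/ptPE: u0' => ->; exact: z0.
    + by move/ptPE: u0 => ->; symmetry; exact: z0.
  move=> m n t [d u] y /= [[z [Sd Gz ->]]|[u0 ->]].
    left; exists (act t (z : mpath n)); split; [exact: Sc|exact: Ga|].
    by rewrite -smap_act /=; congr (_ _ _ (_, _)); exact: dmap_eq.
  by right; split; [exact: ptP_scl|rewrite !smap_act].
- move=> n [d u] [/= Sd|/= u0].
    by have [z Gz] := GS n d Sd; exists (((sval z).2 : sMap _ _) n (did n, u)); left; exists z.
  by exists (f n (b n d)); right.
have H0 n d m (t : dmap m n) :
    (curry h n d : sMap _ _) m (t, dconst m ord0) = f m (act t (b n d)).
  by rewrite -smap_act; apply: hG; [right|right].
pose H n d : mpath n := exist _ (b n d, curry h n d) (H0 n d).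
have HP m n (t : dmap m n) d : H m (act t d) = act t (H n d).
  by apply: mpath_eq; [exact: (smap_act b)|exact: (smap_act (curry h))].
exists (@SMap D mpath H HP); split=> n d // z Sd Gz.
apply: mpath_eq => /=; first by rewrite -(Gb _ _ _ Gz).
apply: ihom_eq => m t u /=; apply: hG; first by left; exact: Sc.
left; exists (act t (z : mpath n)); split; [exact: Sc|exact: Ga|].
by rewrite /=; congr (_ _ _ (_, _)); exact: dmap_eq.
Qed.

Lemma msec_weq : weq msec.
Proof.
have wf : weq mfst by apply: rlp_weq => n; apply: mfst_rlp; exact: bdry_scl.
apply: (weq_cancel_l wf); have -> : smap_cmp mfst msec = sid X by exact: smap_eq.
exact: weq_sid.
Qed.

Hypothesis kX : kan X.


(** The point x is extended first, using that X is Kan; then the path is a map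
    on a cylinder prescribed on S and on both ends. *)
Lemma mev_rlp (D : sSet) (S : forall n, D n -> Prop) : sclosed S -> acyc S -> rlp S mev.
Proof.
move=> Sc aS G b [Gf Ga] GS Gb.
have [||a aG] := acyc_ext aS kX (G := fun n d x => exists2 z, G n d z & x = mfst n z).
- split=> [n d x x' [z Gz ->] [z' Gz' ->]|m n t d x [z Gz ->]].
    by rewrite (Gf _ _ _ _ Gz Gz').
  by exists (act t z); [exact: Ga|rewrite smap_act].
- by move=> n d /GS[z Gz]; exists (mfst n z), z.
have aE n d z : S n d -> G n d z -> a n d = (sval z).1.
  by move=> Sd Gz; apply: aG => //; exists z.
have Tc : sclosed (fun n (t : simplex 1 n) => ptP ord0 t \/ ptP ord_max t).
  by move=> m n t u [t0|t1]; [left|right]; exact: ptP_scl.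
have z0 n (z : mpath n) : ((sval z).2 : sMap _ _) n (did n, dconst n ord0) = f n (sval z).1.
  by rewrite (svalP z) act_id.
have [||h hG] := aS Y kY (simplex 1) _ Tc (fun n w y =>
  [\/ exists z, [/\ S n w.1, G n w.1 z & y = ((sval z).2 : sMap _ _) n (did n, w.2)],
      ptP ord0 w.2 /\ y = f n (a n w.1) | ptP ord_max w.2 /\ y = b n w.1]).
- split.
    move=> n [d u] y y' /= [[z [Sd Gz ->]]|[u0 ->]|[u1 ->]] [[z' [Sd' Gz' ->]]|[u0' ->]|[u1' ->]] //.
    + by rewrite (Gf _ _ _ _ Gz Gz').
    + by move/ptPE: u0' => ->; rewrite z0 -(aE n d).
    + by move/ptPE: u1' => ->; rewrite -(Gb _ _ _ Gz).
    + by move/ptPE: u0 => ->; rewrite z0 -(aE n d).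
    + by case: (ptP01 u0 u1').
    + by move/ptPE: u1 => ->; rewrite -(Gb _ _ _ Gz').
    + by case: (ptP01 u0' u1).
  move=> m n t [d u] y /= [[z [Sd Gz ->]]|[u0 ->]|[u1 ->]].
  + constructor 1; exists (act t (z : mpath n)); split; [exact: Sc|exact: Ga|].
    by rewrite -smap_act /=; congr (_ _ _ (_, _)); exact: dmap_eq.
  + by constructor 2; split; [exact: ptP_scl|rewrite !smap_act].
  + by constructor 3; split; [exact: ptP_scl|rewrite smap_act].
- move=> n [d u] [/= Sd|/= [u0|u1]].
  + have [z Gz] := GS n d Sd; exists (((sval z).2 : sMap _ _) n (did n, u)).
    by constructor 1; exists z.
  + by exists (f n (a n d)); constructor 2.
  + by exists (b n d); constructor 3.
have H0 n d m (t : dmap m n) :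
    (curry h n d : sMap _ _) m (t, dconst m ord0) = f m (act t (a n d)).
  rewrite -smap_act.
  by apply: hG; [right; left|constructor 2].
pose H n d : mpath n := exist _ (a n d, curry h n d) (H0 n d).
have HP m n (t : dmap m n) d : H m (act t d) = act t (H n d).
  by apply: mpath_eq; [exact: (smap_act a)|exact: (smap_act (curry h))].
exists (@SMap D mpath H HP); split=> n d.
  move=> z Sd Gz; apply: mpath_eq => /=; first exact: aE.
  apply: ihom_eq => m t u /=; apply: hG; first by left; exact: Sc.
  constructor 1; exists (act t (z : mpath n)); split; [exact: Sc|exact: Ga|].
  by rewrite /=; congr (_ _ _ (_, _)); exact: dmap_eq.
by rewrite /= act_id; apply: hG; [right; right|constructor 3].
Qed.

Lemma mev_kan_fib : kan_fib mev.
Proof. by move=> n i; apply: mev_rlp; [exact: hornP_scl|exact: acyc_horn]. Qed.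

Lemma kan_mpath : kan mpath.
Proof. exact: kan_total mev_kan_fib kY. Qed.

Lemma mev_weq : weq f -> weq mev.
Proof.
move=> wf; apply: (weq_cancel_r msec_weq).
have -> // : smap_cmp mev msec = f.
by apply: smap_eq => n x; exact: mev_sec.
Qed.

(** The relative form of surjectivity: every simplex of Y with a lift of its
    boundary can be lifted up to a homotopy relative to the boundary. It holds
    because the evaluation [mev] is both a fibration and a weak equivalence.
    *)
Lemma rhlp : weq f -> forall (D : sSet) (S : forall n, D n -> Prop)
    (G : forall n, D n -> X n -> Prop) (b : sMap D Y), sclosed S -> sgraph G ->
  (forall n d, S n d -> exists x, G n d x) -> (forall n d x, G n d x -> f n x = b n d) ->
  exists (h : sMap D X) (H : sMap (sprod D (simplex 1)) Y),
    [/\ forall n d x, S n d -> G n d x -> h n d = x,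
        forall n d, H n (d, dconst n ord0) = f n (h n d) /\ H n (d, dconst n ord_max) = b n d &
        forall n d u, S n d -> H n (d, u) = b n d].
Proof.
move=> wf D S G b Sc [Gf Ga] GS Gb.
have [g [gp pg]] := weq_hequiv kan_mpath kY (mev_weq wf).
have L := dold (kan_fib_cyl mev_kan_fib) kan_mpath pg gp Sc.
have [|||h [hG hb]] := L (fun n d z => exists2 x, G n d x & z = msec n x) b.
- split=> [n d z z' [x Gx ->] [x' Gx' ->]|m n t d z [x Gx ->]].
    by rewrite (Gf _ _ _ _ Gx Gx').
  by exists (act t x); [exact: Ga|rewrite smap_act].
- by move=> n d /GS[x Gx]; exists (msec n x), x.
- by move=> n d z [x Gx ->]; rewrite mev_sec; exact: Gb.
pose H n (w : sprod D (simplex 1) n) : Y n := ((sval (h n w.1)).2 : sMap _ _) n (did n, w.2).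
have HP m n (t : dmap m n) w : H m (act t w) = act t (H n w).
  rewrite /H -smap_act /= smap_act /=; congr (_ _ _ (_, _)); exact: dmap_eq.
exists (smap_cmp mfst h), (@SMap (sprod D (simplex 1)) Y H HP); split.
- by move=> n d x Sd Gx; rewrite /= (hG n d (msec n x)) //; exists x.
- move=> n d; split; last exact: hb.
  by rewrite /= /H (svalP (h n d)) act_id.
- move=> n d u Sd; have [x Gx] := GS n d Sd.
  by rewrite /= /H (hG n d (msec n x)) //=; [rewrite act_id; exact: Gb|exists x].
Qed.

End MPath.

(** * Filling boundaries, and n-types *)

Definition fill (s : nat) (Y : sSet) : Prop := extends (@bdry s) Y.

(** An extension up to the homotopy from phi to the identity is corrected to a
    strict one by the homotopy extension property. *)
Lemma fill_homotopy (Y D : sSet) (S : forall n, D n -> Prop) (phi : sMap Y Y)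
    (G : forall n, D n -> Y n -> Prop) (k : sMap D Y) : kan Y -> sclosed S ->
  elem_homotopic phi (sid Y) -> sgraph G ->
  (forall n d, S n d -> exists e, G n d e) ->
  (forall n d e, S n d -> G n d e -> k n d = phi n e) ->
  exists h : sMap D Y, forall n d e, S n d -> G n d e -> h n d = e.
Proof.
move=> kY Sc [H HP] [Gf Ga] GS kG.
have [||M MG] := @kan_ext_pt Y kY D S ord0 Sc (fun n w y =>
  (exists e, [/\ S n w.1, G n w.1 e & y = H n (e, w.2)]) \/ (ptP ord0 w.2 /\ y = k n w.1)).
- split.
    move=> n [d u] y y' /= [[e [Sd Ge ->]]|[u0 ->]] [[e' [Sd' Ge' ->]]|[u0' ->]] //.
    + by rewrite (Gf _ _ _ _ Ge Ge').
    + by move/ptPE: u0' => ->; rewrite (HP _ _).1 (kG n d e).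
    + by move/ptPE: u0 => ->; rewrite (HP _ _).1 (kG n d e').
  move=> m n f [d u] y /= [[e [Sd Ge ->]]|[u0 ->]].
    by left; exists (act f e); split; [exact: Sc|exact: Ga|rewrite -smap_act].
  by right; split; [exact: ptP_scl|rewrite smap_act].
- move=> n [d u] [/= Sd|/= u0]; last by exists (k n d); right.
  by have [e Ge] := GS n d Sd; exists (H n (e, u)); left; exists e.
exists (smap_cmp M (at_end D ord_max)) => n d e Sd Ge; apply: MG; first by left.
by left; exists e; split=> //=; rewrite (HP n e).2.
Qed.

(** The boundary is moved to Y by g, filled there, and moved back by f. *)
Lemma fill_hequiv (Y Y' : sSet) (f : sMap Y Y') (g : sMap Y' Y) s : kan Y' ->
  elem_homotopic (smap_cmp f g) (sid Y') -> fill s Y -> fill s Y'.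
Proof.
move=> kY' fg fY G [Gf Ga] GS.
have [||h hG] := fY (fun n d y => exists2 e, G n d e & y = g n e).
- split=> [n d y y' [e Ge ->] [e' Ge' ->]|m n t d y [e Ge ->]].
    by rewrite (Gf _ _ _ _ Ge Ge').
  by exists (act t e); [exact: Ga|rewrite smap_act].
- by move=> n d /GS[e Ge]; exists (g n e), e.
apply: (fill_homotopy (k := smap_cmp f h) kY' (@bdry_scl s) fg) => //.
by move=> n d e bd Ge /=; rewrite (hG n d (g n e)) //; exists e.
Qed.

(** A count: the r + 1 values of f and the vertex i do not exhaust the s + 1
    vertices. *)
Lemma small_horn r s (f : dmap r s) (i : 'I_s.+1) : (r.+1 < s)%N -> in_horn i f.
Proof.
move=> rs; apply: contrapT => nh.
have : #|[set: 'I_s.+1]%SET| <= #|i |: [set f l | l : 'I_r.+1]|.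
  apply/subset_leq_card/subsetP => j _; rewrite !inE.
  have [//|ji] := eqVneq j i; apply/imsetP; apply: contrapT => nj.
  by apply: nh; exists j; split=> // l; apply/eqP => e; apply: nj; exists l.
rewrite cardsT card_ord cardsU1 => le.
have := leq_trans le (leq_add (leq_b1 _) (leq_imset_card _ _)).
by rewrite card_ord; lia.
Qed.

Lemma small_bdry r s (f : dmap r s) : (r < s)%N -> @bdry s r f.
Proof.
move=> rs; apply: contrapT => nb.
have : #|[set: 'I_s.+1]%SET| <= #|[set f l | l : 'I_r.+1]|.
  apply/subset_leq_card/subsetP => j _.
  apply/imsetP; apply: contrapT => nj.
  by apply: nb; exists j => l; apply/eqP => e; apply: nj; exists l.
rewrite cardsT card_ord => le.
by have := leq_trans le (leq_imset_card _ _); rewrite card_ord; lia.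
Qed.

Lemma skel_eq_equiv (X : sSet) n m (x y : X m) :
  Relation_Operators.clos_refl_sym_trans _ (@skel_eq X n m) x y -> skel_eq n x y.
Proof.
elim=> // {x y} [x y _ xy p f pn|x y z _ xy _ yz p f pn]; first by rewrite xy.
by rewrite xy // yz.
Qed.

Lemma qcl_inj (T : Type) (R : T -> T -> Prop) x y : qcl R x = qcl R y ->
  Relation_Operators.clos_refl_sym_trans T R x y.
Proof.
move=> /(congr1 sval) /= e; rewrite e; exact: rst_refl.
Qed.

(** A horn filler agrees with the given boundary on every simplex lying in the
    horn, in particular on all those of dimension at most n. *)
Lemma fill_skel (X : sSet) n s (G : forall m, simplex s m -> X m -> Prop) : kan X ->
  (n.+1 < s)%N -> sgraph G -> (forall m f, bdry f -> exists e, G m f e) ->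
  exists h : sMap (simplex s) X, forall m f e, bdry f -> G m f e -> skel_eq n e (h m f).
Proof.
move=> kX; case: s G => // s G ns [Gf Ga] GS.
have [//||h hG] := (rlp_ext _ _).1 ((kan_kan_fib X).1 kX s ord0) G.
  by move=> m f [j [_ fj]]; apply: GS; exists j.
exists h => m f e bf Ge r t rn.
rewrite -smap_act; symmetry; apply: hG; last exact: Ga.
by apply: small_horn; lia.
Qed.

(** Filling a horn contained in the boundary gives a simplex with the right
    boundary up to n-skeletal equality, hence with the right boundary in the
    Postnikov section. A homotopy inverse of the map to the Postnikov section
    turns this into a filler up to homotopy, and [fill_homotopy] corrects it.
    *)
Lemma ntype_fill n (X : sSet) : kan X -> weq (to_postnikov n X) ->
  forall s, (n.+1 < s)%N -> fill s X.
Proof.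
move=> kX wX s ns G sG GS; have [g gp] := (wX X kX).2 (sid X).
have [h hG] := fill_skel kX ns sG GS.
apply: (fill_homotopy (k := smap_cmp (smap_cmp g (to_postnikov n X)) h)
  kX (@bdry_scl s) (homotopic_eh kX gp)) => //.
move=> m f e bf Ge /=; congr (g m _); apply: qcl_eq; apply: rst_sym.
exact/rst_step/hG.
Qed.

(** Only cells of dimension at least N lie outside S, and they are filled one
    by one. *)
Lemma ext_trunc N (F : sSet) : (forall s, (N <= s)%N -> fill s F) ->
  forall (D : sSet) (S : forall n, D n -> Prop),
  (forall n x, (n < N)%N -> S n x) -> extends S F.
Proof.
move=> fF D S SN G sG GS.
have [//|G' [G'f G'a] GG' _ n t bt|h [_ hG]] :=
  @scells D F (fun _ _ _ => True) G _ sG (fun _ _ _ _ => I); last first.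
  by exists h => n x e _; exact: hG.
have [nN|Nn] := ltnP n N.
  have [w Gw] := GS n t (SN n t nN); exists w; split=> // m f e bf Ge.
  by apply: (G'f _ _ _ _ Ge); apply: G'a; exact: GG'.
have [||w wG] := fF n Nn (fun m f e => G' m (act f t) e).
- split=> [m f e e'|m q f g e Ge]; first exact: G'f.
  by rewrite /= act_cmp; exact: G'a.
- by move=> m f; exact: bt.
exists (w n (did n)); split=> // m f e bf Ge.
by rewrite -cls_id; symmetry; exact: wG.
Qed.

(** In these dimensions E and F have no homotopy to obstruct lifting: a filler
    c in E has an image p c that differs from b by a homotopy relative to the
    boundary, because the cells of the prism that this homotopy has to be
    defined on have dimension at least N, where F fills boundaries; p lifts
    this homotopy. *)
Lemma fill_rlp N (E F : sSet) (p : sMap E F) : cyl_fib p -> kan E ->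
  (forall s, (N <= s)%N -> fill s E) -> (forall s, (N <= s)%N -> fill s F) ->
  forall s, (N <= s)%N -> rlp (@bdry s) p.
Proof.
move=> hp kE fE fF s Ns G b sG GS Gb; have [Gf Ga] := sG.
have [c cG] := fE s Ns G sG GS.
pose T n (t : simplex 1 n) := ptP ord0 t \/ ptP ord_max t.
have Tc : sclosed T by move=> m n f t [t0|t1]; [left|right]; exact: ptP_scl.
have [|||K KP] := @ext_trunc N F fF _ (box (@bdry s) T) _ (fun n w y =>
   [\/ bdry w.1 /\ y = b n w.1, ptP ord0 w.2 /\ y = p n (c n w.1) |
       ptP ord_max w.2 /\ y = b n w.1]).
- by move=> n [f u] nN; left; apply: small_bdry; lia.
- have bc n f : bdry f -> p n (c n f) = b n f.
    by move=> bf; have [e Ge] := GS n f bf; rewrite (cG n f e) //; exact: Gb.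
  split.
    move=> n [f u] y y' /= [[bf ->]|[u0 ->]|[u1 ->]] [[bf' ->]|[u0' ->]|[u1' ->]] //.
    + by rewrite bc.
    + by rewrite bc.
    + by case: (ptP01 u0 u1').
    + by case: (ptP01 u0' u1).
  move=> m n t [f u] y /= [[bf ->]|[u0 ->]|[u1 ->]].
  + by constructor 1; split; [exact: bdry_scl|rewrite -smap_act].
  + by constructor 2; split; [exact: ptP_scl|rewrite -!smap_act].
  + by constructor 3; split; [exact: ptP_scl|rewrite -smap_act].
- move=> n [f u] [/= bf|/= [u0|u1]].
  + by exists (b n f); constructor 1.
  + by exists (p n (c n f)); constructor 2.
  + by exists (b n f); constructor 3.
have [|||M [MG Mb]] := hp _ (@bdry s) ord0 (@bdry_scl s) (fun n w y =>
  (bdry w.1 /\ G n w.1 y) \/ (ptP ord0 w.2 /\ y = c n w.1)) K.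
- split.
    move=> n [f u] y y' /= [[bf Gy]|[u0 ->]] [[bf' Gy']|[u0' ->]] //.
    + exact: Gf Gy Gy'.
    + by symmetry; exact: cG.
    + exact: cG.
  move=> m n t [f u] y /= [[bf Gy]|[u0 ->]].
    by left; split; [exact: bdry_scl|exact: Ga].
  by right; split; [exact: ptP_scl|rewrite -smap_act].
- move=> n [f u] [/= bf|/= u0]; last by exists (c n f); right.
  by have [y Gy] := GS n f bf; exists y; left.
- move=> n [f u] y /= [[bf Gy]|[u0 ->]].
    by rewrite (Gb _ _ _ Gy); symmetry; apply: KP; [left|constructor 1].
  by symmetry; apply: KP; [right; left|constructor 2].
exists (smap_cmp M (at_end _ ord_max)); split.
  by move=> n f e bf Ge; apply: MG; left.
by move=> n f /=; rewrite Mb; apply: KP; [right; right|constructor 3].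
Qed.

(** * Finite Galois extensions inside an algebraically closed field *)

Section FieldTheory.
Import GRing.Theory.
Local Open Scope ring_scope.
Variable k : fieldType.

Lemma make_ahom (L M : fieldExtType k) (g : L -> M) :
  linear g -> {morph g : x y / x * y} -> g 1 = 1 ->
  exists a : 'AHom(L, M), forall x, a x = g x.
Proof.
move=> lg mg g1.
pose gL : {linear L -> M} := HB.pack g (GRing.isLinear.Build k L M _ g lg).
have gM : monoid_morphism g by split.
pose gA : {lrmorphism L -> M} := HB.pack g
  (GRing.isLinear.Build k L M _ g lg) (GRing.isMonoidMorphism.Build L M g gM).
exists (AHom (linfun_is_ahom gA)) => x.
exact: (lfunE gA x).
Qed.

Variables (kbar : closedFieldType) (iota : {rmorphism k -> kbar}).

(** An inclusion of images in the closed field is a morphism of extensions. *)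
Lemma emb_ahom (L M : fieldExtType k) (eL : {rmorphism L -> kbar})
    (eM : {rmorphism M -> kbar}) :
  (forall a : k, eL a%:A = iota a) -> (forall a : k, eM a%:A = iota a) ->
  (forall x, exists y, eM y = eL x) ->
  exists a : 'AHom(L, M), forall x, eM (a x) = eL x.
Proof.
move=> eLk eMk LM; have [g gP] := choice LM.
have eMi := fmorph_inj eM.
have [|||a aP] := @make_ahom L M g.
- move=> c x y; apply: eMi; rewrite rmorphD /= !gP rmorphD /=; congr (_ + _).
  by rewrite -[c *: x]mulr_algl -[c *: g x]mulr_algl !rmorphM /= eLk eMk !gP.
- by move=> x y; apply: eMi; rewrite rmorphM /= !gP rmorphM.
- by apply: eMi; rewrite gP !rmorph1.
by exists a => x; rewrite aP.
Qed.

(** The field generated by L and z, with its embedding. The minimal polynomial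
    of z over L exists because membership in the image of L is classically
    decidable. *)
Lemma adjoin_emb (L : fieldExtType k) (e : {rmorphism L -> kbar}) (z : kbar) :
  (forall a : k, e a%:A = iota a) ->
  (exists2 p : {poly k}, p \is monic & root (map_poly iota p) z) ->
  exists (M : fieldExtType k) (eM : {rmorphism M -> kbar}) (a : 'AHom(L, M)) (w : M),
    [/\ forall c : k, eM c%:A = iota c, forall x, eM (a x) = e x, eM w = z &
        forall u : M, exists p : {poly L}, u = (map_poly a p).[w]].
Proof.
move=> eP [p0 mp0 rp0].
have [||p [mp pz ip]] := @minPoly_decidable_closure L kbar e z.
- move=> x; have [ex|nx] := pselect (exists y, e y = x); last by right=> -[y yx]; case: nx; exists y.
  by left; case: (cid ex) => y <-; exists y.
- exists (map_poly (in_alg L) p0); first by rewrite map_monic.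
  rewrite -map_poly_comp (eq_map_poly (g := iota)) // => c /=; exact: eP.
have nzp := monic_neq0 mp.
pose Q := SubFieldExtType pz ip.
pose eQ : {rmorphism Q -> kbar} := @subfx_inj _ _ e z p.
pose M : fieldExtType k := baseFieldType Q.
pose eM : {rmorphism M -> kbar} := eQ.
have eMk (c : k) : eM (c%:A : M) = iota c.
  have -> : (c%:A : M) = ((c%:A : L)%:A : Q) by [].
  by rewrite /eM /eQ /= subfx_inj_base.
have [||x|a aP] := @emb_ahom L M e eM _ _ _.
- exact: eP.
- exact: eMk.
- by exists (x%:A : Q); rewrite /eM /eQ /= subfx_inj_base.
exists M, eM, a, (subfx_root e z p : Q); split=> //.
- by rewrite /eM /eQ /= subfx_inj_root.
- move=> u; have [q uq] := subfxEroot pz nzp (u : Q); exists q.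
  apply: (fmorph_inj eM); rewrite -horner_map /= -map_poly_comp.
  rewrite (eq_map_poly (g := e)); last by move=> x /=; exact: aP.
  rewrite {1}uq /eM /eQ /= -horner_map /= -map_poly_comp; congr _.[_].
  by apply: eq_map_poly => x /=; exact: subfx_inj_base.
Qed.

End FieldTheory.

Section Join.
Import GRing.Theory.
Local Open Scope ring_scope.
Variable k : fieldType.

Variables (kbar : closedFieldType) (iota : {rmorphism k -> kbar}).

(** A separable splitting field, already embedded in the closed field. *)
Lemma mk_galsub (M : fieldExtType k) (eM : {rmorphism M -> kbar}) (p : {poly M})
    (rs : seq M) : (forall c : k, eM c%:A = iota c) ->
  p \is a polyOver 1%VS -> p %= \prod_(x <- rs) ('X - x%:P) ->
  <<1 & rs>>%VS = fullv -> all (separable_element 1%AS) rs ->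
  exists (G : galsub iota) (i : 'AHom(M, gfld G)), forall x, gemb G (i x) = eM x.
Proof.
move=> eMk p1 prs rsf rsep.
have ax : SplittingField.axiom M by exists p => //; exists rs.
pose N : splittingFieldType k := HB.pack M (FieldExt_isSplittingField.Build k M ax).
have gN : galois 1%AS {:N}.
  apply/and3P; split; [exact: sub1v| |exact: normalFieldf].
  by have := separable_Fadjoin_seq rsep; rewrite /= rsf.
exists (@GalSub k kbar iota N gN eM eMk), (\1%AF : 'AHom(M, M)) => x /=.
by rewrite id_lfunE.
Qed.

Lemma ahom_over1 (L M : fieldExtType k) (a : 'AHom(L, M)) (p : {poly L}) :
  p \is a polyOver 1%VS -> map_poly a p \is a polyOver 1%VS.
Proof.
move=> /polyOver1P[q ->]; apply/polyOver1P; exists q.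
by rewrite -map_poly_comp; apply: eq_map_poly => c /=; rewrite rmorph_alg.
Qed.

Lemma ahom_separable (L M : fieldExtType k) (a : 'AHom(L, M)) (x : L) :
  separable_element 1%AS x -> separable_element 1%AS (a x).
Proof.
move=> /separable_elementP[p [p1 px sp]]; apply/separable_elementP.
exists (map_poly a p); split; first exact: ahom_over1.
  by rewrite fmorph_root.
by rewrite separable_map.
Qed.

Lemma galsub_exists : exists E : galsub iota, True.
Proof.
have [|||||G _] := @mk_galsub k^o iota 1 [::] _ _ _ _ _; last by exists G.
- by move=> c; rewrite /GRing.scale /= mulr1.
- exact: rpred1.
- by rewrite big_nil eqpxx.
- by rewrite Fadjoin_nil regular_fullv.
- by [].
Qed.

(** The compositum: adjoin to E a primitive element y of F. The result is the
    splitting field of the product of the polynomials defining E and F, and it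
    is generated by separable elements. *)
Lemma galsub_join (E F : galsub iota) : exists (G : galsub iota)
  (a : 'AHom(gfld E, gfld G)) (b : 'AHom(gfld F, gfld G)), gincl a /\ gincl b.
Proof.
pose y := separable_generator 1%AS {:gfld F}.
have Fy : {:gfld F}%VS = <<1; y>>%VS.
  by have /and3P[s1 sep _] := ggal F; rewrite -eq_adjoin_separable_generator.
have [p0 [mp0 rp0]] : exists p : {poly k}, p \is monic /\ root (map_poly iota p) (gemb F y).
  have /polyOver1P[p pE] := minPolyOver 1%AS y.
  exists p; split; first by rewrite -(map_monic (in_alg (gfld F))) -pE monic_minPoly.
  have := root_minPoly 1%AS y; rewrite pE -(fmorph_root (gemb F)) -map_poly_comp.
  by rewrite (eq_map_poly (g := iota)) // => c /=; exact: gembE.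
have [||M [eM [a [w [eMk aP wP Mw]]]]] := @adjoin_emb k kbar iota (gfld E) (gemb E) (gemb F y).
- exact: gembE.
- by exists p0.
have [|||b bP] := @emb_ahom k kbar iota (gfld F) M (gemb F) eM.
- exact: gembE.
- exact: eMk.
- move=> x; have : x \in {:gfld F}%VS by exact: memvf.
  rewrite Fy => /Fadjoin1_polyP[q ->].
  exists (map_poly (in_alg M) q).[w]; rewrite -!horner_map /= wP -!map_poly_comp.
  by congr _.[_]; apply: eq_map_poly => c /=; rewrite eMk gembE.
have bw : b y = w by apply: (fmorph_inj eM); rewrite bP wP.
have [pE pE1 [rE pErE EE]] := splittingFieldP (gfld E).
have [pF pF1 [rF pFrF FF]] := splittingFieldP (gfld F).
have sepE : all (separable_element 1%AS) (map a rE).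
  apply/allP => _ /mapP[x _ ->]; apply: ahom_separable.
  by have /and3P[_ /separableP sep _] := ggal E; apply: sep; exact: memvf.
have sepF : all (separable_element 1%AS) (map b rF).
  apply/allP => _ /mapP[x _ ->]; apply: ahom_separable.
  by have /and3P[_ /separableP sep _] := ggal F; apply: sep; exact: memvf.
have mapr (L : fieldExtType k) (c : 'AHom(L, M)) (r : seq L) :
    map_poly c (\prod_(x <- r) ('X - x%:P)) = \prod_(x <- map c r) ('X - x%:P).
  rewrite big_map rmorph_prod; apply: eq_bigr => x _.
  by rewrite rmorphB /= map_polyX map_polyC.
have [|||||G [i iP]] := @mk_galsub M eM (map_poly a pE * map_poly b pF) (map a rE ++ map b rF).
- exact: eMk.
- by rewrite rpredM // ahom_over1.
- rewrite big_cat /=; apply: eqp_trans (eqp_mulr _ _) (eqp_mull _ _).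
    by rewrite -mapr eqp_map.
  by rewrite -mapr eqp_map.
- apply/eqP; rewrite eqEsubv subvf /=; apply/subvP => u _.
  have aE x : a x \in <<1 & (map a rE ++ map b rF)>>%VS.
    have : a x \in (a @: <<1 & rE>>)%VS by rewrite EE memv_img // memvf.
    rewrite aimg_adjoin_seq aimg1; apply: subvP; apply: adjoin_seqSr => z zr.
    by rewrite mem_cat zr.
  have bF x : b x \in <<1 & (map a rE ++ map b rF)>>%VS.
    have : b x \in (b @: <<1 & rF>>)%VS by rewrite FF memv_img // memvf.
    rewrite aimg_adjoin_seq aimg1; apply: subvP; apply: adjoin_seqSr => z zr.
    by rewrite mem_cat zr orbT.
  have [q ->] := Mw u; rewrite -bw horner_poly; apply: rpred_sum => j _.
  by apply: rpredM; [exact: aE|apply: rpredX; exact: bF].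
- by rewrite all_cat sepE sepF.
exists G, (i \o a)%AF, (i \o b)%AF; split=> x.
  by rewrite comp_lfunE iP aP.
by rewrite comp_lfunE iP bP.
Qed.

End Join.

(** * Embeddings of Galois extensions form torsors *)

Section Torsor.
Import GRing.Theory.
Variable k : fieldType.
Local Open Scope ring_scope.

Lemma gal_in (L : splittingFieldType k) (g : gal_of {:L}) : g \in 'Gal({:L} / 1%AS)%g.
Proof. by rewrite gal_kHom ?sub1v // k1AHom. Qed.

(** Normality: the minimal polynomial of x splits already in L, so a and b
    have the same image. *)
Lemma ahom_torsor (L : splittingFieldType k) (M : fieldExtType k) (a b : 'AHom(L, M)) :
  exists g : gal_of {:L}, forall x, b x = a (g x).
Proof.
have ba x : b x \in limg a.
  have [r /eqP rE] := splitting_field_normal 1%AS x.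
  have /polyOver1P[q qE] := minPolyOver 1%AS x.
  have : root (map_poly b (minPoly 1%AS x)) (b x) by rewrite fmorph_root root_minPoly.
  have -> : map_poly b (minPoly 1%AS x) = map_poly a (minPoly 1%AS x).
    by rewrite qE -!map_poly_comp; apply: eq_map_poly => c /=; rewrite !rmorph_alg.
  rewrite rE rmorph_prod (eq_bigr (fun y => 'X - (a y)%:P)); last first.
    by move=> y _; rewrite rmorphB /= map_polyX map_polyC.
  by rewrite -(big_map a xpredT (fun z => 'X - z%:P)) root_prod_XsubC => /mapP[y _ ->];
    rewrite memv_img ?memvf.
pose g := (a^-1 \o b)%VF.
have ag x : a (g x) = b x by rewrite comp_lfunE limg_lfunVK.
have ai := fmorph_inj a.
have [||f _ fE] := @kHom_to_gal _ _ 1%AS {:L}%AS {:L}%AS g _ (normalFieldf _) _.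
- by rewrite sub1v subvf.
- apply/kHom_monoid_morphism; split=> [|x y]; apply: ai; first by rewrite rmorph1 -(rmorph1 b); exact: ag.
  by rewrite rmorphM; transitivity (b (x * y)); [exact: ag|rewrite rmorphM; congr (_ * _); exact: (esym (ag _))].
by exists f => x; rewrite -fE ?memvf // ag.
Qed.

Lemma tag_unit (A B : fieldExtType k) (x : {j : unit & 'AHom(A, B)}) : x = existT _ tt (tagged x).
Proof. by case: x => [[] a]. Qed.

Lemma hom_Sp (U : fet k) (L : fieldExtType k) (Ls : separable 1%AS {:L}) (f g : @hom (fet k) U (Sp Ls)) :
  (forall i : fidx U, forall x, tagged (f i) x = tagged (g i) x) -> f = g.
Proof.
move=> e; apply: functional_extensionality_dep => i.
by rewrite [f i]tag_unit [g i]tag_unit; congr existT; apply: ahom_eq => x; exact: e.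
Qed.

Variables (kbar : closedFieldType) (iota : {rmorphism k -> kbar}).

(** The morphisms of spectra that come from inclusions of subfields of the
    closed field. Between two given subfields there is at most one
    ([over_uniq]), and any two subfields are contained in a third
    ([over_dir]). *)
Definition over (E E' : galsub iota) (f : hom (gSp E') (gSp E)) : Prop :=
  exists2 a : 'AHom(gfld E, gfld E'), gincl a &
    f = @Sp_map k _ _ (galois_sep (ggal E')) (galois_sep (ggal E)) a.

Lemma over_refl (E : galsub iota) : over (idm (gSp E)).
Proof.
exists \1%AF => [x|]; first by rewrite /= id_lfunE.
by apply: functional_extensionality_dep => -[].
Qed.

Lemma over_cmp (E E' E'' : galsub iota) (f : hom (gSp E') (gSp E)) (g : hom (gSp E'') (gSp E')) :
  over f -> over g -> over (cmp f g).
Proof.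
move=> [a aP ->] [b bP ->]; exists (b \o a)%AF => // x.
by rewrite comp_lfunE bP aP.
Qed.

Lemma over_uniq (E E' : galsub iota) (f g : hom (gSp E') (gSp E)) : over f -> over g -> f = g.
Proof.
move=> [a aP ->] [b bP ->]; congr (@Sp_map k _ _ _ _ _); apply: ahom_eq => x.
by apply: (fmorph_inj (gemb E')); rewrite aP bP.
Qed.

Lemma over_dir (E F : galsub iota) : exists (G : galsub iota) (f : hom (gSp G) (gSp E))
  (g : hom (gSp G) (gSp F)), over f /\ over g.
Proof.
have [G [a [b [aP bP]]]] := galsub_join E F.
by exists G, (@Sp_map k _ _ (galois_sep (ggal G)) (galois_sep (ggal E)) a),
  (@Sp_map k _ _ (galois_sep (ggal G)) (galois_sep (ggal F)) b); split; eexists.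
Qed.

(** The morphisms between the spectra of two extensions form a torsor under
    the Galois group of the target, as soon as there is one. *)
Lemma gal_torsor (E E' : galsub iota) (f h : hom (gSp E') (gSp E)) :
  exists g : gal_of {:gfld E}, h = cmp (@gal_Sp k _ (ggal E) g) f.
Proof.
have [g gP] := ahom_torsor (tagged (f tt)) (tagged (h tt)).
exists g; apply: hom_Sp => -[] x /=.
by rewrite comp_lfunE -gP.
Qed.

Lemma gal_free (E E' : galsub iota) (f : hom (gSp E') (gSp E)) (g g' : gal_of {:gfld E}) :
  cmp (@gal_Sp k _ (ggal E) g) f = cmp (@gal_Sp k _ (ggal E) g') f -> g = g'.
Proof.
move=> e; apply/eqP/gal_eqP => x _.
apply: (fmorph_inj (tagged (f tt))).
have := congr1 (fun h : fet_hom (gSp E') (gSp E) => tagged (h tt) x) e.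
by rewrite /= !comp_lfunE.
Qed.

Lemma gal_Sp_inv (E : galsub iota) (g : gal_of {:gfld E}) :
  cmp (@gal_Sp k _ (ggal E) g^-1%g) (@gal_Sp k _ (ggal E) g) = idm (gSp E).
Proof. by rewrite -gal_SpM mulVg gal_Sp1. Qed.

Lemma gal_Sp_invr (E : galsub iota) (g : gal_of {:gfld E}) :
  cmp (@gal_Sp k _ (ggal E) g) (@gal_Sp k _ (ggal E) g^-1%g) = idm (gSp E).
Proof. by rewrite -gal_SpM mulgV gal_Sp1. Qed.

End Torsor.

(** * Colimits over the finite Galois extensions *)

(** Idempotent splitting in the simplex category: s sends t to the last point
    that f maps to something at most t. Since f = f s f, a partial map on a
    standard simplex of dimension p is determined by finitely many of its
    values, those on the p-simplices r = f s, and so are its compatibilities.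
    *)
Lemma dmap_regular m p (f : dmap m p) : exists s : dmap p m, dcmp f (dcmp s f) = f.
Proof.
pose P (t : 'I_p.+1) (s : 'I_m.+1) :=
  ((exists i, (f i <= t)%N) -> (f s <= t)%N) /\ (forall i, (f i <= t)%N -> (i <= s)%N) /\
  (~ (exists i, (f i <= t)%N) -> s = ord0).
have ex t : exists s, P t s.
  have [i0 i0P|no] := pickP (fun i => (f i <= t)%N); last first.
    exists ord0; split; [by case=> i; rewrite no|split=> // i; by rewrite no].
  case: (@arg_maxnP _ i0 (fun i => (f i <= t)%N) (fun i : 'I_m.+1 => i : nat) i0P) => s sP smax.
  exists s; split=> //; split=> [i it|[]]; first exact: smax.
  by exists i0.
have [s sP] := choice ex.
have sm (t u : 'I_p.+1) : (t <= u)%N -> (s t <= s u)%N.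
  move=> tu; have [h1 [_ h3]] := sP t; have [_ [k2 _]] := sP u.
  have [[i it]|no] := pselect (exists i, (f i <= t)%N); last by rewrite h3.
  by apply: k2; apply: leq_trans (h1 _) tu; exists i.
exists (DMap sm); apply: dmap_eq => j /=; apply/val_inj/eqP.
have [h1 [h2 _]] := sP (f j); rewrite eqn_leq h1 /=; last by exists j.
by apply: dmono; exact: h2.
Qed.

Section Colim.
Variables (k : fieldType) (kbar : closedFieldType) (iota : {rmorphism k -> kbar}).
Implicit Types (X Y : sPre (fet k)) (E F G H : galsub iota).

Definition cl X E n (x : X (gSp E) n) : colim iota X n := qcl _ (existT _ E x).

Lemma cl_act X E m n (t : dmap m n) (x : X (gSp E) n) : act t (cl x) = cl (act t x).
Proof. exact: qmap_cl. Qed.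

Lemma cl_map X Y (f : pMap X Y) E n (x : X (gSp E) n) :
  colim_map iota f n (cl x) = cl (f (gSp E) n x).
Proof. exact: qmap_cl. Qed.

Lemma cl_surj X n (q : colim iota X n) : exists E (x : X (gSp E) n), q = cl x.
Proof. by move: q; apply: quot_ind => -[E x]; exists E, x. Qed.

Lemma cl_res X E F (f : hom (gSp F) (gSp E)) n (x : X (gSp E) n) :
  over f -> cl (res X f n x) = cl x.
Proof.
move=> [a aP ->]; symmetry; apply: qcl_eq; apply: rst_step.
by exists a.
Qed.

(** The colimit is filtered, so the equivalence relation generated by the
    transition maps is equality at a later stage. *)
Lemma cl_eq X E F n (x : X (gSp E) n) (y : X (gSp F) n) : cl x = cl y ->
  exists G (f : hom (gSp G) (gSp E)) (g : hom (gSp G) (gSp F)),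
    [/\ over f, over g & res X f n x = res X g n y].
Proof.
move=> e0; have {e0} h0 := qcl_inj e0.
pose J (a b : colim_pt iota X n) := exists G (f : hom (gSp G) (gSp (tag a)))
   (g : hom (gSp G) (gSp (tag b))),
    [/\ over f, over g & res X f n (tagged a) = res X g n (tagged b)].
suff : forall a b, clos_refl_sym_trans _ (@colim_step k kbar iota X n) a b -> J a b.
  by move=> JJ; exact: (JJ _ _ h0).
move=> a b; elim=> {a b h0 x y} [a b [f fP e]|a|a b _ [G [f [g [fP gP e]]]]|
    a b c _ [G1 [f1 [g1 [f1P g1P e1]]]] _ [G2 [f2 [g2 [f2P g2P e2]]]]].
- pose ff := @Sp_map k _ _ (galois_sep (ggal (tag b))) (galois_sep (ggal (tag a))) f.
  exists (tag b), ff, (idm _); split; [by exists f|exact: over_refl|].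
  by rewrite res_id e.
- by exists (tag a), (idm _), (idm _); split=> //; exact: over_refl.
- by exists G, g, f.
- have [G [h1 [h2 [h1P h2P]]]] := over_dir G1 G2.
  exists G, (cmp f1 h1), (cmp g2 h2); split; [exact: over_cmp|exact: over_cmp|].
  rewrite !res_cmp e1 -e2 -!res_cmp; congr (res X _ n _).
  by apply: over_uniq; exact: over_cmp.
Qed.

Lemma cl_eq1 X E n (x y : X (gSp E) n) : cl x = cl y ->
  exists G (f : hom (gSp G) (gSp E)), over f /\ res X f n x = res X f n y.
Proof.
move=> /cl_eq[G [f [g [fP gP e]]]]; exists G, f; split=> //.
by rewrite {2}(over_uniq fP gP).
Qed.

Definition colim_in X E : sMap (X (gSp E)) (colim iota X).
Proof.
refine (@SMap (X (gSp E)) (colim iota X) (fun n x => cl x) _).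
by move=> m n t x; rewrite cl_act.
Defined.

(** Finitely many conditions, each of which holds after some extension and
    persists, hold simultaneously after one extension; the conditions are
    indexed by a type injecting into a finite one. *)
Lemma fin_dir E (A : Type) (T : finType) (c : A -> T)
    (P : A -> forall F, hom (gSp F) (gSp E) -> Prop) : injective c ->
  (forall a F G (f : hom (gSp F) (gSp E)) (g : hom (gSp G) (gSp F)),
    over f -> over g -> P a F f -> P a G (cmp f g)) ->
  (forall a, exists F (f : hom (gSp F) (gSp E)), over f /\ P a F f) ->
  exists F (f : hom (gSp F) (gSp E)), over f /\ forall a, P a F f.
Proof.
move=> ci Pup Pex.
have [F [f [fP fQ]]] : exists F (f : hom (gSp F) (gSp E)), over f /\
    forall a, c a \in enum T -> P a F f; last first.
  by exists F, f; split=> // a; apply: fQ; rewrite mem_enum.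
elim: (enum T) => [|t s [F [f [fP fs]]]].
  by exists E, (idm _); split=> //; exact: over_refl.
have [[a at_]|na] := pselect (exists a, c a = t); last first.
  exists F, f; split=> // a; rewrite inE => /orP[/eqP e|]; last exact: fs.
  by case: na; exists a.
have [G [g [gP ga]]] := Pex a.
have [H [h1 [h2 [h1P h2P]]]] := over_dir F G.
exists H, (cmp f h1); split; first exact: over_cmp.
move=> b; rewrite inE => /orP[/eqP e|bs]; last by apply: Pup => //; exact: fs.
have <- : a = b by apply: ci; rewrite e.
have -> : cmp f h1 = cmp g h2 by apply: over_uniq; exact: over_cmp.
exact: Pup.
Qed.

Definition dcode m n (f : dmap m n) : {ffun 'I_m.+1 -> 'I_n.+1} := [ffun i => f i].

Lemma dcode_inj m n : injective (@dcode m n).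
Proof. by move=> f g /ffunP e; apply: dmap_eq => i; have := e i; rewrite !ffunE. Qed.

(** A map from a subcomplex of a standard simplex into the colimit comes from
    a finite stage. Each of the finitely many p-simplices of S is lifted, the
    finitely many equalities that the endomorphisms of [p] impose on them are
    enforced, and the value at g is computed from that at the p-simplex r of
    [dmap_regular]. *)
Lemma finite_stage X p (S : forall n, simplex p n -> Prop)
    (Gm : forall n, simplex p n -> colim iota X n -> Prop) :
  sclosed S -> sgraph Gm -> (forall n f, S n f -> exists q, Gm n f q) ->
  exists E (G' : forall n, simplex p n -> X (gSp E) n -> Prop),
    [/\ sgraph G', forall n f, S n f -> exists e, G' n f e &
        forall n f e, G' n f e -> S n f /\ Gm n f (cl e)].
Proof.
move=> Sc [Gf Ga] GS; have [E0 _] := galsub_exists iota.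
have [|m F G f g fP gP ef Sm|m|E [f0 [_ xex]]] := @fin_dir E0 _ _ (@dcode p p)
   (fun m F f => S p m -> exists x : X (gSp F) p, Gm p m (cl x)).
- exact: dcode_inj.
- by have [x xP] := ef Sm; exists (res X g p x); rewrite cl_res.
- have [Sm|nS] := pselect (S p m); last by exists E0, (idm _); split=> //; exact: over_refl.
  have [q Gq] := GS p m Sm; have [F [x qx]] := cl_surj q; rewrite qx in Gq.
  have [G [f [g [fP gP]]]] := over_dir E0 F.
  by exists G, f; split=> // _; exists (res X g p x); rewrite cl_res.
pose x0 m (Sm : S p m) := sval (cid (xex m Sm)).
have x0P m Sm : Gm p m (cl (x0 m Sm)) := svalP (cid (xex m Sm)).
pose c2 (mu : dmap p p * dmap p p) := (dcode mu.1, dcode mu.2).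
have [||[m u] |F [f [fP eqs]]] := @fin_dir E _ _ c2 (fun mu F f =>
   forall (Sm : S p mu.1) (Smu : S p (dcmp mu.1 mu.2)),
     act mu.2 (res X f p (x0 _ Sm)) = res X f p (x0 _ Smu)).
- by move=> [a b] [a' b'] [/dcode_inj -> /dcode_inj ->].
- by move=> [a b] F G f g fP gP ab Sm Smu; rewrite !res_cmp -smap_act /= ab.
- have [Sm|nS] := pselect (S p m); last by exists E, (idm _); split; [exact: over_refl|].
  have Smu : S p (dcmp m u) by exact: Sc.
  have [|G [f [fP e]]] := @cl_eq1 X E p (act u (x0 _ Sm)) (x0 _ Smu).
    by rewrite -cl_act; exact: (Gf _ _ _ _ (Ga _ _ u _ _ (x0P _ Sm)) (x0P _ Smu)).
  exists G, f; split=> // Sm' Smu'; rewrite -smap_act /=.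
  by rewrite (Prop_irrelevance Sm' Sm) (Prop_irrelevance Smu' Smu).
pose x m Sm := res X f p (x0 m Sm).
have xP m Sm : Gm p m (cl (x m Sm)) by rewrite /x cl_res.
have [s sP] : {s : forall n, dmap n p -> dmap p n | forall n f, dcmp f (dcmp (s n f) f) = f}.
  have h n (g : dmap n p) := cid (dmap_regular g).
  by exists (fun n g => sval (h n g)) => n g; exact: (svalP (h n g)).
pose r n (g : dmap n p) := dcmp g (s n g).
have rg n g : dcmp (r n g) g = g by rewrite -[RHS](sP n g); exact: dmap_eq.
have rrg m n (t : dmap m n) g : dcmp (r n g) (r m (dcmp g t)) = r m (dcmp g t).
  by apply: dmap_eq => i; exact: (congr1 (fun f : dmap n p => f (t (s _ _ i))) (rg n g)).
(* Since g = r g with r = g s, the value at g is forced by that at r. *)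
exists F, (fun n g e => exists Sr : S p (r n g), e = act g (x _ Sr)); split.
- split=> [n g e e' [Sr ->] [Sr' ->]|m n t g e [Sr ->]].
    by rewrite (Prop_irrelevance Sr Sr').
  have Sr' : S p (r m (dcmp g t)).
    by rewrite -rrg; exact: (Sc _ _ (r m (dcmp g t)) _ Sr).
  exists Sr'; rewrite -act_cmp; change (act t g) with (dcmp g t).
  rewrite -{1}(rg m (dcmp g t)) act_cmp.
  have Srr : S p (dcmp (r n g) (r m (dcmp g t))) by exact: (Sc _ _ (r m (dcmp g t)) _ Sr).
  rewrite (eqs (r n g, r m (dcmp g t)) Sr Srr) /=; congr (act _ _); rewrite -/(x _ Srr).
  by move: Srr; rewrite rrg => Srr; rewrite (Prop_irrelevance Srr Sr').
- move=> n g Sg; have Sr : S p (r n g) by exact: (Sc _ _ (s n g) _ Sg).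
  by exists (act g (x _ Sr)), Sr.
- move=> n g e [Sr ->]; rewrite -cl_act; split.
    by rewrite -(rg n g); exact: (Sc _ _ g _ Sr).
  have := Ga _ _ g _ _ (xP _ Sr); change (act g (r n g : simplex p p)) with (dcmp (r n g) g).
  by rewrite rg.
Qed.

Lemma colim_ext X p (S : forall n, simplex p n -> Prop) : sclosed S ->
  (forall E, extends S (X (gSp E))) -> extends S (colim iota X).
Proof.
move=> Sc eX Gm sG GS; have [E [G' [sG' GS' GG]]] := finite_stage Sc sG GS.
have [//|//|h hG] := eX E G'; exists (smap_cmp (colim_in X E) h) => n f q Sf Gq.
have [e Ge] := GS' n f Sf; rewrite /= (hG n f e Sf Ge).
by have [_] := GG n f e Ge; case: sG => Gf _ /Gf; apply.
Qed.

Lemma colim_kan X : (forall E, kan (X (gSp E))) -> kan (colim iota X).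
Proof.
move=> kX; apply/kan_kan_fib => n i; apply/rlp_ext; apply: colim_ext; first exact: hornP_scl.
by move=> E; apply/rlp_ext; exact: ((kan_kan_fib _).1 (kX E)).
Qed.

Definition locally_solvable X Y (p : pMap X Y) q (S : forall n, simplex q n -> Prop) : Prop :=
  forall E (Gm : forall n, simplex q n -> X (gSp E) n -> Prop) (y : Y (gSp E) q),
  sgraph Gm -> (forall n f, S n f -> exists e, Gm n f e) ->
  (forall n f e, Gm n f e -> p _ n e = act f y) ->
  exists F (f : hom (gSp F) (gSp E)) (w : X (gSp F) q), [/\ over f, p _ q w = res Y f q y &
    forall n t e, S n t -> Gm n t e -> act t w = res X f n e].

Lemma rlp_solvable X Y (p : pMap X Y) q (S : forall n, simplex q n -> Prop) :
  (forall E, rlp S (p (gSp E))) -> locally_solvable p S.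
Proof.
move=> lp E Gm y sG GS Gy.
have [//|//|//|h [hG hb]] := lp E Gm (cls y).
exists E, (idm _), (h q (did q)); split; first exact: over_refl.
  by rewrite hb /= act_id res_id.
by move=> n t e St Ge; rewrite -cls_id res_id; exact: hG.
Qed.

(** The problem, posed on a finite complex, comes from a finite stage, and so
    does its compatibility with p. *)
Lemma colim_rlp X Y (p : pMap X Y) q (S : forall n, simplex q n -> Prop) : sclosed S ->
  locally_solvable p S -> rlp S (colim_map iota p).
Proof.
move=> Sc lp Gm b sG GS Gb.
have [E [G' [[G'f G'a] GS' GG]]] := finite_stage Sc sG GS.
have [F [y yb]] := cl_surj (b q (did q)).
have [G [f [g [fP gP]]]] := over_dir E F.
have [||t|H [h [hP hQ]]] := @fin_dir G _ _ (@dcode q q) (fun t H h =>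
   forall e, G' q t e -> res Y h q (p _ q (res X f q e)) = res Y h q (act t (res Y g q y))).
- exact: dcode_inj.
- by move=> t H I h i hP iP e1 e Ge; rewrite !res_cmp e1.
- have [[e Ge]|ne] := pselect (exists e, G' q t e); last first.
    by exists G, (idm _); split; [exact: over_refl|move=> e Ge; case: ne; exists e].
  have [|H [h [hP e1]]] := @cl_eq1 Y G q (p _ q (res X f q e)) (act t (res Y g q y)).
    rewrite -cl_map cl_res // -cl_act cl_res // -yb -cls_id.
    have [_ Gq] := GG _ _ _ Ge; rewrite (Gb _ _ _ Gq) [LHS]cls_id.
    by rewrite [RHS]cls_id.
  by exists H, h; split=> // e' Ge'; rewrite (G'f _ _ _ _ Ge' Ge).
pose fh := cmp f h; pose gh := cmp g h.
have fhP : over fh by exact: over_cmp.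
have ghP : over gh by exact: over_cmp.
have [|||I [i [w [iP pw wG]]]] := lp H (fun n t e => exists2 e0, G' n t e0 & e = res X fh n e0)
  (res Y gh q y).
- split=> [n t e e' [e0 Ge0 ->] [e1 Ge1 ->]|m n u t e [e0 Ge0 ->]].
    by rewrite (G'f _ _ _ _ Ge0 Ge1).
  by exists (act u e0); [exact: G'a|rewrite smap_act].
- by move=> n t St; have [e Ge] := GS' n t St; exists (res X fh n e), e.
- move=> n t e [e0 Ge0 ->].
  have [s ts] := dmap_regular t.
  have Sr : S q (dcmp t s) by apply: (Sc _ _ s t); case: (GG _ _ _ Ge0).
  have [er Ger] := GS' _ _ Sr.
  have -> : e0 = act t er.
    apply: (G'f _ _ _ _ Ge0); rewrite -{1}ts.
    rewrite (_ : dcmp t (dcmp s t) = act t (dcmp t s : simplex q q)); first exact: G'a.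
    exact: dmap_eq.
  rewrite !smap_act /=; have := hQ _ _ Ger; rewrite -pmap_res -res_cmp -/fh => ->.
  rewrite smap_act -res_cmp -/gh -act_cmp; congr (act _ _).
  by rewrite -[RHS]ts; exact: dmap_eq.
exists (cls (cl w)); split=> n t.
  move=> qq St Gq; have [e Ge] := GS' n t St.
  rewrite -[LHS]/(act t (cl w)) cl_act (wG n t (res X fh n e)) //; last by exists e.
  by rewrite !cl_res //; have [_] := GG _ _ _ Ge; case: sG => Gf _ /Gf; apply.
by rewrite -[cls _ n t]/(act t (cl w)) cl_act cl_map smap_act pw -cl_act !cl_res // -yb -cls_id.
Qed.

(** The solution in the colimit is represented at some stage, and satisfies
    there, after a further extension, the finitely many equations of the
    problem. *)
Lemma rlp_colim_solvable X Y (p : pMap X Y) q (S : forall n, simplex q n -> Prop) : sclosed S ->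
  rlp S (colim_map iota p) -> locally_solvable p S.
Proof.
move=> Sc lp E Gm y [Gf Ga] GS Gy.
have [|||h [hG hb]] := lp (fun n t qq => exists2 e, Gm n t e & qq = cl e) (cls (cl y)).
- split=> [n t e e' [e0 Ge0 ->] [e1 Ge1 ->]|m n u t e [e0 Ge0 ->]].
    by rewrite (Gf _ _ _ _ Ge0 Ge1).
  by exists (act u e0); [exact: Ga|rewrite cl_act].
- by move=> n t St; have [e Ge] := GS n t St; exists (cl e), e.
- by move=> n t _ [e Ge ->]; rewrite cl_map (Gy _ _ _ Ge) -cl_act.
have [F [w0 w0E]] := cl_surj (h q (did q)).
have [G [f [g [fP gP]]]] := over_dir E F.
have [|G1 [g1 [g1P e1]]] := @cl_eq1 Y G q (p _ q (res X g q w0)) (res Y f q y).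
  by rewrite -cl_map !cl_res // -w0E hb -[LHS]/(act (did q) (cl y)) act_id.
have [||t|H [h1 [h1P hQ]]] := @fin_dir G1 _ _ (@dcode q q) (fun t H h1 =>
   forall e, S q t -> Gm q t e -> res X h1 q (res X g1 q (act t (res X g q w0))) =
      res X h1 q (res X g1 q (res X f q e))).
- exact: dcode_inj.
- by move=> t H I h1 i hP iP e2 e St Ge; rewrite !res_cmp (e2 e St Ge).
- have [[e [St Ge]]|ne] := pselect (exists e, S q t /\ Gm q t e); last first.
    by exists G1, (idm _); split; [exact: over_refl|move=> e St Ge; case: ne; exists e].
  have [|H [h1 [h1P e2]]] := @cl_eq1 X G1 q (res X g1 q (act t (res X g q w0)))
     (res X g1 q (res X f q e)).
    rewrite !cl_res // -cl_act cl_res // -w0E -cls_id; apply: hG => //.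
    by exists e.
  by exists H, h1; split=> // e' St' Ge'; rewrite (Gf _ _ _ _ Ge' Ge).
exists H, (cmp f (cmp g1 h1)), (res X (cmp g (cmp g1 h1)) q w0); split.
- by apply: over_cmp => //; exact: over_cmp.
- by rewrite pmap_res !res_cmp -e1 pmap_res.
- move=> n t e St Ge; have [s ts] := dmap_regular t.
  have Sr : S q (dcmp t s) by exact: (Sc _ _ s t).
  have [er Ger] := GS _ _ Sr.
  have -> : e = act t er.
    apply: (Gf _ _ _ _ Ge); rewrite -{1}ts.
    rewrite (_ : dcmp t (dcmp s t) = act t (dcmp t s : simplex q q)); first exact: Ga.
    exact: dmap_eq.
  have := hQ _ _ Sr Ger; rewrite !smap_act !res_cmp => <-.
  by rewrite -act_cmp; congr (act _ _); rewrite -[LHS]ts; exact: dmap_eq.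
Qed.

End Colim.

(** * Subpresheaves, representables and partial map classifiers *)

Section PreGraphs.
Variable C : cat.

Definition pgraph (B E : sPre C) (G : forall U n, B U n -> E U n -> Prop) : Prop :=
  [/\ forall U n x e e', G U n x e -> G U n x e' -> e = e',
      forall U m n (f : dmap m n) x e, G U n x e -> G U m (act f x) (act f e) &
      forall U V (f : hom U V) n x e, G V n x e -> G U n (res B f n x) (res E f n e)].

Lemma pgraph_map (B E : sPre C) (G : forall U n, B U n -> E U n -> Prop) :
  pgraph G -> (forall U n x, exists e, G U n x e) ->
  exists h : pMap B E, forall U n x, G U n x (h U n x).
Proof.
move=> [Gf Ga Gr] Gt; have t U n x := cid (Gt U n x).
have ha U m n (f : dmap m n) x : sval (t U m (act f x)) = act f (sval (t U n x)).
  by apply: (Gf _ _ _ _ _ (svalP (t U m (act f x)))); apply: Ga; exact: svalP.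
pose h U : sMap (B U) (E U) := @SMap (B U) (E U) (fun n x => sval (t U n x)) (ha U).
have hr U V (f : hom U V) n x : h U n (res B f n x) = res E f n (h V n x).
  by apply: (Gf _ _ _ _ _ (svalP (t U n (res B f n x)))); apply: Gr; exact: svalP.
by exists (@PMap C B E h hr) => U n x; exact: svalP.
Qed.

Definition pclosed (B : sPre C) (S : forall U n, B U n -> Prop) : Prop :=
  (forall U m n (f : dmap m n) x, S U n x -> S U m (act f x)) /\
  (forall U V (f : hom U V) n x, S V n x -> S U n (res B f n x)).

Section PSub.
Variables (B : sPre C) (S : forall U n, B U n -> Prop) (Sc : pclosed S).

Definition psub : sPre C.
Proof.
refine (@SPre C (fun U => @Sub (B U) (@S U) (Sc.1 U)) (fun U V f =>
  @SMap (@Sub (B V) (@S V) (Sc.1 V)) (@Sub (B U) (@S U) (Sc.1 U))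
    (fun n x => exist _ (res B f n (sval x)) (Sc.2 U V f n _ (svalP x))) _) _ _).
- by move=> U n [x Sx]; apply: eq_exist; exact: res_id.
- by move=> U V W g f n [x Sx]; apply: eq_exist; exact: res_cmp.
Unshelve.
by move=> m n t [x Sx]; apply: eq_exist; exact: smap_act.
Defined.

Definition pincl : pMap psub B :=
  @PMap C psub B (fun U => incl (Sc.1 U)) (fun _ _ _ _ _ => erefl).

Lemma pincl_cof : cofibration pincl.
Proof. by move=> U n [x Sx] [y Sy] /= e; apply: eq_exist. Qed.

End PSub.

Definition pbox (B : sPre C) (D : sSet) (S : forall U n, B U n -> Prop)
  (T : forall n, D n -> Prop) U n (z : ptensor B D U n) : Prop := S U n z.1 \/ T n z.2.

Lemma pbox_cl (B : sPre C) (D : sSet) (S : forall U n, B U n -> Prop)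
  (T : forall n, D n -> Prop) : pclosed S -> sclosed T -> pclosed (pbox S T).
Proof.
move=> [Sa Sr] Tc; split=> [U m n f [x t] [Sx|Tt]|U V f n [x t] [Sx|Tt]].
- by left; exact: Sa.
- by right; exact: Tc.
- by left; exact: Sr.
- by right.
Qed.

Definition disc (T : Type) : sSet :=
  @SSet (fun=> T) (fun _ _ _ x => x) (fun _ _ => erefl) (fun _ _ _ _ _ _ => erefl).

Definition yo (U : C) : sPre C.
Proof.
refine (@SPre C (fun V => disc (hom V U)) (fun V W f =>
  @SMap (disc (hom W U)) (disc (hom V U)) (fun n g => cmp g f) (fun _ _ _ _ => erefl)) _ _).
- by move=> V n g; exact: cmpm1.
- by move=> V W X g f n h; exact: cmpA.
Defined.

(** The graph of the map out of the representable presheaf, times D, that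
    corresponds by Yoneda to a partial map from D to the sections over U. *)
Definition yograph (U : C) (D : sSet) (E : sPre C) (G : forall n, D n -> E U n -> Prop)
    V n (z : ptensor (yo U) D V n) (e : E V n) : Prop :=
  exists2 e0, G n z.2 e0 & e = res E (z.1 : hom V U) n e0.

Lemma yograph_pgraph (U : C) (D : sSet) (E : sPre C) (G : forall n, D n -> E U n -> Prop) :
  sgraph G -> pgraph (yograph G).
Proof.
move=> [Gf Ga]; split.
- by move=> V n [f d] e e' [e0 G0 ->] [e1 G1 ->]; rewrite (Gf _ _ _ _ G0 G1).
- move=> V m n t [f d] e [e0 G0 ->]; exists (act t e0); first exact: Ga.
  by rewrite smap_act.
- move=> V W g n [f d] e [e0 G0 ->]; exists e0; first exact: G0.
  by rewrite -res_cmp.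
Qed.

Definition at_id (U : C) (D : sSet) (E : sPre C) (h : pMap (ptensor (yo U) D) E) : sMap D (E U).
Proof.
refine (@SMap D (E U) (fun n d => h U n (idm U, d)) _).
by move=> m n t d; rewrite -smap_act.
Defined.

End PreGraphs.

Section PMC.
Variables (C : cat) (A F : sPre C) (a : pMap A F).

(** A simplex of the partial map classifier over U: a simplex y of F together
    with a partial lift R of the map it classifies to A, defined on a
    subpresheaf of the representable presheaf times the standard simplex. *)
Definition pm_ok (U : C) n (y : F U n) (R : forall V m, hom V U -> dmap m n -> A V m -> Prop) : Prop :=
  [/\ forall V m f t x x', R V m f t x -> R V m f t x' -> x = x',
      forall V m f t x W q (g : hom W V) (u : dmap q m), R V m f t x ->
        R W q (cmp f g) (dcmp t u) (res A g q (act u x)) &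
      forall V m f t x, R V m f t x -> a V m x = res F f m (act t y)].

Definition pm_simp (U : C) n : Type :=
  {z : F U n * (forall V m, hom V U -> dmap m n -> A V m -> Prop) | pm_ok z.1 z.2}.

Lemma pm_eq (U : C) n (z z' : pm_simp U n) : (sval z).1 = (sval z').1 ->
  (forall V m f t x, (sval z).2 V m f t x <-> (sval z').2 V m f t x) -> z = z'.
Proof.
case: z z' => [[y R] P] [[y' R'] P'] /= e e'; apply: eq_exist; congr pair => //.
apply: functional_extensionality_dep => V; apply: functional_extensionality_dep => m.
apply/funext => f; apply/funext => t; apply/funext => x; apply/propext; exact: e'.
Qed.

Lemma pm_act_ok (U : C) m n (u : dmap m n) (z : pm_simp U n) :
  @pm_ok U m (act u (sval z).1) (fun V q f t x => (sval z).2 V q f (dcmp u t) x).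
Proof.
case: z => [[y R] [Rf Rc Ra]] /=; split=> //.
- by move=> V q f t x x'; exact: (Rf V q f (dcmp u t)).
- by move=> V q f t x W r g v hx; have := Rc _ _ _ _ _ _ _ g v hx.
- by move=> V q f t x /Ra ->; rewrite -act_cmp.
Qed.

Lemma pm_res_ok (U U' : C) n (h : hom U U') (z : pm_simp U' n) :
  @pm_ok U n (res F h n (sval z).1) (fun V q f t x => (sval z).2 V q (cmp h f) t x).
Proof.
case: z => [[y R] [Rf Rc Ra]] /=; split=> //.
- by move=> V q f t x x'; exact: (Rf V q (cmp h f) t).
- by move=> V q f t x W r g v hx; rewrite cmpA; exact: Rc.
- by move=> V q f t x /Ra ->; rewrite res_cmp smap_act.
Qed.

Definition pm_sec (U : C) : sSet.
Proof.
refine (@SSet (pm_simp U) (fun m n u z => exist _ (act u (sval z).1,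
  fun V q f t x => (sval z).2 V q f (dcmp u t) x) (pm_act_ok u z)) _ _).
- move=> n z; apply: pm_eq => [|V m f t x]; first exact: act_id.
  rewrite /=; suff -> : dcmp (did n) t = t by [].
  exact: dmap_eq.
- by move=> m n p u v z; apply: pm_eq => //=; exact: act_cmp.
Defined.

(** The partial map classifier of a over F. It factors the map a as a
    monomorphism [pm_in] followed by a map [pm_out] that lifts against all
    monomorphisms ([pm_rlp]); no small object argument is involved. *)
Definition pmc : sPre C.
Proof.
refine (@SPre C pm_sec (fun U V h => @SMap (pm_sec V) (pm_sec U) (fun n z =>
  exist _ (res F h n (sval z).1, fun W q f t x => (sval z).2 W q (cmp h f) t x)
    (pm_res_ok h z)) _) _ _).
- by move=> U n z; apply: pm_eq => /= [|V m f t x]; rewrite ?res_id ?cmp1m.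
- by move=> U V W g f n z; apply: pm_eq => /= [|V' m f' t x]; rewrite ?res_cmp ?cmpA.
Unshelve.
by move=> m n t z; apply: pm_eq; rewrite //= smap_act.
Defined.

Definition pm_out : pMap pmc F.
Proof.
exact: (@PMap C pmc F (fun U => @SMap (pm_sec U) (F U) (fun n z => (sval z).1)
  (fun _ _ _ _ => erefl)) (fun _ _ _ _ _ => erefl)).
Defined.

Lemma pm_in_ok (U : C) n (x : A U n) : @pm_ok U n (a U n x)
  (fun V m f t x' => x' = res A f m (act t x)).
Proof.
split.
- by move=> V m f t x1 x2 -> ->.
- by move=> V m f t x1 W q g u ->; rewrite res_cmp act_cmp !smap_act.
- by move=> V m f t x1 ->; rewrite pmap_res smap_act.
Qed.

Definition pm_in : pMap A pmc.
Proof.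
refine (@PMap C A pmc (fun U => @SMap (A U) (pm_sec U) (fun n x =>
  exist _ (a U n x, fun V m f t x' => x' = res A f m (act t x)) (pm_in_ok x)) _) _).
- move=> U V h n x; apply: pm_eq => [|W m f t x'] /=; first by rewrite pmap_res.
  by rewrite res_cmp !smap_act.
Unshelve.
move=> m n t x; apply: pm_eq => [|W q f u x'] /=; first by rewrite smap_act.
by rewrite act_cmp.
Defined.

(** The graph of the full partial lift remembers x as its value at the
    identity. *)
Lemma pm_in_cof : cofibration pm_in.
Proof.
move=> U n x x' e.
have := congr1 (fun z => (sval z).2 U n (idm U) (did n) x) e; rewrite /= !res_id !act_id.
by move=> <-.
Qed.

(** To extend a map into the classifier from S to B, the partial lift at x is
    taken to be defined exactly where it is on the part of the simplices of x
    that lie in S. *)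
Lemma pm_rlp (B : sPre C) (S : forall U n, B U n -> Prop)
    (G : forall U n, B U n -> pmc U n -> Prop) (b : pMap B F) :
  pclosed S -> pgraph G -> (forall U n x, S U n x -> exists e, G U n x e) ->
  (forall U n x e, G U n x e -> pm_out U n e = b U n x) ->
  exists h : pMap B pmc, (forall U n x e, S U n x -> G U n x e -> h U n x = e) /\
    forall U n x, pm_out U n (h U n x) = b U n x.
Proof.
move=> [Sa Sr] [Gf Ga Gr] GS Gb.
pose R U n (x : B U n) V m (f : hom V U) (t : dmap m n) (x' : A V m) : Prop :=
  exists e, [/\ S V m (res B f m (act t x)), G V m (res B f m (act t x)) e &
    (sval e).2 V m (idm V) (did m) x'].
have Rok U n x : @pm_ok U n (b U n x) (R U n x).
  split.
  - move=> V m f t x1 x2 [e [Sx Ge ex]] [e' [_ Ge' ex']].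
    have e1 := Gf _ _ _ _ _ Ge Ge'; rewrite -{}e1 in ex'.
    by case: (svalP e) => Rf _ _; exact: Rf ex ex'.
  - move=> V m f t x1 W q g u [e [Sx Ge ex]].
    exists (res pmc g q (act u e)).
    have -> : res B (cmp f g) q (act (dcmp t u) x) = res B g q (act u (res B f m (act t x))).
      by rewrite res_cmp act_cmp smap_act.
    split; [exact/Sr/Sa|exact/Gr/Ga|].
    case: (svalP e) => _ Rc _; have := Rc _ _ _ _ _ _ _ g u ex.
    rewrite /= cmp1m cmpm1.
    suff -> : dcmp (did m) u = dcmp u (did q) by [].
    exact: dmap_eq.
  - move=> V m f t x1 [e [Sx Ge ex]]; case: (svalP e) => _ _ Ra.
    rewrite (Ra _ _ _ _ _ ex) res_id act_id -[(sval e).1]/(pm_out V m e).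
    by rewrite (Gb _ _ _ _ Ge) pmap_res smap_act.
have [||h hP] := @pgraph_map C B pmc (fun U n x z => (sval z).1 = b U n x /\
   forall V m f t x', (sval z).2 V m f t x' <-> R U n x V m f t x').
- split.
  + move=> U n x z z' [e1 r1] [e2 r2]; apply: pm_eq; first by rewrite e1 e2.
    by move=> V m f t x'; rewrite r1 r2.
  + move=> U m n u x z [e1 r1]; split; first by rewrite smap_act -e1.
    by move=> V q f t x'; rewrite /= r1 /R act_cmp.
  + move=> U V g n x z [e1 r1]; split; first by rewrite pmap_res -e1.
    by move=> W q f t x'; rewrite /= r1 /R res_cmp smap_act.
- by move=> U n x; exists (exist _ (b U n x, R U n x) (Rok U n x)).
exists h; split=> [U n x e Sx Ge|U n x]; last by have [] := hP U n x.
have [h1 h2] := hP U n x; apply: pm_eq; first by rewrite h1 -(Gb _ _ _ _ Ge).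
move=> V m f t x'; rewrite h2.
have Ge' : G V m (res B f m (act t x)) (res pmc f m (act t e)) by exact/Gr/Ga.
have ee : (sval (res pmc f m (act t e))).2 V m (idm V) (did m) x' <-> (sval e).2 V m f t x'.
  rewrite /= cmpm1; suff -> : dcmp t (did m) = t by [].
  exact: dmap_eq.
split=> [[e' [_ Ge1 ex]]|ex].
  by apply/ee; rewrite (Gf _ _ _ _ _ Ge' Ge1).
exists (res pmc f m (act t e)); split; [exact/Sr/Sa|exact: Ge'|exact/ee].
Qed.

(** Sectionwise lifting problems are lifting problems on representables. *)
Lemma pm_sec_rlp (U : C) (D : sSet) (S : forall n, D n -> Prop) : sclosed S -> rlp S (pm_out U).
Proof.
move=> Sc G b sG GS Gb.
have bba V m n (t : dmap m n) (z : ptensor (yo U) D V n) :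
    res F ((act t z).1 : hom V U) m (b m (act t z).2) = act t (res F (z.1 : hom V U) n (b n z.2)).
  by case: z => f d /=; rewrite !smap_act.
pose bb0 V : sMap (ptensor (yo U) D V) (F V) :=
  @SMap (ptensor (yo U) D V) (F V) (fun n z => res F (z.1 : hom V U) n (b n z.2)) (bba V).
have bbr V W (g : hom V W) n z : bb0 V n (res (ptensor (yo U) D) g n z) = res F g n (bb0 W n z).
  by case: z => f d /=; rewrite res_cmp.
have [||||h [hG hb]] := @pm_rlp (ptensor (yo U) D) (pbox (fun _ _ _ => False) S) (yograph G)
  (@PMap C (ptensor (yo U) D) F bb0 bbr).
- by apply: pbox_cl => //; split.
- exact: yograph_pgraph.
- move=> V n [f d] [//|/= Sd]; have [e Ge] := GS n d Sd.
  by exists (res pmc f n e), e.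
- by move=> V n [f d] _ [e Ge ->]; rewrite pmap_res (Gb _ _ _ Ge).
exists (at_id h); split=> n d.
  by move=> e Sd Ge; apply: hG; [right|exists e => //; rewrite res_id].
by rewrite -[at_id h n d]/(h U n (idm U, d)) hb /= res_id.
Qed.

End PMC.

(** * Local weak equivalences and injective fibrant presheaves *)

Lemma bdry_factor p m (f : simplex p m) : bdry f ->
  exists q (j : simplex p q) (g : dmap m q), [/\ (q < p)%N, bdry j & f = dcmp j g].
Proof.
case: p f => [|p] f bf; first by case: (bdry0 bf).
have [j [g fg]] := bdry_face bf; exists p, (face j), g; split=> //.
by exists j => l; rewrite /= eq_sym neq_lift.
Qed.

Lemma weq_image (M N : sSet) (f : sMap M N) (S : forall n, N n -> Prop) (Sc : sclosed S) :
  (forall n, injective (f n)) -> (forall n y, S n y <-> exists x, f n x = y) ->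
  weq f <-> weq (incl Sc).
Proof.
move=> fi im.
have fS n x : S n (f n x) by apply/im; exists x.
pose phi0 n (x : M n) : Sub Sc n := exist _ (f n x) (fS n x).
have phia m n (t : dmap m n) x : phi0 m (act t x) = act t (phi0 n x).
  by apply: eq_exist; exact: smap_act.
pose phi : sMap M (Sub Sc) := @SMap M (Sub Sc) phi0 phia.
have wphi : weq phi.
  apply: weq_bij => n; first by move=> x x' /(congr1 sval) /fi.
  move=> [y Sy]; have [x xy] := (im n y).1 Sy; exists x; exact: eq_exist.
have e : f = smap_cmp (incl Sc) phi by exact: smap_eq.
by split=> w; [apply: (weq_cancel_r wphi); rewrite -e|rewrite e; exact: weq_cmp].
Qed.

Section Local.
Variables (k : fieldType) (kbar : closedFieldType) (iota : {rmorphism k -> kbar}).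
Implicit Types (X Y Z : sPre (fet k)) (E F G H : galsub iota).

(** Filtered colimits are exact. *)
Lemma colim_mono X Y (f : pMap X Y) : cofibration f ->
  forall n, injective (colim_map iota f n).
Proof.
move=> fi n x y; have [E [x0 ->]] := cl_surj x; have [F [y0 ->]] := cl_surj y.
have [G [g [h [gP hP]]]] := over_dir E F.
rewrite -(cl_res x0 gP) -(cl_res y0 hP) !cl_map => /cl_eq1[H [i [iP]]].
rewrite -!pmap_res => /fi e; have := congr1 (fun z => cl z) e.
by rewrite !cl_res.
Qed.

Lemma colim_map_cmp X Y Z (g : pMap Y Z) (f : pMap X Y) :
  colim_map iota (pmap_cmp g f) = smap_cmp (colim_map iota g) (colim_map iota f).
Proof.
apply: smap_eq => n q; have [E [x ->]] := cl_surj q.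
by rewrite -[RHS]/(colim_map iota g n (colim_map iota f n (cl x))) !cl_map.
Qed.

(** Filtered colimits commute with products with a fixed simplicial set; the
    comparison map is a bijection. *)
Lemma ctimes X (D : sSet) : exists t : sMap (colim iota (ptensor X D)) (sprod (colim iota X) D),
  (forall E n (x : X (gSp E) n) d, t n (@cl _ _ _ (ptensor X D) E n (x, d)) = (cl x, d)) /\
  (forall n, injective (t n)) /\ weq t.
Proof.
pose R n (q : colim iota (ptensor X D) n) (z : sprod (colim iota X) D n) :=
  exists E (x : X (gSp E) n) d, q = @cl _ _ _ (ptensor X D) E n (x, d) /\ z = (cl x, d).
have Rf n q z z' : R n q z -> R n q z' -> z = z'.
  move=> [E [x [d [-> ->]]]] [E' [x' [d' [e ->]]]].
  have [G [f [g [fP gP [e1 e2]]]]] := cl_eq e.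
  by rewrite -(cl_res x fP) -(cl_res x' gP) e1 e2.
have [||t tP] := @graph_map (colim iota (ptensor X D)) (sprod (colim iota X) D) R.
- split=> //; move=> m n f q z [E [x [d [-> ->]]]].
  by exists E, (act f x), (act f d); rewrite cl_act /= -cl_act.
- by move=> n q; have [E [[x d] ->]] := cl_surj q; exists (cl x, d), E, x, d.
have tE E n (x : X (gSp E) n) d : t n (@cl _ _ _ (ptensor X D) E n (x, d)) = (cl x, d).
  by apply: Rf (tP _ _) _; exists E, x, d.
have ti n : injective (t n).
  move=> q q'; have [E [[x d] ->]] := cl_surj q; have [E' [[x' d'] ->]] := cl_surj q'.
  rewrite !tE => e0; have {e0} [e1 e2] : cl x = cl x' /\ d = d'.
    by split; [exact: (congr1 fst e0)|exact: (congr1 snd e0)].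
  have [G [f [g [fP gP e]]]] := cl_eq e1; rewrite {}e2.
  rewrite -(@cl_res _ _ _ (ptensor X D) _ _ f _ (x, d') fP).
  by rewrite -(@cl_res _ _ _ (ptensor X D) _ _ g _ (x', d') gP) /= e.
exists t; split=> //; split=> //; apply: weq_bij => // n [q d].
by have [E [x ->]] := cl_surj q; exists (@cl _ _ _ (ptensor X D) E n (x, d)).
Qed.

Definition colS X (S : forall U n, X U n -> Prop) n (q : colim iota X n) : Prop :=
  exists E (x : X (gSp E) n), q = cl x /\ S _ _ x.

Lemma colS_scl X (S : forall U n, X U n -> Prop) : pclosed S -> sclosed (colS S).
Proof.
move=> [Sa _] m n f q [E [x [-> Sx]]]; exists E, (act f x).
by rewrite cl_act; split=> //; exact: Sa.
Qed.

(** The pushout product of monomorphisms of presheaves and of simplicial sets,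
    one of which is acyclic, is a local weak equivalence: its colimit is the
    corresponding box of simplicial sets, which is acyclic by [acyc_box]. *)
Lemma local_weq_box X (D : sSet) (S : forall U n, X U n -> Prop) (T : forall n, D n -> Prop)
    (Sc : pclosed S) (Tc : sclosed T) : acyc (colS S) \/ acyc T ->
  local_weq iota (pincl (pbox_cl Sc Tc)).
Proof.
move=> aST; have [t [tE [ti tw]]] := ctimes X D.
have ScT := box_scl (colS_scl Sc) Tc.
have aB : acyc (box (colS S) T).
  by case: aST => [aS|aT]; [exact: acyc_box|apply: acyc_swap; apply: acyc_box => //; exact: colS_scl].
apply: (weq_cancel_l tw).
apply/(weq_image ScT); last exact: acyc_weq.
- by move=> n x y /= /ti; apply: colim_mono; exact: pincl_cof.
- move=> n [q d]; split.
    case=> [[E [x [/= -> Sx]]]|/= Td].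
      have Bx : pbox S T (x, d) by left.
      exists (@cl _ _ _ (psub (pbox_cl Sc Tc)) E n (exist _ (x, d) Bx)).
      by rewrite /smap_cmp /= -[RHS]tE; congr (t n _); exact: cl_map.
    have [E [x ->]] := cl_surj q; have Bx : pbox S T (x, d) by right.
    exists (@cl _ _ _ (psub (pbox_cl Sc Tc)) E n (exist _ (x, d) Bx)).
    by rewrite /smap_cmp /= -[RHS]tE; congr (t n _); exact: cl_map.
  case=> r; have [E [[[x d'] Bx] ->]] := cl_surj r.
  rewrite -[smap_cmp _ _ n (cl _)]/(t n (colim_map iota (pincl (pbox_cl Sc Tc)) n _)).
  rewrite cl_map tE => e0; rewrite -{q d}e0.
  by case: Bx => [/= Sx|/= Td]; [left; exists E, x|right].
Qed.

(** A local trivial fibration becomes a trivial fibration in the colimit, and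
    so does the map out of the classifier; two out of three gives the map into
    it. *)
Lemma pm_in_local_weq X Y (f : pMap X Y) :
  (forall s, @locally_solvable k kbar iota X Y f s (@bdry s)) -> local_weq iota (pm_in f).
Proof.
move=> fl.
have wf : weq (colim_map iota f).
  apply: rlp_weq => q; apply: colim_rlp; first exact: bdry_scl.
  exact: fl.
have wout : weq (colim_map iota (pm_out f)).
  apply: rlp_weq => q; apply: colim_rlp; first exact: bdry_scl.
  by apply: rlp_solvable => E; apply: pm_sec_rlp; exact: bdry_scl.
apply: (weq_cancel_l wout); rewrite -colim_map_cmp.
by have -> : pmap_cmp (pm_out f) (pm_in f) = f by exact: pmap_eq.
Qed.

Section InjFib.
Variables (Z : sPre (fet k)) (Zf : injective_fibration iota (to_pterm Z)).

Lemma inj_lift X (S : forall U n, X U n -> Prop) (Sc : pclosed S)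
    (Gm : forall U n, X U n -> Z U n -> Prop) :
  local_weq iota (pincl Sc) -> pgraph Gm ->
  (forall U n x, S U n x -> exists e, Gm U n x e) ->
  exists h : pMap X Z, forall U n x e, S U n x -> Gm U n x e -> h U n x = e.
Proof.
move=> lw [Gf Ga Gr] GS.
have [||a aG] := @pgraph_map _ (psub Sc) Z (fun U n x e => Gm U n (sval x) e).
- split=> [U n x e e'|U m n f x e|U V f n x e]; [exact: Gf|exact: Ga|exact: Gr].
- by move=> U n [x Sx]; exact: GS.
have [|h [ha _]] := Zf (@pincl_cof _ _ _ Sc) lw (a := a) (b := to_pterm X).
  exact: pmap_eq.
exists h => U n x e Sx Ge.
pose y : psub Sc U n := exist _ x Sx.
have hx : h U n x = a U n y := congr1 (fun g : pMap (psub Sc) Z => g U n y) ha.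
have ay : Gm U n x (a U n y) := aG U n y.
by rewrite hx; exact: Gf ay Ge.
Qed.

(** A partial map into Z defined on the box extends, because the box is a
    local trivial cofibration ([local_weq_box]). *)
Lemma inj_ext X (D : sSet) (S : forall U n, X U n -> Prop) (T : forall n, D n -> Prop)
    (Gm : forall U n, ptensor X D U n -> Z U n -> Prop) :
  pclosed S -> sclosed T -> acyc (colS S) \/ acyc T -> pgraph Gm ->
  (forall U n x, pbox S T x -> exists e, Gm U n x e) ->
  exists h : pMap (ptensor X D) Z, forall U n x e, pbox S T x -> Gm U n x e -> h U n x = e.
Proof.
by move=> Sc Tc aST; apply: (inj_lift (Sc := pbox_cl Sc Tc)); exact: local_weq_box.
Qed.

(** Extension problems in sections over U are problems on the representable
    presheaf of U. *)
Lemma inj_sec_ext (D : sSet) (T : forall n, D n -> Prop) (U : fet k) :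
  sclosed T -> acyc T -> extends T (Z U).
Proof.
move=> Tc aT Gm sG GT.
have F0 : pclosed (fun (V : fet k) n (_ : yo U V n) => False) by split.
have [||h hG] := @inj_ext (yo U) D _ T (yograph Gm) F0 Tc (or_intror aT).
- exact: yograph_pgraph.
- by move=> V n [f d] [//|/= /GT[e Ge]]; exists (res Z f n e), e.
exists (at_id h) => n d e Td Ge; apply: hG; first by right.
by exists e => //; rewrite res_id.
Qed.

Lemma inj_kan (U : fet k) : kan (Z U).
Proof.
apply/kan_kan_fib => n i; apply/rlp_ext; apply: inj_sec_ext; first exact: hornP_scl.
exact: acyc_horn.
Qed.

(** The sectionwise Postnikov section. The map to it is a local trivial
    fibration as soon as the boundaries of dimension at least n + 2 can be
    filled locally ([to_ppost_solvable]). *)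
Definition ppost (n : nat) : sPre (fet k).
Proof.
refine (@SPre (fet k) (fun U => postnikov n (Z U)) (fun U V f =>
  @SMap (postnikov n (Z V)) (postnikov n (Z U)) (fun m =>
    @qmap _ _ _ _ (res Z f m) _) _) _ _).
- by move=> U m; apply: quot_ind => x; rewrite /= qmap_cl res_id.
- by move=> U V W g f m; apply: quot_ind => x; rewrite /= !qmap_cl res_cmp.
Unshelve.
- by move=> x y xy p t pn; rewrite -!smap_act xy.
- by move=> m q t; apply: quot_ind => x; rewrite /= !qmap_cl smap_act.
Defined.

Definition to_ppost (n : nat) : pMap Z (ppost n).
Proof.
refine (@PMap (fet k) Z (ppost n) (fun U => to_postnikov n (Z U)) _).
by move=> U V f m x; rewrite /= qmap_cl.
Defined.

Lemma colim_pterm_eq n (x y : colim iota (@pterm (fet k)) n) : x = y.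
Proof.
have [E [[] ->]] := cl_surj x; have [F [[] ->]] := cl_surj y.
have [G [f [g [fP gP]]]] := over_dir E F.
by rewrite -(cl_res _ fP) -(cl_res _ gP).
Qed.

Variable n : nat.
Hypothesis colf : forall s, (n.+1 < s)%N -> fill s (colim iota Z).

(** For s at most n + 1, the class of an s-simplex determines its boundary,
    whose nondegenerate simplices have dimension at most n; so any
    representative z will do. In higher dimensions fill the boundary locally;
    the class of the filler is right because its n-skeleton lies in the
    boundary. *)
Lemma to_ppost_solvable s : @locally_solvable k kbar iota _ _ (to_ppost n) s (@bdry s).
Proof.
move=> E Gm y [Gf Ga] GS; move: y; apply: quot_ind => z Gz.
have ske m (t : simplex s m) e : Gm m t e -> skel_eq n e (act t z).
  move=> Ge; have := Gz _ _ _ Ge; rewrite /= qmap_cl => e0.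
  exact: skel_eq_equiv (qcl_inj e0).
have skE m (x x' : Z (gSp E) m) : (m <= n)%N -> skel_eq n x x' -> x = x'.
  by move=> mn /(_ m (did m) mn); rewrite !act_id.
have [sn|ns] := leqP s n.+1.
  exists E, (idm _), z; split; [exact: over_refl|by rewrite /= qmap_cl res_id|].
  move=> m t e bt Ge; rewrite res_id.
  have [q [j [u [qs bj tu]]]] := bdry_factor bt; rewrite {bt}tu in Ge *.
  have [e0 Ge0] := GS _ _ bj; have Ge1 := Ga _ _ u _ _ Ge0.
  rewrite (Gf _ _ _ _ Ge Ge1) act_cmp; congr (act u _); symmetry; apply: skE; last exact: ske.
  lia.
have fl : rlp (@bdry s) (colim_map iota (to_pterm Z)).
  move=> G' b sG' GS' _; have [h hG] := colf ns sG' GS'.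
  by exists h; split=> // m x; exact: colim_pterm_eq.
have [F [f [w [fP _ wG]]]] := rlp_colim_solvable (@bdry_scl s) fl (y := tt)
  (conj Gf Ga) GS (fun _ _ _ _ => erefl).
exists F, f, w; split=> //.
  rewrite /= qmap_cl; apply: qcl_eq; apply: rst_step => r u rn.
  have bu : @bdry s r u by apply: small_bdry; lia.
  have [e Ge] := GS r u bu; rewrite (wG _ _ _ bu Ge) -smap_act; congr (res Z f _ _).
  by apply: skE => //; exact: ske.
Qed.

(** Local fillers give global ones, over any injective fibrant Z. The map from
    Z to its Postnikov quotient P being a local trivial fibration, Z is a
    retract, by rho, of the partial map classifier of Z over P. A boundary in
    Z(U) can be filled up to n-skeletal equality, that is, in P; this filler
    lifts to the classifier, with the given boundary, and rho brings it back
    to Z. *)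
Lemma inj_fill (U : fet k) s : (n.+1 < s)%N -> fill s (Z U).
Proof.
move=> ns Gm sG GS.
pose P := to_ppost n.
have win := pm_in_local_weq to_ppost_solvable.
pose idZ : pMap Z Z := @PMap (fet k) Z Z (fun U => sid (Z U)) (fun _ _ _ _ _ => erefl).
have [|rho [rhoi _]] := Zf (@pm_in_cof _ _ _ P) win (a := idZ) (b := to_pterm _).
  exact: pmap_eq.
have rhoE m (x : Z U m) : rho U m (pm_in P U m x) = x.
  exact: (congr1 (fun g : pMap Z Z => g U m x) rhoi).
have [h hG] := fill_skel (@inj_kan U) ns sG GS.
have [|||H [HG _]] := @pm_sec_rlp _ _ _ P U _ (@bdry s) (@bdry_scl s)
  (fun m t w => bdry t /\ exists2 e, Gm m t e & w = pm_in P U m e) (smap_cmp (P U) h).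
- case: sG => Gf Ga; split=> [m t w w' [_ [e Ge ->]] [_ [e' Ge' ->]]|m q u t w [bt [e Ge ->]]].
    by rewrite (Gf _ _ _ _ Ge Ge').
  by split; [exact: bdry_scl|exists (act u e); [exact: Ga|rewrite smap_act]].
- by move=> m t bt; have [e Ge] := GS m t bt; exists (pm_in P U m e); split=> //; exists e.
- move=> m t w [bt [e Ge ->]]; apply: qcl_eq; apply: rst_step; exact: hG.
exists (smap_cmp (rho U) H) => m t e bt Ge.
by rewrite /smap_cmp /= (HG m t (pm_in P U m e)) ?rhoE //; split=> //; exists e.
Qed.

End InjFib.
End Local.

(** * The Borel construction *)

Section Borel.
Variables (k : fieldType) (kbar : closedFieldType) (iota : {rmorphism k -> kbar}).
Implicit Types (E F G : galsub iota).
Local Open Scope group_scope.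

Notation BE E := (borel (ggal E)).
Notation gS E g := (@gal_Sp k (gfld E) (ggal E) g).

Section One.
Variable E : galsub iota.
Notation gT := (gal_of {:gfld E}).

Lemma gal_Sp_cancel (U : fet k) (g : gT) (s s' : hom U (gSp E)) :
  cmp (gS E g) s = cmp (gS E g) s' -> s = s'.
Proof.
move=> e; have := congr1 (cmp (gS E g^-1)) e.
by rewrite !cmpA gal_Sp_inv !cmp1m.
Qed.

Lemma borel_mk_arr U n (s : hom U (gSp E)) (c : 'I_n.+1 -> gT) (i j : 'I_n.+1) :
  (c j * (c i)^-1 \in 'Gal({:gfld E} / 1%AS)%G) /\
  cmp (gS E (c j * (c i)^-1)) (cmp (gS E (c i)) s) = cmp (gS E (c j)) s.
Proof. by split; [exact: gal_in|rewrite cmpA -gal_SpM mulgKV]. Qed.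

(** A simplex of the Borel construction is a point s with group elements c 0,
    ..., c n: the vertices are the c i s, and the arrow from the i-th to the
    j-th is the quotient. Every simplex has this form ([borelE]). *)
Definition borel_mk U n (s : hom U (gSp E)) (c : 'I_n.+1 -> gT) : BE E U n.
Proof.
refine (@Functor (ord_cat n) (translation 'Gal({:gfld E} / 1%AS)%G (gal_gset (ggal E) U))
  (fun i => cmp (gS E (c i)) s)
  (fun i j _ => exist _ (c j * (c i)^-1) (borel_mk_arr s c i j)) _ _).
- by move=> i; apply: eq_exist; rewrite mulgV.
- by move=> i j l h g; apply: eq_exist; rewrite /= mulgA mulgKV.
Defined.

Definition borel_obj U n (x : BE E U n) (i : 'I_n.+1) : hom U (gSp E) := fob x i.
Definition borel_arr U n (x : BE E U n) (i : 'I_n.+1) : gT :=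
  sval (@fmor _ _ x ord0 i (leq0n i)).

Lemma borel_objE U n (x : BE E U n) i : borel_obj x i = cmp (gS E (borel_arr x i)) (borel_obj x ord0).
Proof. by rewrite /borel_arr; case: (fmor x _) => g [/= _ ->]. Qed.

Lemma borel_arrM U n (x : BE E U n) (i j : 'I_n.+1) (ij : (i <= j)%N) :
  sval (@fmor _ _ x i j ij) = borel_arr x j * (borel_arr x i)^-1.
Proof.
apply: (mulIg (borel_arr x i)); rewrite mulgKV /borel_arr.
have := @fmorM _ _ x ord0 i j ij (leq0n i).
have -> : @cmp (ord_cat n) ord0 i j ij (leq0n i) = leq0n j by exact: (@Prop_irrelevance (is_true (ord0 <= j)%N)).
by move=> ->.
Qed.

Lemma borelE U n (x : BE E U n) : x = borel_mk (borel_obj x ord0) (borel_arr x).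
Proof.
apply: translation_functor_eq => [i|i j ij]; first exact: borel_objE.
exact: borel_arrM.
Qed.

Lemma res_borel_mk U V n (f : hom U V) (s : hom V (gSp E)) (c : 'I_n.+1 -> gT) :
  res (BE E) f n (borel_mk s c) = borel_mk (cmp s f) c.
Proof. by apply: translation_functor_eq => // i; exact: (esym (cmpA (gS E (c i)) s f)). Qed.

Lemma act_borel_mk U m n (t : dmap m n) (s : hom U (gSp E)) (c : 'I_n.+1 -> gT) :
  act t (borel_mk s c) = borel_mk s (fun i => c (t i)).
Proof. exact: translation_functor_eq. Qed.

Lemma borel_obj_res U V n (f : hom U V) (x : BE E V n) i : borel_obj (res (BE E) f n x) i = cmp (borel_obj x i) f.
Proof. by []. Qed.

Lemma borel_arr_res U V n (f : hom U V) (x : BE E V n) i : borel_arr (res (BE E) f n x) i = borel_arr x i.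
Proof. by []. Qed.

Lemma endo_gal (s : hom (gSp E) (gSp E)) : exists g : gT, s = gS E g.
Proof.
have [g ->] := gal_torsor (idm (gSp E)) s.
by exists g; rewrite cmpm1.
Qed.

(** The Galois group acts freely on the points, and all points over a spectrum
    of the extension are translates of the identity. *)
Lemma borel_freely_generated : freely_generated (BE E) (gSp E).
Proof.
split=> [U n x|U f f' y e|U n f f' x y e].
- exists (borel_obj x ord0), (borel_mk (idm _) (borel_arr x)).
  by rewrite res_borel_mk cmp1m -borelE.
- have := congr1 (fun x : BE E U 0%N => borel_obj x ord0) e; rewrite !borel_obj_res.
  have [g ->] := endo_gal (borel_obj y ord0); exact: gal_Sp_cancel.
- have ea i : borel_arr x i = borel_arr y i by rewrite -(borel_arr_res f) e borel_arr_res.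
  have [a xa] := endo_gal (borel_obj x ord0); have [b yb] := endo_gal (borel_obj y ord0).
  exists (cmp (gS E b^-1) (gS E a)); rewrite [x]borelE [y]borelE res_borel_mk.
  rewrite xa yb cmpA gal_Sp_invr cmp1m.
  by congr borel_mk; apply/funext.
Qed.

End One.

(** Over an extension that contains E the action is free, so a simplex is
    determined by its vertices. *)
Lemma borel_obj_inj E G (f : hom (gSp G) (gSp E)) n (x y : BE E (gSp G) n) :
  (forall i, borel_obj x i = borel_obj y i) -> x = y.
Proof.
move=> e; rewrite [x]borelE [y]borelE e; congr borel_mk; apply/funext => i.
have := e i; rewrite (borel_objE x) (borel_objE y) e; exact: gal_free.
Qed.

(** Over an extension G containing E and F the Borel construction is the nerve
    of an indiscrete groupoid: a boundary extends by choosing vertices. *)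
Lemma borel_locally_trivial E s :
  @locally_solvable k kbar iota _ _ (to_pterm (BE E)) s (@bdry s).
Proof.
move=> F Gm [] [Gf Ga] GS _.
have [G [f [h [fP hP]]]] := over_dir E F.
pose v (i : 'I_s.+1) : simplex s 0 := @DMap 0 s (fun=> i) (fun _ _ _ => leqnn _).
pose v0 m (i : 'I_m.+1) : dmap 0 m := @DMap 0 m (fun=> i) (fun _ _ _ => leqnn _).
have cP i : exists g : gal_of {:gfld E}, forall e, Gm 0%N (v i) e ->
    borel_obj (res (BE E) h 0%N e) ord0 = cmp (gS E g) f.
  have [[e Ge]|ne] := pselect (exists e, Gm 0%N (v i) e); last first.
    by exists 1 => e Ge; case: ne; exists e.
  have [g gP] := gal_torsor f (borel_obj (res (BE E) h 0%N e) ord0).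
  by exists g => e' Ge'; rewrite (Gf _ _ _ _ Ge' Ge).
have [c cE] := choice cP.
exists G, h, (borel_mk f c); split=> // m t e bt Ge.
rewrite act_borel_mk; apply: (borel_obj_inj f) => i.
rewrite -[LHS]/(cmp (gS E (c (t i))) f) -(cE (t i) (act (v0 m i) e)).
  by rewrite smap_act.
have := Ga _ _ (v0 m i) _ _ Ge.
suff -> : act (v0 m i) t = v (t i) by [].
exact: dmap_eq.
Qed.

(** Restriction of Galois automorphisms along a morphism f, in a form that
    does not refer to subfields. *)
Lemma gal_restrict E E' (f : hom (gSp E') (gSp E)) : exists r : gal_of {:gfld E'} -> gal_of {:gfld E},
  [/\ forall g, cmp f (gS E' g) = cmp (gS E (r g)) f, r 1 = 1 & forall g h, r (g * h) = r g * r h].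
Proof.
have rP g : exists g', cmp f (gS E' g) = cmp (gS E g') f by exact: gal_torsor.
have [r rE] := choice rP; exists r; split=> // [|g h]; apply: (gal_free (f := f)).
  by rewrite -rE !gal_Sp1 cmpm1 cmp1m.
by rewrite -rE !gal_SpM cmpA rE -!cmpA rE.
Qed.

Section Change.
Variables (E E' : galsub iota) (f : hom (gSp E') (gSp E)).
Variable r : gal_of {:gfld E'} -> gal_of {:gfld E}.
Hypothesis rE : forall g, cmp f (gS E' g) = cmp (gS E (r g)) f.
Hypothesis r1 : r 1 = 1.
Hypothesis rM : forall g h, r (g * h) = r g * r h.

Lemma change_arr U n (x : BE E' U n) (i j : 'I_n.+1) (ij : (i <= j)%N) :
    (r (sval (@fmor _ _ x i j ij)) \in 'Gal({:gfld E} / 1%AS)%G) /\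
    cmp (gS E (r (sval (@fmor _ _ x i j ij)))) (cmp f (fob x i)) = cmp f (fob x j).
Proof.
split; first exact: gal_in.
rewrite cmpA -rE -cmpA; case: (fmor x ij) => g [/= _].
by move=> <-.
Qed.

Definition change U n (x : BE E' U n) : BE E U n.
Proof.
refine (@Functor (ord_cat n) (translation 'Gal({:gfld E} / 1%AS)%G (gal_gset (ggal E) U))
    (fun i => cmp f (fob x i))
    (fun i j ij => exist _ (r (sval (@fmor _ _ x i j ij))) (change_arr x ij)) _ _).
- move=> i; apply: eq_exist.
  by have -> := @fmor1 _ _ x i.
- move=> i j l h g; apply: eq_exist.
  by have -> := @fmorM _ _ x i j l h g; rewrite /= rM.
Defined.

Definition pchange : pMap (BE E') (BE E).
Proof.
refine (@PMap (fet k) (BE E') (BE E) (fun U => @SMap (BE E' U) (BE E U) (@change U) _) _).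
- by move=> U V g n x; apply: translation_functor_eq => // i; exact: (cmpA f (fob x i) g).
Unshelve.
by move=> m n t x; exact: translation_functor_eq.
Defined.

End Change.

(** Restriction of groups and f together map the Borel construction of a
    larger extension to that of a smaller one. *)
Lemma borel_change E E' (f : hom (gSp E') (gSp E)) : inhabited (pMap (BE E') (BE E)).
Proof.
have [r [rE r1 rM]] := gal_restrict f.
exact: inhabits (pchange rE r1 rM).
Qed.

End Borel.

(** * Function complexes out of a freely generated presheaf *)

Section KanPhom.
Variables (C : cat).

Definition pexp (D : sSet) (X : sPre C) : sPre C.
Proof.
refine (@SPre C (fun U => ihom D (X U)) (fun U V f =>
  @SMap (ihom D (X V)) (ihom D (X U)) (fun n g => smap_cmp (res X f) (g : sMap _ _)) _) _ _).
- by move=> U n g; apply: smap_eq => m z /=; rewrite res_id.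
- by move=> U V W g f n h; apply: smap_eq => m z /=; rewrite res_cmp.
Unshelve.
by move=> m n t g; exact: smap_eq.
Defined.

Lemma pexp_res D X U V (f : hom U V) n (g : pexp D X V n) m (t : dmap m n) d :
  (res (pexp D X) f n g : sMap _ _) m (t, d) = res X f m ((g : sMap _ _) m (t, d)).
Proof. by []. Qed.

Variables (B : sPre C) (V : C).
Hypothesis fgB : freely_generated B V.

Definition phom_post (X Y : sPre C) (p : pMap X Y) : sMap (phom B X) (phom B Y).
Proof.
refine (@SMap (phom B X) (phom B Y) (fun n g => pmap_cmp p (g : pMap _ _)) _).
by move=> m n t g; exact: pmap_eq.
Defined.

(** Maps out of B into X parametrized by D are maps from B to the presheaf of
    functions from D to X. By induction over the cells of B, only lifting
    problems in sections over V, against the boundary of a simplex boxed with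
    S, have to be solved. The constraint adm collects the values on S and the
    projection to Y. *)
Lemma phom_rlp (X Y : sPre C) (p : pMap X Y) (D : sSet) (S : forall n, D n -> Prop) :
  sclosed S -> (forall n, rlp (box (@bdry n) S) (p V)) -> rlp S (phom_post p).
Proof.
move=> Sc lp Gm b [Gf Ga] GS Gb.
pose adm U n (x : B U n) (g : pexp D X U n) :=
  (forall m (f : dmap m n) (t : D m) (q : phom B X m), S m t -> Gm m t q ->
    (g : sMap _ _) m (f, t) = (q : pMap _ _) U m (act f x, did m)) /\
  (forall m (f : dmap m n) (t : D m),
    p U m ((g : sMap _ _) m (f, t)) = (b m t : pMap _ _) U m (act f x, did m)).
have [|||||H [vH _ HT]] := @cells C B (pexp D X) V adm _ _ fgB (fun=> True)
  (fun _ _ _ _ => False).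
- move=> U W f n x g [ax bx]; split=> [m t d q hd Gq|m t d].
    by rewrite pexp_res (ax m t d q hd Gq) -pmap_res /= smap_act.
  by rewrite pexp_res pmap_res bx -pmap_res /= smap_act.
- move=> U m n t x g [ax bx]; split=> [q u d r hd Gr|q u d].
    by rewrite -act_cmp -(ax q (dcmp t u) d r hd Gr).
  by rewrite -act_cmp -(bx q (dcmp t u) d).
- by split=> // U f n x [].
- move=> G vG _ n t _ _ bt.
  pose bV m (z : sprod (simplex n) D m) : Y V m := (b m z.2 : pMap _ _) V m (act (z.1 : simplex n m) t, did m).
  have bVa m r (u : dmap m r) z : bV m (act u z) = act u (bV r z).
    case: z => f d; rewrite /bV -smap_act /= smap_act /= act_cmp.
    by congr ((b r d : pMap _ _) V m (_, _)); exact: dmap_eq.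
  have [|||w [wG wb]] := lp n
    (fun m z y => (bdry z.1 /\ exists g : pexp D X V m, G V m (act z.1 t) g /\ (g : sMap _ _) m (did m, z.2) = y) \/
      (S m z.2 /\ exists q : phom B X m, Gm m z.2 q /\ y = (q : pMap _ _) V m (act z.1 t, did m)))
    (@SMap (sprod (simplex n) D) (Y V) bV bVa).
  + have hd m (f : dmap m n) (d : D m) (g : pexp D X V m) (q : phom B X m) :
        S m d -> G V m (act f t) g -> Gm m d q ->
        (g : sMap _ _) m (did m, d) = (q : pMap _ _) V m (act f t, did m).
      by move=> hd Gg Gq; rewrite ((v_adm vG Gg).1 m (did m) d q hd Gq) act_id.
    split.
      move=> m [f d] y y' /= [[bf [g [Gg <-]]]|[h1 [q [Gq ->]]]] [[bf' [g' [Gg' <-]]]|[h1' [q' [Gq' ->]]]].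
      * by rewrite (v_fun vG Gg Gg').
      * exact: hd.
      * by symmetry; exact: hd.
      * by rewrite (Gf _ _ _ _ Gq Gq').
    move=> m r u [f d] y /= [[bf [g [Gg <-]]]|[h1 [q [Gq ->]]]].
      left; split; first exact: bdry_scl.
      exists (act u (g : pexp D X V r)); split; first by rewrite act_cmp; exact: (v_act vG).
      by rewrite -smap_act /=; congr (g m (_, _)); exact: dmap_eq.
    right; split; first exact: Sc.
    exists (act u (q : phom B X r)); split; first exact: Ga.
    rewrite -smap_act /= act_cmp; congr (q V m (_, _)); exact: dmap_eq.
  + move=> m [f d] [/= bf|/= h1].
      have [g Gg] := bt m f bf; exists ((g : sMap _ _) m (did m, d)); left; split=> //.
      by exists g.
    have [q Gq] := GS m d h1; exists ((q : pMap _ _) V m (act f t, did m)); right; split=> //.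
    by exists q.
  + move=> m [f d] y /= [[bf [g [Gg <-]]]|[h1 [q [Gq ->]]]].
      by rewrite ((v_adm vG Gg).2 m (did m) d) act_id.
    by rewrite /bV -(Gb _ _ _ Gq).
  exists w; split; first split.
  + move=> m f d q h1 Gq; apply: wG; first by right.
    by right; split=> //; exists q.
  + by move=> m f d; exact: wb.
  + move=> m f g bf Gg; apply: ihom_eq => q u d; symmetry; apply: wG; first by left; exact: bdry_scl.
    left; split; first exact: bdry_scl.
    exists (act u (g : pexp D X V m)); split; first by rewrite act_cmp; exact: (v_act vG).
    by rewrite /=; congr ((g : sMap _ _) q (_, _)); exact: dmap_eq.
- by [].
have [||h hH] := @pgraph_map C B (pexp D X) H.
- split=> [U n x e e'|U m n f x e|U W f n x e].
  + exact: (v_fun vH).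
  + exact: (v_act vH).
  + exact: (v_res vH).
- by move=> U n x; exact: HT.
have ev m (d : D m) U r n (u : dmap r n) (z : ptensor B (simplex m) U n) :
    (h U r (act u z).1 : sMap _ _) r (did r, act (act u z).2 d) =
    act u ((h U n z.1 : sMap _ _) n (did n, act z.2 d)).
  case: z => x f; rewrite -smap_act.
  have -> : h U r (@act (ptensor B (simplex m) U) r n u (x, f)).1 = act u (h U n x).
    by rewrite /= smap_act.
  rewrite -[LHS]/((h U n x : sMap _ _) r (dcmp u (did r), act (dcmp f u) d)).
  rewrite -[RHS]/((h U n x : sMap _ _) r (dcmp (did n) u, act u (act f d))) act_cmp.
  by congr ((h U n x : sMap _ _) r (_, _)); exact: dmap_eq.
pose L1 m d U : sMap (ptensor B (simplex m) U) (X U) :=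
  @SMap (ptensor B (simplex m) U) (X U) _ (ev m d U).
have L2 m d U W (f : hom U W) n z : L1 m d U n (res _ f n z) = res X f n (L1 m d W n z).
  by case: z => x t; rewrite /= pmap_res.
pose L m d : phom B X m := @PMap C (ptensor B (simplex m)) X (L1 m d) (L2 m d).
have L3 m r (u : dmap m r) (d : D r) : L m (act u d) = act u (L r d).
  apply: pmap_eq => U n [x f].
  by congr ((h U n x : sMap _ _) n (_, _)); rewrite -act_cmp.
exists (@SMap D (phom B X) L L3); split=> m d.
  move=> q hd Gq; apply: pmap_eq => U n [x f] /=.
  have := (v_adm vH (hH U n x)).1 n (did n) _ _ (Sc _ _ f _ hd) (Ga _ _ f _ _ Gq).
  rewrite act_id /= => ->; congr (q U n (_, _)); exact: dmap_eq.
apply: pmap_eq => U n [x f].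
rewrite -[LHS]/(p U n ((h U n x : sMap _ _) n (did n, act f d))).
rewrite (v_adm vH (hH U n x)).2 act_id smap_act /=.
congr ((b m d : pMap _ _) U n (_, _)); exact: dmap_eq.
Qed.

Lemma kan_phom (X : sPre C) : kan (X V) -> kan (phom B X).
Proof.
move=> kX; apply/kan_kan_fib => n i; apply/rlp_ext => G sG GS.
have bb m u (t : dmap m u) (d : simplex n.+1 u) : to_pterm (ptensor B (simplex m)) =
    act (s := phom B (pterm C)) t (to_pterm (ptensor B (simplex u))).
  exact: pmap_eq.
have [|//|//|m d q _|h [hG _]] := @phom_rlp X (pterm C) (to_pterm X) (simplex n.+1) (@hornP n.+1 i)
  (@hornP_scl _ _) _ G
  (@SMap (simplex n.+1) (phom B (pterm C)) (fun m _ => to_pterm (ptensor B (simplex m))) bb).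
- move=> m; apply/rlp_ext; apply: kan_ext_horn => //; exact: bdry_scl.
- exact: pmap_eq.
by exists h.
Qed.

End KanPhom.

Section BorelHom.
Variables (k : fieldType) (kbar : closedFieldType) (iota : {rmorphism k -> kbar}).
Variable E : galsub iota.
Notation BE := (borel (ggal E)).

Lemma borel_kan_phom (X : sPre (fet k)) : (forall U, kan (X U)) -> kan (phom BE X).
Proof. by move=> kX; apply: (kan_phom (borel_freely_generated E)). Qed.

Lemma borel_phom_weq (X Y : sPre (fet k)) (p : pMap X Y) :
  (forall U (D : sSet) (S : forall n, D n -> Prop), sclosed S -> rlp S (p U)) ->
  weq (phom_post BE p).
Proof.
move=> lp; apply: rlp_weq => n.
apply: (phom_rlp (borel_freely_generated E)); first exact: bdry_scl.
by move=> m; apply: lp; apply: box_scl; exact: bdry_scl.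
Qed.

End BorelHom.

(** * The path fibration of a map of presheaves *)

Section PathPre.
Variables (C : cat) (X Z : sPre C) (j : pMap X Z).

Definition pp_res U V (f : hom U V) n (z : mpath (j V) n) : mpath (j U) n.
Proof.
exists (res X f n (sval z).1, smap_cmp (res Z f) ((sval z).2 : sMap _ _)) => m t /=.
by rewrite (svalP z) -smap_act pmap_res.
Defined.

(** The mapping path space in each section. Only the evaluation [pev] at the
    far end is studied: it is a sectionwise fibration that replaces j. *)
Definition ppath : sPre C.
Proof.
refine (@SPre C (fun U => mpath (j U)) (fun U V f =>
  @SMap (mpath (j V)) (mpath (j U)) (@pp_res U V f) _) _ _).
- move=> U n z; apply: mpath_eq => /=; first exact: res_id.
  by apply: smap_eq => m w; exact: res_id.
- move=> U V W g f n z; apply: mpath_eq => /=; first exact: res_cmp.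
  by apply: smap_eq => m w; exact: res_cmp.
Unshelve.
move=> m n t z; apply: mpath_eq => /=; first exact: smap_act.
by apply: smap_eq.
Defined.

Definition pev : pMap ppath Z := @PMap C ppath Z (fun U => mev (j U)) (fun _ _ _ _ _ => erefl).

Definition psec : pMap X ppath.
Proof.
refine (@PMap C X ppath (fun U => msec (j U)) _).
move=> U V f n x; apply: mpath_eq => //=; apply: smap_eq => m w.
rewrite -[LHS]/(j U m (act w.1 (res X f n x))) -smap_act; exact: pmap_res.
Defined.
Definition pfst : pMap ppath X := @PMap C ppath X (fun U => mfst (j U)) (fun _ _ _ _ _ => erefl).

Lemma pev_sec : pmap_cmp pev psec = j.
Proof. by apply: pmap_eq => U n x; exact: mev_sec. Qed.

End PathPre.

Lemma fill_lift s (E F : sSet) (p : sMap E F) : rlp (@bdry s) p -> fill s F -> fill s E.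
Proof.
move=> lp fF G [Gf Ga] GS.
have [||b bG] := fF (fun n d y => bdry d /\ exists2 e, G n d e & y = p n e).
- split=> [n d y y' [_ [e Ge ->]] [_ [e' Ge' ->]]|n m t d y [bd [e Ge ->]]].
    by rewrite (Gf _ _ _ _ Ge Ge').
  by split; [exact: bdry_scl|exists (act t e); [exact: Ga|rewrite smap_act]].
- by move=> n d bd; have [e Ge] := GS n d bd; exists (p n e); split=> //; exists e.
have [|||h [hG _]] := lp (fun n d e => bdry d /\ G n d e) b.
- split=> [n d e e' [_ Ge] [_ Ge']|n m t d e [bd Ge]]; first exact: (Gf _ _ _ _ Ge Ge').
  by split; [exact: bdry_scl|exact: Ga].
- by move=> n d bd; have [e Ge] := GS n d bd; exists e.
- by move=> n d e [bd Ge]; symmetry; apply: bG => //; split=> //; exists e.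
by exists h => n d e bd Ge; apply: hG.
Qed.

Section PathFib.
Variables (k : fieldType) (kbar : closedFieldType) (iota : {rmorphism k -> kbar}).
Variables (X Z : sPre (fet k)) (j : pMap X Z).
Hypothesis kX : forall U, kan (X U).
Hypothesis kZ : forall U, kan (Z U).
Hypothesis wj : local_weq iota j.

Notation W := (ppath j).

Lemma ppath_kan U : kan (W U).
Proof. exact: kan_mpath. Qed.

(** The section of constant paths is inverse to a sectionwise trivial
    fibration. *)
Lemma psec_local_weq : local_weq iota (psec j).
Proof.
have wf : weq (colim_map iota (pfst j)).
  apply: rlp_weq => q; apply: colim_rlp; first exact: bdry_scl.
  by apply: rlp_solvable => E; apply: mfst_rlp => //; exact: bdry_scl.
apply: (weq_cancel_l wf).
have -> : smap_cmp (colim_map iota (pfst j)) (colim_map iota (psec j)) = sid _.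
  by apply: smap_eq => n q; have [E [x ->]] := cl_surj q; rewrite -[LHS]/(colim_map iota (pfst j) n (colim_map iota (psec j) n (cl x))) !cl_map.
exact: weq_sid.
Qed.

(** In the colimit over all extensions, the evaluation is a Kan fibration and
    a weak equivalence of Kan complexes, hence lifts boundaries by Dold; such
    problems descend to finite stages. *)
Lemma pev_solvable s : @locally_solvable k kbar iota W Z (pev j) s (@bdry s).
Proof.
apply: rlp_colim_solvable; first exact: bdry_scl.
have kW : kan (colim iota W) by apply: colim_kan => E; exact: ppath_kan.
have kZ' : kan (colim iota Z) by apply: colim_kan => E.
have wp : weq (colim_map iota (pev j)).
  by apply: (weq_cancel_r psec_local_weq); rewrite -colim_map_cmp pev_sec.
have kp : kan_fib (colim_map iota (pev j)).
  move=> n i; apply: colim_rlp; first exact: hornP_scl.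
  by apply: rlp_solvable => E; exact: mev_kan_fib.
have [g [gp pg]] := weq_hequiv kW kZ' wp.
have L := dold (kan_fib_cyl kp) kW pg gp (@bdry_scl s).
exact: L.
Qed.

Hypothesis Zf : injective_fibration iota (to_pterm Z).
Variable n : nat.
Hypothesis nX : sectionwise_ntype n X.

(** X fills boundaries of dimension at least n + 2 in each section, hence in
    the colimit; so does the colimit of Z, being homotopy equivalent to that
    of X; so does Z in each section, being injective fibrant. Then [fill_rlp]
    applies. *)
Lemma pev_high U s : (n.+1 < s)%N -> rlp (@bdry s) (pev j U).
Proof.
have fX V r : (n.+1 < r)%N -> fill r (X V) by apply: ntype_fill.
have fcX r : (n.+1 < r)%N -> fill r (colim iota X).
  by move=> nr; apply: colim_ext; [exact: bdry_scl|move=> E; exact: fX].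
have kX' : kan (colim iota X) by apply: colim_kan => E.
have kZ' : kan (colim iota Z) by apply: colim_kan => E.
have [g [_ jg]] := weq_hequiv kX' kZ' wj.
have fcZ r : (n.+1 < r)%N -> fill r (colim iota Z).
  by move=> nr; apply: fill_hequiv kZ' jg (fcX r nr).
apply: fill_rlp; [apply: kan_fib_cyl; exact: mev_kan_fib|exact: ppath_kan| |].
- move=> r nr; apply: fill_lift (fX U r nr); apply: (mfst_rlp (f := j U)) => //; exact: bdry_scl.
- by move=> r; exact: (inj_fill Zf fcZ).
Qed.

End PathFib.

(** * Lifting over the Borel construction, skeleton by skeleton *)

Section Skeleton.
Variables (k : fieldType) (kbar : closedFieldType) (iota : {rmorphism k -> kbar}).
Variables (W Z : sPre (fet k)) (p : pMap W Z) (N : nat).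
Hypothesis ploc : forall s, @locally_solvable k kbar iota W Z p s (@bdry s).
Hypothesis phigh : forall U s, (N <= s)%N -> rlp (@bdry s) (p U).
Variables (m : nat) (a : forall n, simplex m n -> W (Spk k) n -> Prop) (b : Z (Spk k) m).
Hypothesis sa : sgraph a.
Hypothesis ab : forall n (t : simplex m n) e, a t e -> p _ n e = act t b.
Implicit Types (E F : galsub iota).

Notation T E := (ptensor (borel (ggal E)) (simplex m)).

Let G0 E U n (x : T E U n) (e : W U n) : Prop :=
  exists e0, [/\ bdry x.2, a x.2 e0 & e = res W (@to_Spk k U : @hom (fet k) U (Spk k)) n e0].
Let adm E U n (x : T E U n) (e : W U n) : Prop :=
  p U n e = res Z (@to_Spk k U : @hom (fet k) U (Spk k)) n (act (x.2 : simplex m n) b).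

Lemma Spk_cmp (U V : fet k) (f : hom U V) :
  cmp (@to_Spk k V : @hom (fet k) V (Spk k)) f = @to_Spk k U.
Proof. exact: to_Spk_eq. Qed.

Let fgT E : freely_generated (T E) (gSp E).
Proof. exact/ptensor_freely_generated/borel_freely_generated. Qed.

Let adm_res E U V (f : hom U V) n (x : T E V n) e :
  adm x e -> @adm E U n (res (T E) f n x) (res W f n e).
Proof. by case: x => x t; rewrite /adm pmap_res => ->; rewrite -res_cmp Spk_cmp. Qed.

Let adm_act E U q n (f : dmap q n) (x : T E U n) e :
  adm x e -> @adm E U q (act f x) (act f e).
Proof.
by case: x => x t h; rewrite /adm smap_act h -smap_act -act_cmp.
Qed.

Let vG0 E : valid (gSp E) (@adm E) (@G0 E).
Proof.
case: sa => af aa; split.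
- by move=> U n x e e' [e0 [_ a0 ->]] [e1 [_ a1 ->]]; rewrite (af _ _ _ _ a0 a1).
- move=> U V f n [x t] e [e0 [bt a0 ->]]; exists e0; split=> //.
  by rewrite -res_cmp Spk_cmp.
- move=> U q n f [x t] e [e0 [bt a0 ->]]; exists (act f e0); split.
  + exact: bdry_scl.
  + exact: aa.
  + by rewrite smap_act.
- by move=> U n [x t] e [e0 [bt a0 ->]]; rewrite /adm pmap_res (ab a0).
- move=> U f n [x t] [e [e0 [bt a0 _]]].
  by exists (res W (@to_Spk k (gSp E)) n e0), e0.
Qed.

Let bd E (G : forall U n, T E U n -> W U n -> Prop) U s (y : T E U s) : valid (gSp E) (@adm E) G ->
  (forall U n (x : T E U n), (n < s)%N -> pdom G x) ->
  forall n (f : simplex s n), bdry f -> pdom G (act f y).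
Proof.
move=> vG Gs n f; case: s y Gs f => [|s] y Gs f; first by move/bdry0.
move=> /bdry_face[i [g ->]]; rewrite act_cmp.
have [e Ge] := Gs _ _ (act (face i) y) (ltnSn s).
by exists (act g e); exact: (v_act vG g Ge).
Qed.

Let tcode E s (y : T E (gSp E) s) :=
  (sval (cid (endo_gal (borel_obj y.1 ord0))), [ffun i => borel_arr y.1 i], dcode y.2).

Let tcode_inj E s : injective (@tcode E s).
Proof.
move=> [x t] [x' t'] [/= e1 /ffunP e2 /dcode_inj ->]; congr pair.
rewrite [x]borelE [x']borelE (svalP (cid (endo_gal (borel_obj x ord0)))) e1.
rewrite -(svalP (cid (endo_gal (borel_obj x' ord0)))); congr borel_mk.
by apply/funext => i; have := e2 i; rewrite !ffunE.
Qed.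

(** Over the skeleta, E grows. Each of the finitely many s-cells y over Sp(E)
    poses a boundary problem for p that is solvable over some extension; one
    extension F serves for all of them. After pulling G back along the map of
    Borel constructions, the s-cells over Sp(F) restrict from cells over Sp(E)
    along translates of f, and receive the values found. *)
Let skeleton s : exists E (G : forall U n, T E U n -> W U n -> Prop),
  [/\ valid (gSp E) (@adm E) G, gle (@G0 E) G &
      forall U n (x : T E U n), (n < s)%N -> pdom G x].
Proof.
elim: s => [|s [E [G [vG G0G Gs]]]].
  by have [E _] := galsub_exists iota; exists E, (@G0 E); split.
pose Q (y : T E (gSp E) s) F (f : hom (gSp F) (gSp E)) := exists w : W (gSp F) s,
  p _ s w = res Z (@to_Spk k (gSp F) : @hom (fet k) (gSp F) (Spk k)) s (act (y.2 : simplex m s) b) /\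
  forall n (t : simplex s n) e, bdry t -> G _ n (act t y) e -> act t w = res W f n e.
have [||y|F [f [fP fQ]]] := @fin_dir k kbar iota E _ _ (@tcode E s) Q.
- exact: tcode_inj.
- move=> y F H f g fP gP [w [pw wG]]; exists (res W g s w); split.
    by rewrite pmap_res pw -res_cmp Spk_cmp.
  by move=> n t e bt Ge; rewrite -smap_act (wG n t e) // res_cmp.
- have bdy := bd y vG Gs.
  have [|||F [f [w [fP pw wG]]]] := @ploc s E (fun n t e => bdry t /\ G _ n (act t y) e)
      (res Z (@to_Spk k (gSp E) : @hom (fet k) (gSp E) (Spk k)) s (act (y.2 : simplex m s) b)).
  + split=> [n t e e' [_ Ge] [_ Ge']|n q u t e [bt Ge]]; first exact: (v_fun vG Ge Ge').
    by split; [exact: bdry_scl|rewrite act_cmp; exact: (v_act vG)].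
  + by move=> n t bt; have [e Ge] := bdy n t bt; exists e.
  + move=> n t e [bt Ge]; have := v_adm vG Ge; rewrite /adm => ->.
    by rewrite -smap_act -act_cmp.
  exists F, f; split=> //; exists w; split; first by rewrite pw -res_cmp Spk_cmp.
  by move=> n t e bt Ge; apply: wG.
have [pi] := borel_change f.
pose G' U n (x : T F U n) (e : W U n) : Prop := G U n (pi U n x.1, x.2) e.
have vG' : valid (gSp F) (@adm F) G'.
  split.
  - by move=> U n x e e'; exact: (v_fun vG).
  - by move=> U V g n [x t] e Ge; rewrite /G' /= pmap_res; exact: (v_res vG g Ge).
  - by move=> U q n u [x t] e Ge; rewrite /G' /= smap_act; exact: (v_act vG u Ge).
  - by move=> U n [x t] e Ge; exact: (v_adm vG Ge).
  - move=> U g n [x t] [e]; rewrite /G' /= pmap_res => Ge.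
    have [h [y xy]] := fg_gen (fgT E) (pi _ n x, t).
    have [|e' Ge'] := v_sat vG (f := cmp h g) (x := y).
      by exists e; rewrite res_cmp -xy.
    exists (res W h n e'); rewrite /= xy; exact: (v_res vG h Ge').
have G0G' : gle (@G0 F) G' by move=> U n [x t] e Ge; apply: G0G.
have [||H [vH G'H HM]] := @cells (fet k) (T F) W (gSp F) (@adm F) (@adm_res F) (@adm_act F)
  (fgT F) (fun n => (n <= s)%N) G' vG'; last first.
- exists F, H; split=> //; by move=> U n x e /G0G' /G'H.
- by move=> n /ltnW.
move=> G1 vG1 G'G1 n [x t] ns nd _.
(* G' is defined below dimension s, so a missing cell has dimension s. *)
have en : n = s.
  apply/eqP; rewrite eqn_leq ns leqNgt; apply/negP => ltns; apply: nd.
  by have [e Ge] := Gs _ _ (pi _ n x, t) ltns; exists e; exact: G'G1.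
move: x t nd; rewrite {n ns}en => x t nd.
have [h [y xy]] := fg_gen (fgT E) (pi _ s x, t).
have [g hg] := gal_torsor f h.
(* h is a translate of f: move the translation into the cell. *)
pose y' := res (T E) (@gal_Sp k _ (ggal E) g) s y.
have xy' : (pi _ s x, t) = res (T E) f s y' by rewrite xy hg res_cmp.
have [w [pw wG]] := fQ y'.
exists w; split; first by rewrite /adm pw; congr (res Z _ s (act _ b)); exact: (esym (congr1 snd xy')).
move=> n u e bu Ge.
have [e' Ge'] := bd y' vG Gs bu.
rewrite (wG n u e' bu Ge'); apply: (v_fun vG1 Ge); apply: G'G1.
rewrite /G' /= smap_act.
rewrite -[X in G _ _ X _]/(@act (T E (gSp F)) n s u (pi _ s x, t)) xy' -smap_act; exact: (v_res vG).
Qed.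

(** The partial lift a of b over the ground field becomes a full lift after
    pulling back to the product of the Borel construction of some extension E
    with the simplex. In dimension N and above the lift is extended cell by
    cell with no change of E. *)
Lemma skeleton_lift : exists E (c : pMap (T E) W),
  (forall U n (x : T E U n) e0, bdry x.2 -> a x.2 e0 ->
     c U n x = res W (@to_Spk k U : @hom (fet k) U (Spk k)) n e0) /\
  forall U n (x : T E U n),
    p U n (c U n x) = res Z (@to_Spk k U : @hom (fet k) U (Spk k)) n (act (x.2 : simplex m n) b).
Proof.
have [E [G [vG G0G Gs]]] := skeleton N; exists E.
have [||H [vH GH HM]] := @cells (fet k) (T E) W (gSp E) (@adm E) (@adm_res E) (@adm_act E)
  (fgT E) (fun=> True) G vG; last first.
- have [||c cH] := @pgraph_map (fet k) (T E) W H.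
  + split=> [U n x e e'|U q n f x e|U V f n x e].
    * exact: (v_fun vH).
    * exact: (v_act vH).
    * exact: (v_res vH).
  + by move=> U n x; exact: HM.
  exists c; split=> [U n x e0 bx ax|U n x]; last exact: (v_adm vH (cH U n x)).
  apply: (v_fun vH (cH U n x)); apply: GH; apply: G0G.
  by exists e0.
- by [].
move=> G1 vG1 GG1 n y _ nd bdy.
have Nn : (N <= n)%N.
  by rewrite leqNgt; apply/negP => nN; apply: nd; have [e Ge] := Gs _ _ y nN; exists e; exact: GG1.
have [|||w [wG wb]] := @phigh (gSp E) n Nn (fun q u e => bdry u /\ G1 _ q (act u y) e)
    (cls (res Z (@to_Spk k (gSp E) : @hom (fet k) (gSp E) (Spk k)) n (act (y.2 : simplex m n) b))).
- split=> [q t e e' [_ Ge] [_ Ge']|q r u t e [bt Ge]]; first exact: (v_fun vG1 Ge Ge').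
  by split; [exact: bdry_scl|rewrite act_cmp; exact: (v_act vG1)].
- by move=> q t bt; have [e Ge] := bdy q t bt; exists e.
- move=> q t e [bt Ge]; have := v_adm vG1 Ge; rewrite /adm => ->.
  by rewrite -[RHS]smap_act -act_cmp.
exists (w n (did n)); split; first by rewrite /adm wb /= act_id.
by move=> q f e bf Ge; rewrite -cls_id; symmetry; exact: wG.
Qed.

End Skeleton.

(** * Descending to global sections *)

Section Final.
Variables (k : fieldType) (kbar : closedFieldType) (iota : {rmorphism k -> kbar}).
Notation toSpk U := (@to_Spk k U : @hom (fet k) U (Spk k)).

(** An injective fibrant Z cannot distinguish A from M along the local trivial
    cofibration i. So H extends from A to M, and restricting the extension to
    a global section t of M gives a map out of D. *)
Lemma inj_descend_along (Z A M : sPre (fet k)) (i : pMap A M) (D : sSet)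
    (S : forall n, D n -> Prop) (G : forall n, D n -> Z (Spk k) n -> Prop)
    (H : pMap (ptensor A D) Z) (t : sMap D (M (Spk k))) :
  injective_fibration iota (to_pterm Z) -> cofibration i -> local_weq iota i ->
  sclosed S -> sgraph G -> (forall n d, S n d -> exists e, G n d e) ->
  (forall U n x d e, S n d -> G n d e -> H U n (x, d) = res Z (toSpk U) n e) ->
  exists h : sMap D (Z (Spk k)), forall n d e, S n d -> G n d e -> h n d = e.
Proof.
move=> Zf ic iw Sc [Gf Ga] GS HG.
pose I U n (z : M U n) := exists x, i U n x = z.
have Ic : pclosed I.
  split=> [U m n f z [x <-]|U V f n z [x <-]]; first by exists (act f x); rewrite smap_act.
  by exists (res A f n x); rewrite pmap_res.
have aI : acyc (colS (iota := iota) I).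
  apply: (weq_acyc (Sc := colS_scl Ic)).
  apply/(weq_image (f := colim_map iota i) (colS_scl Ic)); last exact: iw.
    exact: colim_mono ic.
  move=> n y; split=> [[F [z [-> [x <-]]]]|[x <-]].
    by exists (cl x); rewrite cl_map.
  have [F [x0 ->]] := cl_surj x; rewrite cl_map.
  by exists F, (i _ n x0); split=> //; exists x0.
have [||h hG] := @inj_ext k kbar iota Z Zf M D I S
  (fun U n z e => (exists2 x, i U n x = z.1 & e = H U n (x, z.2)) \/
    (S n z.2 /\ exists2 e0, G n z.2 e0 & e = res Z (toSpk U) n e0)) Ic Sc (or_introl aI).
- split.
  + move=> U n [z d] e e' /= [[x xz ->]|[Sd [e0 G0 ->]]] [[x' xz' ->]|[Sd' [e1 G1 ->]]].
    * by rewrite (ic U n x x') // xz xz'.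
    * exact: HG.
    * by symmetry; exact: HG.
    * by rewrite (Gf _ _ _ _ G0 G1).
  + move=> U m n f [z d] e /= [[x xz ->]|[Sd [e0 G0 ->]]].
      by left; exists (act f x); rewrite ?smap_act ?xz // -smap_act.
    right; split; first exact: Sc.
    by exists (act f e0); [exact: Ga|rewrite smap_act].
  + move=> U V f n [z d] e /= [[x xz ->]|[Sd [e0 G0 ->]]].
      left; exists (res A f n x); first by rewrite pmap_res xz.
      exact: (esym (pmap_res H f (x, d))).
    right; split=> //; exists e0 => //.
    by rewrite -res_cmp (to_Spk_eq (cmp _ _)).
- move=> U n [z d] [/= [x xz]|/= Sd]; first by exists (H U n (x, d)); left; exists x.
  by have [e0 G0] := GS n d Sd; exists (res Z (toSpk U) n e0); right; split=> //; exists e0.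
have ha m n (f : dmap m n) d : h (Spk k) m (t m (act f d), act f d) = act f (h (Spk k) n (t n d, d)).
  by rewrite -smap_act smap_act.
exists (@SMap D (Z (Spk k)) (fun n d => h (Spk k) n (t n d, d)) ha) => n d e Sd Ge /=.
apply: hG; first by right.
right; split=> //; exists e => //.
by rewrite -(to_Spk_eq (idm (Spk k))) res_id.
Qed.

(** A map H on A times D, for a locally contractible A, that comes on S from
    global sections of Z can be replaced by a map out of D with the same
    values on S. As A need not have a global section, it is embedded in its
    partial map classifier over the terminal presheaf, which has sections by
    its lifting property. *)
Lemma inj_descend (Z A : sPre (fet k)) (D : sSet) (S : forall n, D n -> Prop)
    (G : forall n, D n -> Z (Spk k) n -> Prop) (H : pMap (ptensor A D) Z) :
  injective_fibration iota (to_pterm Z) ->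
  (forall s, @locally_solvable k kbar iota _ _ (to_pterm A) s (@bdry s)) ->
  sclosed S -> sgraph G -> (forall n d, S n d -> exists e, G n d e) ->
  (forall U n x d e, S n d -> G n d e -> H U n (x, d) = res Z (toSpk U) n e) ->
  exists h : sMap D (Z (Spk k)), forall n d e, S n d -> G n d e -> h n d = e.
Proof.
move=> Zf Al; pose q : pMap A (pterm (fet k)) := to_pterm A.
have [|||//|t _] := @pm_sec_rlp _ _ _ q (Spk k) D (fun _ _ => False) _ (fun _ _ _ => False)
  (to_unit D).
- by [].
- by split.
- by [].
apply: (inj_descend_along t Zf (@pm_in_cof _ _ _ q)).
exact: pm_in_local_weq.
Qed.

Section Main.
Variables (n : nat) (X Z : sPre (fet k)) (j : pMap X Z).
Hypothesis kX : forall U, kan (X U).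
Hypothesis nX : sectionwise_ntype n X.
Hypothesis dX : finite_descent X.
Hypothesis wj : local_weq iota j.
Hypothesis Zf : injective_fibration iota (to_pterm Z).

Notation W := (ppath j).
Notation p := (pev j (Spk k)).

Let kZ U : kan (Z U).
Proof. exact: (@inj_kan k kbar iota Z Zf U). Qed.

(** Descent is invariant under sectionwise trivial fibrations, since the
    function complex out of the Borel construction preserves them. *)
Lemma ppath_descent (E : galsub iota) : weq (descent_map W (ggal E)).
Proof.
have wq : weq (phom_post (borel (ggal E)) (pfst j)).
  by apply: borel_phom_weq => U D S Sc; exact: mfst_rlp.
have wS : weq (pfst j (Spk k)).
  by apply: rlp_weq => s; apply: (mfst_rlp (f := j (Spk k))) => //; exact: bdry_scl.
apply: (weq_cancel_l wq).
have -> : smap_cmp (phom_post (borel (ggal E)) (pfst j)) (descent_map W (ggal E)) =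
    smap_cmp (descent_map X (ggal E)) (pfst j (Spk k)).
  by apply: smap_eq => s w; exact: pmap_eq.
exact: weq_cmp (dX (ggal E)) wS.
Qed.

(** A simplex b over the ground field, with a lift of its boundary, lifts over
    the Borel construction of some extension E ([skeleton_lift]). By descent
    the lift c is homotopic relative to the boundary to one coming from d over
    the ground field. The image of this homotopy in Z descends to a homotopy K
    over the ground field, from p d to b; lifting K along the fibration p,
    from d, ends at the required lift of b. *)
Lemma pev_rlp m : rlp (@bdry m) p.
Proof.
move=> G b [Gf Ga] GS Gb.
pose b0 := b m (did m).
have bE q (t : simplex m q) : b q t = act t b0 by exact: cls_id.
have [||E [c [cG cb]]] := @skeleton_lift k kbar iota W Z (pev j) n.+2
  (pev_solvable kX kZ wj) (fun U s => pev_high kX kZ wj Zf nX (U := U) (s := s)) m G b0.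
- by split.
- by move=> q t e Ge; rewrite -bE; exact: Gb.
pose B := borel (ggal E).
have kW : kan (W (Spk k)) by exact: ppath_kan.
have kBW : kan (phom B W) by apply: borel_kan_phom => U; exact: ppath_kan.
have [|||d [H [dG Hend Hbd]]] := rhlp kBW kW (ppath_descent E) (D := simplex m) (S := @bdry m)
   (G := fun q t e => bdry t /\ G q t e) (b := cls (c : phom B W m)) (@bdry_scl m).
- split=> [q t e e' [_ Ge] [_ Ge']|q r u t e [bt Ge]]; first exact: (Gf _ _ _ _ Ge Ge').
  by split; [exact: bdry_scl|exact: Ga].
- by move=> q t bt; have [e Ge] := GS q t bt; exists e.
- move=> q t e [bt Ge]; apply: pmap_eq => U r [x u].
  rewrite -[LHS]/(act (u : simplex q r) (res W (toSpk U) q e)).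
  rewrite -[RHS]/(c U r (x, dcmp t u)) -smap_act; symmetry; apply: cG.
    exact: (@bdry_scl m _ _ u t bt).
  exact: Ga.
pose D := sprod (simplex m) (simplex 1).
pose S q (z : D q) := [\/ bdry z.1, ptP ord0 z.2 | ptP ord_max z.2].
have Sc : sclosed S.
  move=> q r u [t v] [/= bt|/= v0|/= v1].
  - by constructor 1; exact: bdry_scl.
  - by constructor 2; exact: ptP_scl.
  - by constructor 3; exact: ptP_scl.
have dbdry q (t : simplex m q) : bdry t -> p q (d q t) = b q t.
  by move=> bt; have [e Ge] := GS q t bt; rewrite (dG q t e) //; exact: Gb.
(* The image of the homotopy in Z, with the two simplex factors made one. *)
pose HH U q (z : ptensor B D U q) : Z U q :=
  pev j U q ((H q z.2 : pMap _ _) U q (z.1, did q)).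
have HHa U q r (u : dmap q r) (z : ptensor B D U r) : HH U q (act u z) = act u (HH U r z).
  case: z => x tv; rewrite -[RHS]smap_act; congr (pev j U q _).
  rewrite -[LHS]/((H q (act u tv) : pMap _ _) U q (act u x, did q)) -[RHS]smap_act.
  have -> : H q (act u tv) = act u (H r tv) by exact: smap_act.
  congr ((H r tv : pMap _ _) U q (_, _)); exact: dmap_eq.
pose HH1 U : sMap (ptensor B D U) (Z U) := @SMap (ptensor B D U) (Z U) (HH U) (HHa U).
have HHr U V (f : hom U V) q z : HH1 U q (res (ptensor B D) f q z) = res Z f q (HH1 V q z).
  by case: z => x tv; rewrite /= /HH -[RHS]pmap_res -pmap_res.
pose HP : pMap (ptensor B D) Z := @PMap (fet k) (ptensor B D) Z HH1 HHr.
have cE U q (x : B U q) (t : simplex m q) :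
    pev j U q ((cls (c : phom B W m) q t : pMap _ _) U q (x, did q)) = res Z (toSpk U) q (b q t).
  by rewrite bE -(cb U q (x, t)); congr (pev j U q (c U q (x, _))); exact: dmap_eq.
have [|||K KP] := @inj_descend Z B D S
  (fun q z e => (ptP ord0 z.2 /\ e = p q (d q z.1)) \/
    ((bdry z.1 \/ ptP ord_max z.2) /\ e = b q z.1)) HP Zf (@borel_locally_trivial k kbar iota E) Sc.
- split.
  + move=> q [t u] e e' /= [[u0 ->]|[bu ->]] [[u0' ->]|[bu' ->]] //.
    * by case: bu' => [/dbdry|/(ptP01 u0)].
    * by case: bu => [/dbdry/esym|/(ptP01 u0')].
  + move=> q r f [t u] e /= [[u0 ->]|[bu ->]].
      have dp : p q (d q (act f t)) = act f (p r (d r t)) by rewrite !smap_act.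
      by left; split; [exact: ptP_scl|exact: (esym dp)].
    right; split; last by rewrite smap_act.
    by case: bu => h; [left; exact: bdry_scl|right; exact: ptP_scl].
- move=> q [t u] [/= h|/= h|/= h].
  + by exists (b q t); right; split=> //; left.
  + by exists (p q (d q t)); left.
  + by exists (b q t); right; split=> //; right.
- have HE U q x t u : HP U q (x, (t, u)) =
      pev j U q ((H q (t, u) : pMap _ _) U q (x, did q)) by [].
  move=> U q x [t u] e _ [[/ptPE u0 ->]|[bu ->]]; rewrite HE.
    rewrite (u0 : u = _) (Hend q t).1 -[RHS](pmap_res (pev j)); congr (pev j U q _).
    exact: act_id.
  case: bu => [bt|/ptPE u1]; first by rewrite (Hbd q t u bt) cE.
  by rewrite (u1 : u = _) (Hend q t).2 cE.
have pfib : cyl_fib p by apply: kan_fib_cyl; exact: mev_kan_fib.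
have [|||M [MG Mb]] := pfib (simplex m) (@bdry m) ord0 (@bdry_scl m)
  (fun q z e => (bdry z.1 /\ G q z.1 e) \/ (ptP ord0 z.2 /\ e = d q z.1)) K.
- split.
  + move=> q [t u] e e' /= [[bt Ge]|[u0 ->]] [[bt' Ge']|[u0' ->]] //.
    * exact: (Gf _ _ _ _ Ge Ge').
    * by symmetry; apply: dG.
    * by apply: dG.
  + move=> q r f [t u] e /= [[bt Ge]|[u0 ->]].
      by left; split; [exact: bdry_scl|exact: Ga].
    by right; split; [exact: ptP_scl|rewrite smap_act].
- move=> q [t u] [/= bt|/= u0].
    by have [e Ge] := GS q t bt; exists e; left.
  by exists (d q t); right.
- move=> q [t u] e /= [[bt Ge]|[u0 ->]].
    rewrite (KP q (t, u) (b q t)); [exact: Gb|by constructor 1|].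
    by right; split=> //; left.
  by rewrite (KP q (t, u) (p q (d q t))) //; [constructor 2|left].
exists (smap_cmp M (at_end (simplex m) ord_max)); split=> q t.
  by move=> e bt Ge; apply: MG; left.
rewrite -[LHS]/(p q (M q (t, dconst q ord_max))) Mb.
apply: KP; first by constructor 3.
by right; split=> //; right.
Qed.

Lemma descent_sections_weq : weq (j (Spk k)).
Proof.
have -> : j (Spk k) = smap_cmp p (msec (j (Spk k))).
  by apply: smap_eq => q x; rewrite /= act_id.
by apply: weq_cmp; [apply: rlp_weq; exact: pev_rlp|exact: msec_weq].
Qed.

End Main.
End Final.

Theorem corollary20 (k : fieldType) (kbar : closedFieldType)
    (iota : {rmorphism k -> kbar})
    (kbar_algebraic : forall x : kbar, algebraicOver iota x)
    (n : nat) (X Z : sPre (fet k)) (j : pMap X Z)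
    (X_kan : forall U : fet k, kan (X U))
    (X_ntype : sectionwise_ntype n X)
    (X_descent : finite_descent X)
    (j_model : injective_fibrant_model iota j) :
  weq (j (Spk k)).
Proof. by case: j_model; exact: descent_sections_weq. Qed.
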